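(* Let $F:\mathbb{C}^n\to\mathbb{C}^m$, $n\ge2$, be a polynomial mapping and let $S\subset\mathbb{C}^n$ be an unbounded algebraic set. If $\#(F|S)^{-1}(0)<\infty$, then $\mathcal{L}_\infty(F|S)\in N(F|S)\cap\mathbb{Q}$. Moreover, there exist $R>0$ and a curve $\varphi:\{t\in\mathbb{C}:|t|>R\}\to\mathbb{C}^n$, meromorphic at $\infty$, such that $\varphi(t)\in S$ for all $t$ with $|t|>R$, $\|\varphi(t)\|\to+\infty$ for $t\to\infty$, and $$\|F\circ\varphi(t)\|\sim\|\varphi(t)\|^{\mathcal{L}_\infty(F|S)}\qquad\text{for } t\to\infty.$$
   Context: $\|\cdot\|$ denotes the Euclidean norm. For a polynomial mapping $F:\mathbb{C}^n\to\mathbb{C}^m$ and an unbounded algebraic set $S\subset\mathbb{C}^n$ put $$N(F|S):=\{\nu\in\mathbb{R} : \exists A>0,\ \exists B>0,\ \forall z\in S,\ (\|z\|>B\Rightarrow A\|z\|^\nu\le\|F(z)\|)\}$$ (using the maximum norm instead gives the same set). The Łojasiewicz exponent at infinity of $F|S$ is $\mathcal{L}_\infty(F|S):=\sup N(F|S)$, with the convention $\sup\emptyset=-\infty$. A curve $\varphi=(\varphi_1,\dots,\varphi_n):\{t\in\mathbb{C}:|t|>R\}\to\mathbb{C}^n$ is meromorphic at $\infty$ if each $\varphi_i$ is holomorphic on $\{|t|>R\}$ and meromorphic at $\infty$, i.e. is the sum there of a Laurent series with only finitely many terms with positive powers of $t$. $g(t)\sim h(t)$ for $t\to\infty$, for nonnegative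 functions $g,h$, means that there are constants $c_1,c_2>0$ with $c_1h(t)\le g(t)\le c_2h(t)$ for all $t$ with $|t|$ sufficiently large. *)

(* Defs.v *)
From HB Require Import structures.
From mathcomp Require Import all_boot all_order all_algebra.
From mathcomp Require Import complex.
From mathcomp Require Import all_classical all_reals all_analysis.
From mathcomp Require mpoly.
Import -(notations) mpoly.
Import Order.TTheory GRing.Theory Num.Theory.
Import numFieldNormedType.Exports.

Set Implicit Arguments.
Unset Strict Implicit.
Unset Printing Implicit Defensive.

Local Open Scope classical_set_scope.
Local Open Scope ring_scope.

(* [cabs z : R], whereas the norm [`|z|] of the library lives in [R[i]]. *)
Definition cabs (R : realType) (z : R[i]) : R := ComplexField.Normc.normc z.

(* The Euclidean norm on C^n; the norm of the library on matrices is the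
   maximum norm. *)
Definition enorm (R : realType) (n : nat) (z : 'rV[R[i]]_n) : R :=
  Num.sqrt (\sum_(i < n) cabs (z 0 i) ^+ 2).

(* The polynomials are those of multinomials: [mpoly n K] is K[X_0..X_(n-1)]. *)
Definition peval (R : realType) (n : nat) (p : mpoly n R[i])
    (z : 'rV[R[i]]_n) : R[i] :=
  meval (fun i => z 0 i) p.

Definition polynomial_map (R : realType) (n m : nat)
    (F : 'rV[R[i]]_n -> 'rV[R[i]]_m) : Prop :=
  exists P : 'I_m -> mpoly n R[i], forall z j, F z 0 j = peval (P j) z.

Definition algebraic_set (R : realType) (n : nat)
    (S : set 'rV[R[i]]_n) : Prop :=
  exists ps : seq (mpoly n R[i]),
    S = [set z | forall p, p \in ps -> peval p z = 0].

Definition unbounded (R : realType) (n : nat) (S : set 'rV[R[i]]_n) : Prop :=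
  forall M : R, exists2 z, S z & M < enorm z.

Definition loj_set (R : realType) (n m : nat)
    (F : 'rV[R[i]]_n -> 'rV[R[i]]_m) (S : set 'rV[R[i]]_n) : set R :=
  [set nu | exists A B : R, [/\ 0 < A, 0 < B &
    forall z, S z -> B < enorm z -> A * enorm z `^ nu <= enorm (F z)]].

(* [ereal_sup set0 = -oo]. *)
Definition loj_exp (R : realType) (n m : nat)
    (F : 'rV[R[i]]_n -> 'rV[R[i]]_m) (S : set 'rV[R[i]]_n) : \bar R :=
  ereal_sup (EFin @` loj_set F S).

Definition holomorphic_outside (R : realType) (r : R) (f : R[i] -> R[i]) :
    Prop :=
  forall t, r < cabs t -> derivable (f : R[i]^o -> R[i]^o) t 1.

(* The Laurent series is the sum over k of a_k t^(d - k), so that d bounds its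
   positive powers. *)
Definition laurent_outside (R : realType) (r : R) (f : R[i] -> R[i]) : Prop :=
  exists (d : nat) (a : nat -> R[i]), forall t : R[i], r < cabs t ->
    series (fun k => a k * t ^ (d%:Z - k%:Z) : R[i]^o) @ \oo --> (f t : R[i]^o).

(* A curve on {|t| > r} is a total function, whose values at the other points
   are irrelevant. *)
Definition meromorphic_at_infty (R : realType) (n : nat) (r : R)
    (phi : R[i] -> 'rV[R[i]]_n) : Prop :=
  forall i : 'I_n, holomorphic_outside r (fun t => phi t 0 i) /\
                   laurent_outside r (fun t => phi t 0 i).

Definition tends_to_pinfty (R : realType) (g : R[i] -> R) : Prop :=
  forall M : R, exists r : R, forall t, r < cabs t -> M < g t.

Definition asymp_equiv (R : realType) (g h : R[i] -> R) : Prop :=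
  exists c1 c2 : R, [/\ 0 < c1, 0 < c2 &
    exists r : R, forall t, r < cabs t -> c1 * h t <= g t <= c2 * h t].

(* Main.v *)
Require Import Defs.
From HB Require Import structures.
From mathcomp Require Import all_boot all_order all_algebra.
From mathcomp Require Import complex ordered_qelim qe_rcf.
From mathcomp Require Import all_classical all_reals all_analysis.
From mathcomp Require Import zify ring lra.
From mathcomp Require mpoly.
Import -(notations) mpoly.
Import Order.TTheory GRing.Theory Num.Theory.
Import numFieldNormedType.Exports.

(* On a sphere |z| = r meeting S choose a point minimising |F|.  By quantifier
   elimination over R the set of the pairs (r, minimiser) is semialgebraic, and
   its coordinates can be selected one after the other as germs, for r -> +oo,
   of convergent Puiseux series in 1/r: over such a germ, the truth of a
   quantifier-free condition on the next coordinate y only changes at the roots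
   of finitely many polynomials in y, whose roots are again convergent Puiseux
   series, so that y can be replaced by a midpoint or a translate of these.
   Putting r = t^N gives a curve phi(t) of convergent Laurent series with
   |phi(t)| = t^N for large real t, on which |F| is minimal on every large
   sphere; hence the exponent is d / N, where |F(phi(t))| ~ t^d, and it is
   attained.  F o phi does not vanish identically because F has finitely many
   zeros on S.  As the algebraic equations of S hold for the Laurent series,
   they extend to all complex t near infinity.

   Puiseux's theorem for convergent series is proved with the Newton polygon
   and Hensel's lemma, the convergence of the lifted factors resulting from a
   quadratic recurrence on the norms of their coefficients. *)

Set Implicit Arguments.
Unset Strict Implicit.
Unset Printing Implicit Defensive.

Local Open Scope ring_scope.

(** * Convergent power series *)

(** Minimality of phi is known only on a real half-line, where the order of R can be used, whereas
    the curve has to live over complex t. The bridge is analytic: a Laurent germ at infinity either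
    vanishes identically or is comparable to an integer power of |t|. Hence equations and growth
    exponents read off on the real axis hold for all large complex t, although phi(t) need not
    minimise |F| there. For this reason real germs are restrictions of complex Laurent germs; and
    formal series would not do, since formulas are evaluated at actual points.

    Selection keeps one of finitely many candidates, so it only ensures that a condition holds for
    arbitrarily large x. As signs of germs are eventually constant, a first-order condition on germs
    that holds for arbitrarily large x holds for all large x.

    Each extraction of roots may force a substitution of x^(n+1) for x. The radius is a free
    variable of the formula, never selected but only reparametrised, so that it ends up as an exact
    power x^(N+1), which makes the exponent rational. *)

Lemma strong_recursion (T : Type) (x0 : T) (step : (nat -> T) -> nat -> T) :
  (forall f g k, (forall j, (j < k)%N -> f j = g j) -> step f k = step g k) ->
  exists f, forall k, f k = step f k.
Proof.
move=> loc.
pose upd (f : nat -> T) n k := if k == n then step f n else f k.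
(* [F n] is correct at the arguments below [n], and each stage fixes one more value; the solution is
   the diagonal. *)
pose F := fix F n := if n is m.+1 then upd (F m) m else fun=> x0.
have FE n k : (k < n)%N -> F n k = F k.+1 k.
  elim: n => // n IH; rewrite ltnS leq_eqVlt => /orP[/eqP-> //|kn].
  by rewrite -(IH kn) /= /upd (ltn_eqF kn).
exists (fun k => F k.+1 k) => k; rewrite /= {1}/upd eqxx; apply: loc => j jk.
exact: FE.
Qed.

(** * Geometric bounds and quadratic recurrences *)

Section Recurrence.
Variable K : numFieldType.

(** This is a positive radius of convergence, expressed by a single constant: with the exponent
    [k.+1], [M] also bounds the term of order 0, and [1 <= M] allows exponents to be raised
    freely. *)
Definition geometric (a : nat -> K) :=
  exists2 M : K, 1 <= M & forall k, `|a k| <= M ^+ k.+1.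

Lemma geometricI (a : nat -> K) (C M : K) :
  (forall k, `|a k| <= C * M ^+ k) -> 0 <= M -> geometric a.
Proof.
move=> le_a M0.
have C0 : 0 <= C by have := le_a 0%N; rewrite expr0 mulr1; apply: le_trans.
exists ((1 + C) * (1 + M)).
  by rewrite -[leLHS]mul1r ler_pM ?ler01 // lerDl.
move=> k; apply: le_trans (le_a k) _.
rewrite exprMn ler_pM ?exprn_ge0 //.
  rewrite exprS -[leLHS]mulr1 ler_pM ?ler01 //.
    by rewrite lerDr ler01.
  by rewrite exprn_ege1 // lerDl.
rewrite exprS -[leLHS]mul1r ler_pM ?ler01 ?exprn_ge0 //.
  by rewrite lerDl.
by rewrite lerXn2r ?nnegrE ?addr_ge0 ?ler01 // lerDr ler01.
Qed.

(** The pairs [(j, k - j)] with [k < n] lie in the square of side [n], and all terms are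
    non-negative. *)
Lemma conv_sum_le (a b : nat -> K) n :
  (forall k, 0 <= a k) -> (forall k, 0 <= b k) ->
  \sum_(k < n) \sum_(j < k.+1) a j * b (k - j)%N <=
  (\sum_(j < n) a j) * (\sum_(l < n) b l).
Proof.
move=> a0 b0.
have E k : (k < n)%N -> \sum_(j < k.+1) a j * b (k - j)%N =
    \sum_(j < n) (if (j <= k)%N then a j * b (k - j)%N else 0).
  move=> kn; rewrite -big_mkcond /=.
  by rewrite (big_ord_widen_cond n xpredT (fun j => a j * b (k - j)%N)) // kn.
rewrite (eq_bigr (fun k : 'I_n => \sum_(j < n) (if (j <= k)%N then a j * b (k
  - j)%N else 0))) => [|k _]; last exact: E.
rewrite exchange_big /= mulr_suml; apply: ler_sum => j _.
rewrite -big_mkcond /= -mulr_sumr ler_wpM2l //.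
rewrite -(big_mkord (fun i => j <= i)%N (fun i => b (i - j)%N)) /=.
rewrite -(big_mkord xpredT b).
rewrite (@big_cat_nat _ _ _ j) //=; last exact: ltnW.
rewrite [X in X + _]big1_seq => [|i /andP[ji]]; last first.
  by rewrite mem_index_iota ltnNge ji andbF.
rewrite add0r -{1}[j : nat]add0n big_addn.
apply: le_trans (_ : \sum_(0 <= i < n - j) b i <= _).
  rewrite le_eqVlt; apply/orP; left; apply/eqP.
  by apply: eq_big => [i|i _]; rewrite ?leq_addl // addnK.
rewrite [leRHS](@big_cat_nat _ _ _ (n - j)%N) ?leq_subr //=.
by rewrite lerDl sumr_ge0.
Qed.

Lemma half_sum_le n : \sum_(k < n) (2^-1) ^+ k <= 2 :> K.
Proof.
have -> : \sum_(k < n) (2^-1) ^+ k = 2 - 2 * (2^-1) ^+ n :> K.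
  elim: n => [|n IH]; first by rewrite big_ord0 expr0 mulr1 subrr.
  by rewrite big_ord_recr /= IH exprS; field.
by rewrite lerBlDr lerDl mulr_ge0 // exprn_ge0 // invr_ge0.
Qed.

(* The weighted partial sums s n of x satisfy s (n + 1) <= e + M * (s n) ^+ 2,
   with e as small as desired when the weight is small; hence they stay below
   2 * e. *)
Lemma quadratic_recurrence (x p : nat -> K) (M : K) :
  (forall k, 0 <= x k) -> 0 <= M -> geometric p ->
  (forall k, x k.+1 <= M * (`|p k.+1| + \sum_(j < k) x j.+1 * x (k - j)%N)) ->
  geometric x.
Proof.
move=> x0 M0 [D D1 pD] rec.
have D0 : 0 < D := lt_le_trans ltr01 D1.
pose N := 1 + M; have N1 : 1 <= N by rewrite lerDl.
have N0 : 0 < N := lt_le_trans ltr01 N1.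
have MN : M <= N by rewrite lerDr ler01.
(* With this [e] the bound [2 * e] reproduces itself, as [N * (2 * e) ^+ 2 = e]. The next constant
   [T] satisfies [2 * N * D / T = e], which makes the weighted contribution of [p] at most [e]. *)
pose e := (4 * N)^-1; have e0 : 0 < e by rewrite invr_gt0 mulr_gt0.
pose T := 8 * N ^+ 2 * D; have T0 : 0 < T by rewrite !mulr_gt0 ?exprn_gt0.
have T2 : 2 <= T.
  rewrite -[leLHS]mulr1 ler_pM ?ler01 // -[leLHS]mulr1 ler_pM ?ler01 //.
    by rewrite ler_nat.
  by rewrite exprn_ege1.
pose w := (D * T)^-1; have w0 : 0 < w by rewrite invr_gt0 mulr_gt0.
pose y k := x k.+1 * w ^+ k.+1.
have y0 k : 0 <= y k by rewrite mulr_ge0 // exprn_ge0 // ltW.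
have Psum n : N * (\sum_(k < n) `|p k.+1| * w ^+ k.+1) <= e.
  apply: le_trans (_ : N * (D / T * \sum_(k < n) (2^-1) ^+ k) <= _); last first.
    apply: le_trans (_ : N * (D / T * 2) <= _).
      rewrite !ler_wpM2l ?half_sum_le ?divr_ge0 // ltW //.
    rewrite le_eqVlt; apply/orP; left; apply/eqP; rewrite /e /T.
    field; rewrite ?gt_eqF //.
  rewrite ler_wpM2l ?(ltW N0) // mulr_sumr; apply: ler_sum => k _.
  apply: le_trans (ler_wpM2r _ (pD k.+1)) _; first by rewrite exprn_ge0 // ltW.
  rewrite /w exprVn exprMn invfM [D ^+ k.+2]exprS mulrA mulfK; last first.
    by rewrite expf_neq0 // gt_eqF.
  rewrite -mulrA ler_wpM2l ?(ltW D0) // exprSr invfM mulrC.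
  by rewrite -exprVn ler_wpM2l ?invr_ge0 ?(ltW T0) // lerXn2r ?nnegrE
    ?invr_ge0 ?(ltW T0) ?lef_pV2 ?posrE.
have step n : \sum_(k < n.+1) y k <= e + N * (\sum_(k < n) y k) ^+ 2.
  apply: le_trans (_ : N * (\sum_(k < n.+1) `|p k.+1| * w ^+ k.+1) +
     N * (\sum_(k < n.+1) \sum_(j < k) y j * y (k - j.+1)%N) <= _).
    rewrite -mulrDr -big_split mulr_sumr /=; apply: ler_sum => k _.
    apply: le_trans (_ : M * (`|p k.+1| + \sum_(j < k) x j.+1 * x (k - j)%N) *
      w ^+ k.+1 <= _).
      by rewrite ler_wpM2r ?rec ?exprn_ge0 // ltW.
    rewrite -mulrA; apply: ler_pM => //.
      by rewrite mulr_ge0 ?exprn_ge0 ?(ltW w0) // addr_ge0 // sumr_ge0 // => j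
        _; rewrite mulr_ge0.
    rewrite mulrDl lerD2l mulr_suml; apply: ler_sum => j _.
    rewrite /y subnSK // mulrACA -exprD addSn subnKC //.
    exact: ltnW.
  apply: lerD => //; rewrite ler_wpM2l ?(ltW N0) // big_ord_recl big_ord0 add0r.
  exact: conv_sum_le.
have bnd n : \sum_(k < n) y k <= 2 * e.
  elim: n => [|n IH]; first by rewrite big_ord0 mulr_ge0 // ltW.
  apply: le_trans (step n) _; rewrite mulr_natl mulr2n lerD2l.
  apply: le_trans (_ : N * (2 * e) ^+ 2 <= _).
    by rewrite ler_wpM2l ?(ltW N0) // lerXn2r ?nnegrE ?sumr_ge0 // mulr_ge0 //
      ltW.
  rewrite le_eqVlt; apply/orP; left; apply/eqP; rewrite /e.
  by field; rewrite gt_eqF.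
apply: (@geometricI _ (x 0%N + 2 * e) w^-1); last by rewrite invr_ge0 ltW.
case=> [|k]; first by rewrite expr0 mulr1 ger0_norm // lerDl mulr_ge0 // ltW.
rewrite ger0_norm // exprVn ler_pdivlMr ?exprn_gt0 //.
have := bnd k.+1; rewrite big_ord_recr /= => le_s.
apply: le_trans (_ : 2 * e <= _); last by rewrite lerDr.
by apply: le_trans le_s; rewrite lerDr sumr_ge0.
Qed.
End Recurrence.

(** * The ring of convergent power series *)

Section ConvergentPowerSeries.
Variable K : numFieldType.

(** The bound is stored as a boolean, so that series with equal coefficients are equal. *)
Record cps := Cps { cf :> nat -> K; cf_geometric : `[< geometric cf >] }.

HB.instance Definition _ := [isSub for cf].
HB.instance Definition _ := gen_eqMixin cps.
HB.instance Definition _ := gen_choiceMixin cps.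

Lemma cpsP (f g : cps) : f =1 g -> f = g.
Proof. by move=> /funext fg; apply: val_inj. Qed.

Lemma geometric_cf (f : cps) : geometric f.
Proof. exact/asboolP/cf_geometric. Qed.

Definition cps_of (a : nat -> K) (ga : geometric a) : cps :=
  Cps (introT (asboolP _) ga).

Lemma geometric_add (a b : nat -> K) :
  geometric a -> geometric b -> geometric (fun k => a k + b k).
Proof.
move=> [M M1 aM] [N N1 bN].
have M0 := le_trans ler01 M1; have N0 := le_trans ler01 N1.
apply: (@geometricI _ _ (M + N) (M + N)); last exact: addr_ge0.
move=> k; rewrite -exprS.
apply: le_trans (ler_normD _ _) _; apply: le_trans (lerD (aM k) (bN k)) _.
rewrite [leRHS]exprS mulrDl !exprS; apply: lerD; apply: ler_wpM2l => //.
  by rewrite lerXn2r ?nnegrE ?addr_ge0 // lerDl.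
by rewrite lerXn2r ?nnegrE ?addr_ge0 // lerDr.
Qed.

Lemma geometric_opp (a : nat -> K) : geometric a -> geometric (fun k => - a k).
Proof. by move=> [M M1 aM]; exists M => // k; rewrite normrN. Qed.

Lemma geometric_mul (a b : nat -> K) : geometric a -> geometric b ->
  geometric (fun k => \sum_(j < k.+1) a j * b (k - j)%N).
Proof.
move=> [M M1 aM] [N N1 bN].
have M0 := le_trans ler01 M1; have N0 := le_trans ler01 N1.
apply: (@geometricI _ _ (2 * (M * N)) (2 * (M * N))); last by rewrite !mulr_ge0.
move=> k; rewrite -exprS; apply: le_trans (ler_norm_sum _ _ _) _.
apply: le_trans (_ : \sum_(j < k.+1) (M * N) ^+ k.+1 <= _).
  apply: ler_sum => j _; rewrite normrM exprMn ler_pM //.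
    by apply: le_trans (aM j) _; rewrite ler_weXn2l.
  by apply: le_trans (bN _) _; rewrite ler_weXn2l // ltnS leq_subr.
rewrite sumr_const card_ord -[_ *+ k.+1]mulr_natl [leRHS]exprMn ler_wpM2r
  ?exprn_ge0 ?mulr_ge0 //.
by rewrite -natrX ler_nat ltnW // ltn_expl.
Qed.

Lemma geometric_const (c : K) : geometric (fun k => if k == 0%N then c else 0).
Proof.
apply: (@geometricI _ _ `|c| 0) => // -[|k]; rewrite ?mulr1 //=.
by rewrite normr0 mulr_ge0 // exprn_ge0.
Qed.

Definition cps_add (f g : cps) :=
  cps_of (geometric_add (geometric_cf f) (geometric_cf g)).
Definition cps_opp (f : cps) := cps_of (geometric_opp (geometric_cf f)).
Definition cps_mul (f g : cps) :=
  cps_of (geometric_mul (geometric_cf f) (geometric_cf g)).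
Definition cps_const (c : K) := cps_of (geometric_const c).

Fact cps_addA : associative cps_add.
Proof. by move=> f g h; apply: cpsP => k; apply: addrA. Qed.
Fact cps_addC : commutative cps_add.
Proof. by move=> f g; apply: cpsP => k; apply: addrC. Qed.
Fact cps_add0 : left_id (cps_const 0) cps_add.
Proof. by move=> f; apply: cpsP => k /=; rewrite if_same add0r. Qed.
Fact cps_addN : left_inverse (cps_const 0) cps_opp cps_add.
Proof. by move=> f; apply: cpsP => k /=; rewrite if_same addNr. Qed.

HB.instance Definition _ :=
  GRing.isZmodule.Build cps cps_addA cps_addC cps_add0 cps_addN.

Lemma cfD (f g : cps) k : (f + g) k = f k + g k. Proof. by []. Qed.
Lemma cf0 k : (0 : cps) k = 0. Proof. exact: if_same. Qed.

(** A coefficient of a product only depends on truncations of the factors, so that the laws of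
    multiplication are inherited from polynomials. *)
Definition cps_trunc n (f : cps) : {poly K} := \poly_(i < n) f i.

Lemma coef_trunc n (f : cps) k : (k < n)%N -> (cps_trunc n f)`_k = f k.
Proof. by move=> kn; rewrite coef_poly kn. Qed.

Lemma cps_mul_trunc n (f g : cps) k : (k < n)%N ->
  cps_mul f g k = (cps_trunc n f * cps_trunc n g)`_k.
Proof.
move=> kn; rewrite coefM; apply: eq_bigr => j _.
have jn : (j < n)%N by apply: leq_trans kn; apply: ltn_ord.
by rewrite !coef_trunc // (leq_ltn_trans (leq_subr _ _)).
Qed.

Fact cps_mulC : commutative cps_mul.
Proof.
by move=> f g; apply: cpsP => k; rewrite !(cps_mul_trunc _ _ (ltnSn k)) mulrC.
Qed.

Lemma coefM_eq (p p' q q' : {poly K}) n :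
  (forall i, (i < n)%N -> p`_i = p'`_i) ->
  (forall i, (i < n)%N -> q`_i = q'`_i) ->
  forall i, (i < n)%N -> (p * q)`_i = (p' * q')`_i.
Proof.
move=> pp qq i lin; rewrite !coefM; apply: eq_bigr => j _.
by rewrite pp ?qq // ?(leq_ltn_trans (leq_subr _ _)) // (leq_trans _ lin).
Qed.

Lemma trunc_mul n (f g : cps) k : (k < n)%N ->
  (cps_trunc n (cps_mul f g))`_k = (cps_trunc n f * cps_trunc n g)`_k.
Proof. by move=> kn; rewrite coef_trunc // -cps_mul_trunc. Qed.

Fact cps_mulA : associative cps_mul.
Proof.
move=> f g h; apply: cpsP => k; rewrite !(cps_mul_trunc _ _ (ltnSn k)).
rewrite (coefM_eq (n := k.+1) (p' := cps_trunc k.+1 f)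
  (q' := cps_trunc k.+1 g * cps_trunc k.+1 h)) //; last exact: trunc_mul.
rewrite mulrA; apply/esym/(coefM_eq (n := k.+1)) => //; exact: trunc_mul.
Qed.

Fact cps_mul1 : left_id (cps_const 1) cps_mul.
Proof.
move=> f; apply: cpsP => k /=; rewrite big_ord_recl /= mul1r subn0.
by rewrite big1 ?addr0 // => j _; rewrite mul0r.
Qed.

Fact cps_mulDl : left_distributive cps_mul cps_add.
Proof.
move=> f g h; apply: cpsP => k /=; rewrite -big_split; apply: eq_bigr => j _.
exact: mulrDl.
Qed.

Fact cps_oner_neq0 : cps_const 1 != 0.
Proof.
by apply/eqP => /(congr1 (fun f : cps => f 0%N)) /eqP; rewrite cf0 oner_eq0.
Qed.

HB.instance Definition _ := GRing.Zmodule_isComNzRing.Build cps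
  cps_mulA cps_mulC cps_mul1 cps_mulDl cps_oner_neq0.

Lemma cfM (f g : cps) k : (f * g) k = \sum_(j < k.+1) f j * g (k - j)%N.
Proof. by []. Qed.
Lemma cf1 k : (1 : cps) k = (k == 0%N)%:R.
Proof. by rewrite /= /1 /=; case: k. Qed.

Lemma cf_sum I (r : seq I) (P : pred I) (F : I -> cps) k :
  (\sum_(i <- r | P i) F i) k = \sum_(i <- r | P i) F i k.
Proof. exact: (big_morph (fun f : cps => f k) (fun f g => cfD f g k) (cf0 k)).
  Qed.

Fact cps_const_zmod : zmod_morphism cps_const.
Proof. by move=> a b; apply: cpsP => -[|k] //=; rewrite subr0. Qed.
Fact cps_const_monoid : monoid_morphism cps_const.
Proof.
split=> // a b; apply: cpsP => k; rewrite cfM big_ord_recl big1 /= => [|i _].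
  by rewrite addr0 subn0; case: eqP; rewrite ?mulr0.
by rewrite mul0r.
Qed.
HB.instance Definition _ := GRing.isZmodMorphism.Build K cps cps_const
  cps_const_zmod.
HB.instance Definition _ := GRing.isMonoidMorphism.Build K cps cps_const
  cps_const_monoid.

Definition cps_at0 (f : cps) := f 0%N.
Fact cps_at0_zmod : zmod_morphism cps_at0. Proof. by []. Qed.
Fact cps_at0_monoid : monoid_morphism cps_at0.
Proof. by split=> // f g; rewrite /cps_at0 cfM big_ord_recl big_ord0 addr0. Qed.
HB.instance Definition _ := GRing.isZmodMorphism.Build cps K cps_at0
  cps_at0_zmod.
HB.instance Definition _ := GRing.isMonoidMorphism.Build cps K cps_at0
  cps_at0_monoid.

Lemma geometric_shift (a : nat -> K) n : geometric a -> geometric (fun k => a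
  (n + k)%N).
Proof.
move=> [M M1 aM]; have M0 := le_trans ler01 M1.
apply: (@geometricI _ _ (M ^+ n.+1) M) => // k.
by apply: le_trans (aM _) _; rewrite -exprD addSn.
Qed.
Definition cps_shift n (f : cps) := cps_of (geometric_shift n (geometric_cf f)).

Lemma geometric_delta n : geometric (fun k => (k == n)%:R : K).
Proof.
apply: (@geometricI _ _ 1 1) => // k.
by rewrite expr1n mulr1; case: eqP; rewrite ?normr1 ?normr0.
Qed.
Definition cps_X n : cps := cps_of (geometric_delta n).

Lemma cf_XM n (f : cps) k : (cps_X n * f) k = if (k < n)%N then 0 else f (k -
  n)%N.
Proof.
rewrite cfM; case: ltnP => [kn|nk].
  rewrite big1 // => j _ /=.
  by rewrite ltn_eqF ?mul0r // (leq_trans (ltn_ord j)).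
have nk1 : (n < k.+1)%N by [].
rewrite (bigD1 (Ordinal nk1)) //= eqxx mul1r big1 ?addr0 // => j jn.
by rewrite (negbTE (_ : (j : nat) != n)) ?mul0r.
Qed.

Lemma cps_X_shift n (f : cps) : (forall k, (k < n)%N -> f k = 0) ->
  f = cps_X n * cps_shift n f.
Proof.
by move=> f0; apply: cpsP => k; rewrite cf_XM; case: ltnP => [/f0//|nk];
  rewrite /= subnKC.
Qed.

Lemma cps_X0 : cps_X 0 = 1.
Proof. by apply: cpsP => k; rewrite cf1. Qed.
Lemma cps_XD m n : cps_X (m + n)%N = cps_X m * cps_X n.
Proof.
apply: cpsP => k; rewrite cf_XM /=; case: ltnP => km.
  by rewrite ltn_eqF // ltn_addr.
by rewrite -{1}(subnKC km) eqn_add2l.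
Qed.
Lemma cps_Xexp n i : cps_X n ^+ i = cps_X (n * i)%N.
Proof.
elim: i => [|i IH]; first by rewrite muln0 cps_X0.
by rewrite exprS IH -cps_XD mulnS.
Qed.

Lemma cps_X_inj n : injective ( *%R (cps_X n)).
Proof.
move=> f g fg; apply: cpsP => k.
have := congr1 (fun h : cps => h (n + k)%N) fg; rewrite !cf_XM.
by rewrite ltnNge leq_addr /= addKn.
Qed.

Lemma cps_ordP (f : cps) : f != 0 -> exists n (g : cps), g 0%N != 0 /\ f =
  cps_X n * g.
Proof.
move=> f0; have ex : exists n, f n != 0.
  apply/not_existsP => fn0; move/eqP: f0; apply; apply: cpsP => k.
  by rewrite cf0; apply/eqP/negPn/negP/fn0.
case: (ex_minnP ex) => n fn mn; exists n, (cps_shift n f); split.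
  by rewrite /= addn0.
apply: cps_X_shift => k; rewrite ltnNge => nk.
by apply/eqP/negPn; apply: contra nk; apply: mn.
Qed.

Lemma cps_inverse (f : cps) : f 0%N != 0 -> exists g, f * g = 1.
Proof.
move=> f0.
have [|h hE] := @strong_recursion K 0 (fun h k => if k is m.+1 then
  - (f 0%N)^-1 * (\sum_(j < m.+1) f j.+1 * h (m - j)%N) else (f 0%N)^-1).
  move=> h h' [//|m] hh; congr (_ * _); apply: eq_bigr => j _.
  by rewrite hh // ltnS leq_subr.
have gh : geometric h.
  have [M M1 fM] := geometric_cf f; have M0 := le_trans ler01 M1.
  pose c : K := `|(f 0%N)^-1|; have c0 : 0 <= c := normr_ge0 _.
  (* Since [B - M = c * M ^+ 2], the convolution in the inductive bound telescopes to
     [B ^+ m.+1 - M ^+ m.+1]. *)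
  pose B := M + c * M ^+ 2.
  have B0 : 0 <= B by apply: addr_ge0 => //; apply: mulr_ge0 => //;
    apply: exprn_ge0.
  apply: (@geometricI _ _ c B) => //; elim/ltn_ind => -[|m] IH.
    by rewrite hE expr0 mulr1.
  rewrite hE normrM normrN -/c ler_wpM2l //.
  apply: le_trans (ler_norm_sum _ _ _) _.
  apply: le_trans (_ : \sum_(j < m.+1) c * M ^+ 2 * (B ^+ (m - j) * M ^+ j) <=
    _).
    apply: ler_sum => j _; rewrite normrM.
    have := IH (m - j)%N; rewrite ltnS leq_subr => /(_ isT) hm.
    apply: le_trans (ler_pM _ _ (fM j.+1) hm) _ => //.
    by rewrite !exprS expr0 mulr1 le_eqVlt; apply/orP; left; apply/eqP; ring.
  rewrite -mulr_sumr; have := subrXX B M m.+1; rewrite /= [B - M]addrC addKr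
    => <-.
  by rewrite lerBlDr lerDl exprn_ge0.
exists (cps_of gh); apply: cpsP => k; rewrite cf1 cfM.
case: k => [|m]; first by rewrite big_ord_recl big_ord0 addr0 /= hE mulfV.
rewrite big_ord_recl /= hE subn0 mulrA mulrN mulfV // mulN1r.
by rewrite addNr.
Qed.

Definition cps_unit : {pred cps} := [pred f : cps | f 0%N != 0].
Definition cps_inv (f : cps) : cps :=
  if pselect (f 0%N != 0) is left f0 then sval (cid (cps_inverse f0)) else f.

Fact cps_mulVf : {in cps_unit, left_inverse 1 cps_inv *%R}.
Proof.
move=> f; rewrite inE /cps_inv; case: pselect => // f0 _.
by rewrite mulrC; case: cid.
Qed.
Fact cps_unitPl (f g : cps) : g * f = 1 -> cps_unit f.
Proof.
move=> /(congr1 cps_at0); rewrite rmorphM rmorph1 => /eqP.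
rewrite /cps_unit /=; apply: contraL => /eqP f0.
by rewrite [cps_at0 f]f0 mulr0 eq_sym oner_eq0.
Qed.
Fact cps_inv_out : {in [predC cps_unit], cps_inv =1 id}.
Proof. by move=> f; rewrite !inE /cps_inv; case: pselect => // f0 /negP. Qed.
HB.instance Definition _ :=
  GRing.ComNzRing_hasMulInverse.Build cps cps_mulVf cps_unitPl cps_inv_out.

Fact cps_integral : GRing.integral_domain_axiom cps.
Proof.
move=> f g fg0; apply/negPn/negP; rewrite negb_or.
case/andP=> /cps_ordP[m [f' [f0 fE]]] /cps_ordP[n [g' [g0 gE]]].
have: f' * g' = 0.
  apply: (@cps_X_inj (m + n)); rewrite mulr0 cps_XD mulrACA -fE -gE //.
move=> /(congr1 cps_at0) /eqP; rewrite rmorphM rmorph0 mulf_eq0.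
by rewrite (negPf f0) (negPf g0).
Qed.
HB.instance Definition _ := GRing.ComUnitRing_isIntegral.Build cps cps_integral.

Lemma geometric_ram N (a : nat -> K) : geometric a ->
  geometric (fun k => if (N %| k)%N then a (k %/ N)%N else 0).
Proof.
move=> [M M1 aM]; have M0 := le_trans ler01 M1.
exists M => // k; case: ifP => _; last by rewrite normr0 exprn_ge0.
by apply: le_trans (aM _) _; rewrite ler_weXn2l // ltnS leq_div.
Qed.
(* [cps_ram n f] is the series [f (s ^+ n.+1)]. *)
Definition cps_ram n (f : cps) := cps_of (geometric_ram n.+1 (geometric_cf f)).

Fact cps_ram_zmod n : zmod_morphism (cps_ram n).
Proof. by move=> f g; apply: cpsP => k /=; case: ifP => // _;
  rewrite subr0. Qed.
Fact cps_ram_monoid n : monoid_morphism (cps_ram n).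
Proof.
split=> [|f g]; apply: cpsP => k.
  rewrite cf1 /=; case: k => // k; case: ifP => // nk.
  by rewrite gtn_eqF // divn_gt0 // dvdn_leq.
have ramE (h : cps) m i : (i < m)%N ->
    cps_ram n h i = (cps_trunc m h \Po 'X^(n.+1))`_i.
  move=> im; rewrite coef_comp_poly_Xn //=; case: ifP => // _.
  by rewrite coef_trunc // (leq_ltn_trans (leq_div _ _)).
rewrite (ramE _ _ _ (ltnSn k)).
have -> : (cps_trunc k.+1 (f * g) \Po 'X^(n.+1))`_k =
          ((cps_trunc k.+1 f * cps_trunc k.+1 g) \Po 'X^(n.+1))`_k.
  rewrite !coef_comp_poly_Xn //; case: ifP => // _.
  by apply: trunc_mul; rewrite ltnS leq_div.
rewrite comp_polyM (cps_mul_trunc _ _ (ltnSn k)).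
by apply: (coefM_eq (n := k.+1)) => // i ik; rewrite -ramE // coef_trunc.
Qed.
HB.instance Definition _ n :=
  GRing.isZmodMorphism.Build cps cps (cps_ram n) (cps_ram_zmod n).
HB.instance Definition _ n :=
  GRing.isMonoidMorphism.Build cps cps (cps_ram n) (cps_ram_monoid n).

Lemma cf_ram n (f : cps) k :
  cps_ram n f k = if (n.+1 %| k)%N then f (k %/ n.+1)%N else 0.
Proof. by []. Qed.

(** Ramification exponents multiply, while the index of [cps_ram] is the exponent minus one. *)
Lemma cps_ram_comp m n (f : cps) :
  cps_ram m (cps_ram n f) = cps_ram (m.+1 * n.+1).-1 f.
Proof.
apply: cpsP => k; rewrite !cf_ram prednK ?muln_gt0 // divnMA.
case: ifP => [mk|mk].
  by rewrite dvdn_divRL // mulnC.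
case: ifP => // /(dvdn_trans (dvdn_mulr _ _)) mk'.
by rewrite mk' in mk.
Qed.

Lemma cps_ram_X n k : cps_ram n (cps_X k) = cps_X (n.+1 * k)%N.
Proof.
apply: cpsP => j /=; case: ifP => [nj|nj].
  by rewrite -[in RHS](divnK nj) mulnC eqn_pmul2l.
by case: eqP => // jE; rewrite jE dvdn_mulr in nj.
Qed.

End ConvergentPowerSeries.

(** * Hensel's lemma and Puiseux's theorem *)

Section PolynomialNorm.
Variable K : numFieldType.
Implicit Types p q : {poly K}.

(** The sum, unlike the maximum, is submultiplicative without a constant depending on the degree. *)
Definition pnorm p := \sum_(i < size p) `|p`_i|.

Lemma pnorm_wide n p : (size p <= n)%N -> pnorm p = \sum_(i < n) `|p`_i|.
Proof.
move=> pn; rewrite /pnorm (big_ord_widen n (fun i => `|p`_i|)) //.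
rewrite [RHS](bigID (fun i : 'I_n => (i < size p)%N)) /= [X in _ + X]big1
  ?addr0 //.
by move=> i; rewrite -leqNgt => /(nth_default 0) ->; rewrite normr0.
Qed.

Lemma pnorm_ge0 p : 0 <= pnorm p. Proof. exact: sumr_ge0. Qed.

Lemma coef_le_pnorm p i : `|p`_i| <= pnorm p.
Proof.
case: (ltnP i (size p)) => [ip|/(nth_default 0) ->];
  last by rewrite normr0 pnorm_ge0.
by rewrite /pnorm (bigD1 (Ordinal ip)) //= lerDl sumr_ge0.
Qed.

Lemma pnormD p q : pnorm (p + q) <= pnorm p + pnorm q.
Proof.
rewrite (@pnorm_wide (maxn (size p) (size q)) p) ?leq_maxl //.
rewrite (@pnorm_wide (maxn (size p) (size q)) q) ?leq_maxr //.
rewrite (@pnorm_wide (maxn (size p) (size q)) (p + q)) ?size_polyD //.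
by rewrite -big_split; apply: ler_sum => i _; rewrite coefD ler_normD.
Qed.

Lemma pnormZ c p : pnorm (c *: p) = `|c| * pnorm p.
Proof.
rewrite (pnorm_wide (size_scale_leq c p)) mulr_sumr; apply: eq_bigr => i _.
by rewrite coefZ normrM.
Qed.

Lemma pnormN p : pnorm (- p) = pnorm p.
Proof. by rewrite -scaleN1r pnormZ normrN1 mul1r. Qed.

Lemma pnorm_sum I (r : seq I) (P : pred I) (F : I -> {poly K}) :
  pnorm (\sum_(i <- r | P i) F i) <= \sum_(i <- r | P i) pnorm (F i).
Proof.
elim/big_ind2: _ => // [|p x q y px qy]; first by rewrite /pnorm size_poly0
  big_ord0.
by apply: le_trans (pnormD _ _) _; apply: lerD.
Qed.

Lemma pnormM p q : pnorm (p * q) <= pnorm p * pnorm q.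
Proof.
pose n := (size p + size q)%N.
rewrite (@pnorm_wide n p) ?leq_addr // (@pnorm_wide n q) ?leq_addl //.
rewrite (@pnorm_wide n (p * q)); last first.
  by apply: leq_trans (size_polyMleq _ _) _; apply: leq_pred.
apply: le_trans (conv_sum_le _ (fun=> normr_ge0 _) (fun=> normr_ge0 _)).
apply: ler_sum => k _; rewrite coefM; apply: le_trans (ler_norm_sum _ _ _) _.
by apply: ler_sum => j _; rewrite normrM.
Qed.

(** The monomials of degree below [d] form a finite basis, whose images give the bound. It is
    applied to the operators solving the Bezout equation in Hensel's lemma. *)
Lemma linear_pnorm_bounded (L : {poly K} -> {poly K}) d : linear L ->
  exists2 M, 0 <= M & forall p, (size p <= d)%N -> pnorm (L p) <= M * pnorm p.
Proof.
move=> linL; pose f : {linear {poly K} -> {poly K}} :=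
  HB.pack L (GRing.isLinear.Build _ _ _ _ L linL).
exists (\sum_(i < d) pnorm (L 'X^i)) => [|p pd].
  by apply: sumr_ge0 => i _; apply: pnorm_ge0.
have -> : L p = \sum_(i < d) p`_i *: L 'X^i.
  rewrite -[L]/(f : _ -> _) -[p in LHS](coefK p) poly_def.
  rewrite linear_sum (big_ord_widen d (fun i => f (p`_i *: 'X^i))) //.
  rewrite [RHS](bigID (fun i : 'I_d => (i < size p)%N)) /= [X in _ + X]big1
    ?addr0.
    by apply: eq_bigr => i _; exact: (linearZZ f).
  by move=> i; rewrite -leqNgt => /(nth_default 0) ->; rewrite scale0r.
apply: le_trans (pnorm_sum _ _ _) _; rewrite mulr_suml; apply: ler_sum => i _.
by rewrite pnormZ mulrC ler_wpM2l ?pnorm_ge0 ?coef_le_pnorm.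
Qed.

End PolynomialNorm.

Lemma geometric_le (K : numFieldType) (a b : nat -> K) :
  geometric b -> (forall k, `|a k| <= `|b k|) -> geometric a.
Proof. by move=> [M M1 bM] ab; exists M => // k; apply: le_trans (bM k). Qed.

(** * Hensel's lemma over convergent series *)

Section Hensel.
Variable K : numFieldType.

(** A polynomial over series is read as a series with polynomial coefficients; Hensel lifting
    determines these one after the other. *)
Definition coefpoly k (P : {poly cps K}) : {poly K} := \poly_(i < size P) P`_i
  k.

Lemma coef_coefpoly k (P : {poly cps K}) i : (coefpoly k P)`_i = P`_i k.
Proof.
by rewrite coef_poly; case: ltnP => // /(nth_default 0) ->; rewrite cf0.
Qed.

Lemma coefpolyM k (P Q : {poly cps K}) :
  coefpoly k (P * Q) = \sum_(j < k.+1) coefpoly j P * coefpoly (k - j) Q.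
Proof.
apply/polyP => i; rewrite coef_coefpoly coefM cf_sum coef_sum.
under eq_bigr do rewrite cfM; rewrite exchange_big /=; apply: eq_bigr => j _.
by rewrite coefM; apply: eq_bigr => l _; rewrite !coef_coefpoly.
Qed.

Lemma coefpoly_inj (P Q : {poly cps K}) : coefpoly^~ P =1 coefpoly^~ Q -> P = Q.
Proof.
by move=> PQ; apply/polyP => i; apply: cpsP => k; rewrite -!coef_coefpoly PQ.
Qed.

Lemma coefpoly_surj n (Gs : nat -> {poly K}) : (forall k, (size (Gs k) <=
  n)%N) ->
  geometric (fun k => pnorm (Gs k)) -> exists G : {poly cps K}, coefpoly^~ G
    =1 Gs.
Proof.
move=> sz gG.
have gi i : geometric (fun k => (Gs k)`_i).
  by apply: geometric_le gG _ => k; rewrite (ger0_norm (pnorm_ge0 _))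
    coef_le_pnorm.
exists (\poly_(i < n) cps_of (gi i)) => k; apply/polyP => i.
rewrite coef_coefpoly coef_poly; case: ltnP => // ni; rewrite cf0.
by rewrite nth_default // (leq_trans (sz k)).
Qed.

Lemma geometric_pnorm (P : {poly cps K}) : geometric (fun k => pnorm (coefpoly
  k P)).
Proof.
suff: geometric (fun k => \sum_(i < size P) `|P`_i k|).
  move=> g; apply: geometric_le g _ => k.
  rewrite (@pnorm_wide _ (size P)) ?size_poly //.
  by under eq_bigr do rewrite coef_coefpoly.
elim: (size P) => [|n IH].
  apply: (geometric_le (geometric_const 0)) => k.
  by rewrite big_ord0 normr0.
have gn : geometric (fun k => `|P`_n k|).
  by apply: geometric_le (geometric_cf P`_n) _ => k; rewrite normr_id.
apply: geometric_le (geometric_add IH gn) _ => k.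
by rewrite big_ord_recr.
Qed.

Lemma coefpoly_lead k (P : {poly cps K}) : P \is monic ->
  (size (coefpoly k.+1 P) <= (size P).-1)%N.
Proof.
move=> mP; apply/leq_sizeP => i; rewrite leq_eqVlt => /orP[/eqP <-|].
  by rewrite coef_coefpoly -/(lead_coef P) (monicP mP) cf1.
move=> Pi; rewrite coef_coefpoly nth_default ?cf0 //.
by rewrite (leq_trans _ Pi) // leqSpred.
Qed.

Section HenselLifting.
Variables (P : {poly cps K}) (g h : {poly K}).
Hypotheses (mP : P \is monic) (mg : g \is monic) (mh : h \is monic).
Hypotheses (cop : coprimep g h) (P0 : coefpoly 0 P = g * h).

Let sizeP : size P = (size g + size h).-1.
Proof.
have <- : size (coefpoly 0 P) = (size g + size h).-1.
  by rewrite P0 size_monicM // monic_neq0.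
apply/esym/eqP; rewrite eqn_leq size_poly /=.
have P1 := monicP mP.
case E : (size P) => [|n] //; apply/negPn; rewrite -leqNgt.
apply/negP => /leq_sizeP/(_ n (leqnn n)) /eqP.
by rewrite coef_coefpoly -[n]/(n.+1.-1) -E -/(lead_coef P) P1 cf1 oner_eq0.
Qed.

Lemma hensel : exists G H : {poly cps K},
  [/\ G \is monic, H \is monic, size G = size g, size H = size h & P = G * H].
Proof.
have g0 := monic_neq0 mg; have h0 := monic_neq0 mh.
(* By Bezout, [G * h + g * H = Q] is solved by linear functions of [Q]. *)
have [[u v] /= uv] := Bezout_eq1_coprimepP _ _ cop.
pose L1 Q := (Q * v) %% g; pose L2 Q := (Q - L1 Q * h) %/ g.
have LE Q : L1 Q * h + g * L2 Q = Q.
  have dv : g %| Q - L1 Q * h.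
    have E : Q * v = (Q * v %/ g) * g + L1 Q := divp_eq _ _.
    move: (Q * v %/ g) (L1 Q) E => q r E.
    have -> : Q - r * h = (Q * u + q * h) * g.
      have -> : r = Q * v - q * g by rewrite E addrC addKr.
      by rewrite -{1}[Q]mulr1 -uv; ring.
    exact: dvdp_mull.
  by rewrite /L2 [g * _]mulrC (divpK dv) addrC subrK.
have linL1 : linear L1.
  by move=> c p q; rewrite /L1 mulrDl -scalerAl modpD modpZl.
have linL2 : linear L2.
  move=> c p q; rewrite /L2 linL1 mulrDl -scalerAl opprD addrACA -scalerBr.
  by rewrite divpD divpZl.
(* At order [m.+1], the equation [P = G * H] reads [G' * h + g * H' = Q] in the new coefficients
   [G'] and [H'], where [Q] collects [P] and the products of corrections of smaller positive
   order. *)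
have [|S SE] := @strong_recursion _ (0, 0) (fun (S : nat -> {poly K} * {poly
  K}) k =>
  if k is m.+1 then
    let Q := coefpoly m.+1 P - \sum_(j < m) (S j.+1).1 * (S (m - j)%N).2 in
    (L1 Q, L2 Q) else (g, h)).
  move=> S S' [//|m] SS' /=; set Q := _ - _; set Q' := _ - _.
  have -> // : Q = Q'; congr (_ - _); apply: eq_bigr => j _.
  by rewrite !SS' // ltnS ?leq_subr.
pose Q m := coefpoly m.+1 P - \sum_(j < m) (S j.+1).1 * (S (m - j)%N).2.
have S0 : S 0%N = (g, h) by rewrite SE.
have SS m : S m.+1 = (L1 (Q m), L2 (Q m)) by rewrite SE.
have sg : (0 < size g)%N by rewrite size_poly_gt0.
have sh : (0 < size h)%N by rewrite size_poly_gt0.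
have lt1 (a b c : nat) : (a < b -> (a + c).-1 <= (b + c).-1.-1)%N by lia.
have lt2 (a b c d : nat) : (a < c -> b < d -> (a + b).-1 <= (c + d).-1.-1)%N
  by lia.
have lt3 (a b c : nat) : (0 < b -> (a + b).-1 <= (a + c).-1.-1 -> 0 < a -> b <
  c)%N by lia.
have lt4 (a b c d : nat) : (a <= c -> b <= d -> (a + b).-1 <= (c + d).-1)%N by
  lia.
(* The first correction is a remainder modulo [g]. The second is then bounded through the degree of
   [g * L2 (Q m)], because [Q m] has smaller degree than the monic [P]. *)
have szS m : (size (S m.+1).1 < size g)%N /\ (size (S m.+1).2 < size h)%N.
  elim/ltn_ind: m => m IH; rewrite SS /=.
  have s1 : (size (L1 (Q m)) < size g)%N by rewrite ltn_modp.
  split=> //.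
  have sQ : (size (Q m) <= (size P).-1)%N.
    apply: leq_trans (size_polyD _ _) _; rewrite size_polyN geq_max
      coefpoly_lead //=.
    apply: leq_trans (size_sum _ _ _) _; apply/bigmax_leqP => j _.
    have jm := ltn_ord j; rewrite -[(m - j)%N]subnSK //.
    have [] := IH j jm; have [] := IH (m - j.+1)%N.
      by rewrite ltn_subrL (leq_ltn_trans _ jm).
    move=> _ b a _; apply: leq_trans (size_polyMleq _ _) _.
    by rewrite sizeP; apply: lt2.
  have [->|L20] := eqVneq (L2 (Q m)) 0; first by rewrite size_poly0.
  have : (size (g * L2 (Q m))%R <= (size P).-1)%N.
    have -> : g * L2 (Q m) = Q m - L1 (Q m) * h by apply/eqP;
      rewrite eq_sym subr_eq [eqbRHS]addrC LE.
    apply: leq_trans (size_polyD _ _) _; rewrite size_polyN geq_max sQ /=.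
    by apply: leq_trans (size_polyMleq _ _) _; rewrite sizeP lt1.
  rewrite size_monicM // sizeP; move: (size_poly_gt0 (L2 (Q m))); rewrite L20.
  by move=> b0 le; apply: lt3 b0 le _.
have [M1 M10 bM1] := linear_pnorm_bounded (size P) linL1.
have [M2 M20 bM2] := linear_pnorm_bounded (size P) linL2.
have szQ m : (size (Q m) <= size P)%N.
  have [] := szS m; rewrite SS /= => a b; rewrite -(LE (Q m)).
  apply: leq_trans (size_polyD _ _) _; rewrite geq_max.
  apply/andP; split; apply: leq_trans (size_polyMleq _ _) _; rewrite sizeP.
    by rewrite lt4 // ltnW.
  by rewrite lt4 // ltnW.
(* The norm of [Q] is at most that of a coefficient of [P] plus a convolution of earlier values of
   [x], and [L1], [L2] are bounded in the relevant degrees: this is the recurrence solved above. *)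
pose x k := pnorm (S k).1 + pnorm (S k).2.
have x0 k : 0 <= x k by rewrite addr_ge0 ?pnorm_ge0.
have gx : geometric x.
  apply: (@quadratic_recurrence _ x (fun k => pnorm (coefpoly k P)) (M1 + M2))
    => //.
  - exact: addr_ge0.
  - exact: geometric_pnorm.
  move=> k; rewrite {1}/x SS /=.
  apply: le_trans (lerD (bM1 _ (szQ k)) (bM2 _ (szQ k))) _.
  rewrite -mulrDl ler_wpM2l ?addr_ge0 // ger0_norm ?pnorm_ge0 //.
  apply: le_trans (pnormD _ _) _; rewrite lerD2l pnormN.
  apply: le_trans (pnorm_sum _ _ _) _; apply: ler_sum => j _.
  apply: le_trans (pnormM _ _) _; apply: ler_pM; rewrite ?pnorm_ge0 //.
    by rewrite lerDl pnorm_ge0.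
  by rewrite lerDr pnorm_ge0.
have [G GE] : exists G : {poly cps K}, coefpoly^~ G =1 (fun k => (S k).1).
  apply: (@coefpoly_surj (size g)) => [[|k]|].
  - by rewrite S0.
  - by have [/ltnW] := szS k.
  apply: geometric_le gx _ => k; rewrite !ger0_norm ?pnorm_ge0 //.
  by rewrite lerDl pnorm_ge0.
have [H HE] : exists H : {poly cps K}, coefpoly^~ H =1 (fun k => (S k).2).
  apply: (@coefpoly_surj (size h)) => [[|k]|].
  - by rewrite S0.
  - by have [_ /ltnW] := szS k.
  apply: geometric_le gx _ => k; rewrite !ger0_norm ?pnorm_ge0 //.
  by rewrite lerDr pnorm_ge0.
(* Only the coefficient of order 0 reaches the degree of [f], so the leading coefficient of the lift
   is the constant series 1. *)
have monic_lift (F : {poly cps K}) (f : {poly K}) : f \is monic -> coefpoly 0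
  F = f ->
    (forall k, (size (coefpoly k.+1 F) < size f)%N) -> F \is monic /\ size F =
      size f.
  move=> mf F0 Fk.
  have cF i : ((size f).-1 <= i)%N -> F`_i = (i == (size f).-1)%:R.
    move=> fi; apply: cpsP => -[|k]; rewrite -coef_coefpoly.
      rewrite F0; case: (eqVneq i (size f).-1) => [->|ni].
        by rewrite -/(lead_coef f) (monicP mf) cf1.
      rewrite nth_default ?cf0 // (leq_trans (leqSpred _)) // ltn_neqAle
        eq_sym ni.
      exact: fi.
    rewrite nth_default; last first.
      by rewrite -ltnS (leq_trans (Fk k)) // (leq_trans (leqSpred _)).
    by case: eqP; rewrite ?cf1 ?cf0.
  have sf : (0 < size f)%N by rewrite size_poly_gt0 monic_neq0.
  have sF : size F = size f.
    apply/eqP; rewrite eqn_leq; apply/andP; split.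
      by apply/leq_sizeP => i fi; rewrite cF ?gtn_eqF ?prednK // (leq_trans
        (leq_pred _)).
    rewrite -(prednK sf); apply/negPn/negP; rewrite -leqNgt => /leq_sizeP/(_ _
      (leqnn _)).
    by rewrite cF // eqxx => /eqP; rewrite oner_eq0.
  by split=> //; rewrite monicE lead_coefE sF cF // eqxx.
have [|k|mG sG] := monic_lift G g mg; first by rewrite GE S0.
  by rewrite GE; have [] := szS k.
have [|k|mH sH] := monic_lift H h mh; first by rewrite HE S0.
  by rewrite HE; have [] := szS k.
exists G, H; split=> //; apply: coefpoly_inj => k; rewrite coefpolyM.
under eq_bigr do rewrite GE HE.
case: k => [|m]; first by rewrite big_ord_recl big_ord0 addr0 S0.
rewrite big_ord_recl big_ord_recr /= subn0 S0 /bump /= !add1n subnn S0 SS /=.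
under eq_bigr do rewrite add1n subSS.
rewrite [_ + L1 _ * h]addrC addrA [g * _ + _]addrC LE.
by rewrite subrK.
Qed.
End HenselLifting.
End Hensel.

(** * Puiseux's theorem for convergent series *)

Section Puiseux.
Variable K : numClosedFieldType.
Implicit Types P Q : {poly cps K}.

Definition ram_splits P := exists n (rs : seq (cps K)),
  map_poly (cps_ram n) P = \prod_(r <- rs) ('X - r%:P).

Lemma map_ram_comp m n P :
  map_poly (cps_ram m) (map_poly (cps_ram n) P) =
  map_poly (cps_ram (m.+1 * n.+1).-1) P.
Proof.
by rewrite -map_poly_comp; apply: eq_map_poly => c; exact: cps_ram_comp.
Qed.

Lemma ram_splits_mul P Q : ram_splits P -> ram_splits Q -> ram_splits (P * Q).
Proof.
move=> [m [rs PE]] [n [ss QE]]; exists (m.+1 * n.+1).-1.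
exists (map (cps_ram n) rs ++ map (cps_ram m) ss).
rewrite big_cat !big_map rmorphM /=.
have -> : map_poly (cps_ram (m.+1 * n.+1).-1) P =
          map_poly (cps_ram n) (map_poly (cps_ram m) P).
  by rewrite map_ram_comp mulnC.
by rewrite -[map_poly _ Q]map_ram_comp QE PE !map_prod_XsubC.
Qed.

Lemma ram_splits_ram m P : ram_splits (map_poly (cps_ram m) P) -> ram_splits P.
Proof.
by move=> [n [rs]]; rewrite map_ram_comp => PE; exists (n.+1 * m.+1).-1, rs.
Qed.

Lemma ram_splits_shift c P : ram_splits (P \Po ('X + c%:P)) -> ram_splits P.
Proof.
move=> [n [rs PE]]; exists n, (map (+%R (cps_ram n c)) rs).
rewrite big_map.
have := congr1 (fun p => p \Po ('X - (cps_ram n c)%:P)) PE.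
rewrite map_comp_poly rmorphD /= map_polyX map_polyC /= -comp_polyA.
rewrite comp_polyD comp_polyX comp_polyC subrK comp_polyXr => ->.
rewrite rmorph_prod; apply: eq_bigr => r _ /=.
by rewrite comp_polyB comp_polyX comp_polyC polyCD opprD addrA.
Qed.

Lemma coef_comp_scaleX (R : comNzRingType) (c : R) (p : {poly R}) i :
  (p \Po (c *: 'X))`_i = c ^+ i * p`_i.
Proof.
rewrite comp_polyE coef_sum.
under eq_bigr do rewrite exprZn !coefZ coefXn.
case: (ltnP i (size p)) => [ip|pi].
  rewrite (bigD1 (Ordinal ip)) //= eqxx mulr1 mulrC big1 ?addr0 // => j ji.
  rewrite (negbTE (_ : i != j)) ?mulr0 //.
  by apply: contra ji => /eqP ij; apply/eqP/val_inj.
rewrite nth_default // mulr0 big1 // => j _.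
by rewrite gtn_eqF ?mulr0 // (leq_trans (ltn_ord j)).
Qed.

(** Multiplying the roots by [u] weights the coefficients by powers of [u]. As [u] need not be
    invertible, both sides are compared after the substitution of [u *: 'X], which is injective
    because [u != 0]. *)
Lemma prod_XsubC_scale (R : idomainType) (u : R) (rs : seq R) (p : {poly R}) :
  u != 0 ->
  (forall i, (i <= size rs)%N ->
     p`_i = u ^+ (size rs - i) * (\prod_(r <- rs) ('X - r%:P))`_i) ->
  (size p <= (size rs).+1)%N ->
  p = \prod_(r <- rs) ('X - (u * r)%:P).
Proof.
move=> u0 pE sp.
suff E : p \Po (u *: 'X) = (\prod_(r <- rs) ('X - (u * r)%:P)) \Po (u *: 'X).
  apply/polyP => i; have := congr1 (fun q : {poly R} => q`_i) E.
  by rewrite !coef_comp_scaleX; apply: mulfI; rewrite expf_neq0.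
have -> : (\prod_(r <- rs) ('X - (u * r)%:P)) \Po (u *: 'X) =
    u ^+ size rs *: \prod_(r <- rs) ('X - r%:P).
  rewrite rmorph_prod /=.
  under eq_bigr do rewrite comp_polyB comp_polyX comp_polyC polyCM mul_polyC
    -scalerBr.
  by rewrite scaler_prod big_const_seq count_predT iter_mulr_1.
apply/polyP => i; rewrite coef_comp_scaleX coefZ.
case: (leqP i (size rs)) => [irs|rsi].
  by rewrite pE // mulrA -exprD subnKC.
by rewrite !nth_default ?mulr0 // ?size_prod_XsubC // (leq_trans sp).
Qed.

(** This undoes the substitution of the Newton polygon: the roots of [P] are those of [Q] times the
    power [q] of the variable, a power that ramification multiplies by [n.+1]. *)
Lemma ram_splits_scale q d P Q : (size P <= d.+1)%N -> size Q = d.+1 ->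
  (forall i, (i <= d)%N -> P`_i = cps_X K (q * (d - i))%N * Q`_i) ->
  ram_splits Q -> ram_splits P.
Proof.
move=> sP sQ PQ [n [rs QE]].
have srs : size rs = d.
  apply/eq_add_S; rewrite -(size_prod_XsubC rs id) -QE -sQ.
  rewrite size_map_inj_poly ?rmorph0 //.
  move=> f g fg; apply: cpsP => k.
  have := congr1 (fun h : cps K => h (k * n.+1)%N) fg.
  by rewrite !cf_ram dvdn_mull // mulnK.
exists n, (map ( *%R (cps_X K (n.+1 * q)%N)) rs); rewrite big_map.
apply: prod_XsubC_scale.
- apply/eqP => /(congr1 (fun h : cps K => h (n.+1 * q)%N)) /eqP.
  by rewrite cf0 /= eqxx oner_eq0.
- move=> i; rewrite srs => id; rewrite -QE !coef_map /= PQ // rmorphM /=.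
  by rewrite cps_ram_X cps_Xexp mulnA.
- by rewrite srs (leq_trans (size_poly _ _)).
Qed.

(** The roots have sum 0. Were they all equal, they would be 0 by characteristic zero, and [p] would
    be a power of ['X]. So there are two distinct roots, and the factor carrying one of them is
    coprime to the factor carrying the others. *)
Lemma monic_root_split (p : {poly K}) d : p \is monic -> size p = d.+2 ->
  p`_d = 0 -> p != 'X^(d.+1) ->
  exists g h : {poly K}, [/\ g \is monic, h \is monic, coprimep g h, p = g * h
     & (size g < size p)%N /\ (size h < size p)%N].
Proof.
move=> mp sp pd pX.
have [zs pE] := closed_field_poly_normal p.
rewrite (monicP mp) scale1r in pE.
have szs : size zs = d.+1.
  by apply/eq_add_S; rewrite -(size_prod_XsubC zs id) -pE sp.
have [z1 z1s] : exists z1, z1 \in zs.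
  by case: (zs) szs => // z1 zs' _; exists z1; rewrite mem_head.
have [all1|/allPn[z2 z2s z21]] := boolP (all (pred1 z1) zs).
  have zsE : zs = nseq d.+1 z1 by rewrite -szs; apply/all_pred1P.
  have := @coefPn_prod_XsubC _ zs; rewrite -pE szs pd => /(_ isT) /esym/eqP.
  rewrite oppr_eq0 zsE big_nseq iter_addr_0 -mulr_natr mulf_eq0 pnatr_eq0 orbF
    => /eqP z10.
  case/eqP: pX; rewrite pE zsE big_nseq z10 subr0.
  by rewrite iter_mulr_1.
pose g := \prod_(z <- zs | z == z1) ('X - z%:P).
pose h := \prod_(z <- zs | z != z1) ('X - z%:P).
have c1 : (0 < count (pred1 z1) zs)%N by rewrite -has_count; apply/hasP;
  exists z1 => /=.
have c2 : (0 < count (predC (pred1 z1)) zs)%N.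
  by rewrite -has_count; apply/hasP; exists z2.
have c12 := count_predC (pred1 z1) zs.
exists g, h; split.
- exact: monic_prod_XsubC.
- exact: monic_prod_XsubC.
- rewrite /g; elim/big_ind: _ => [|q r qh rh|z /eqP ->].
  + exact: coprime1p.
  + by rewrite coprimepMl qh.
  + rewrite coprimep_sym coprimep_XsubC /h -big_filter root_prod_XsubC.
    by rewrite mem_filter eqxx.
- by rewrite pE (bigID (pred1 z1)).
have -> : size g = (count (pred1 z1) zs).+1.
  by rewrite /g -big_filter size_prod_XsubC size_filter.
have -> : size h = (count (predC (pred1 z1)) zs).+1.
  by rewrite /h -big_filter size_prod_XsubC size_filter.
rewrite sp -szs -c12 !ltnS; split.
  by rewrite -[ltnLHS]addn0 ltn_add2l.
by rewrite -[ltnLHS]add0n ltn_add2r.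
Qed.

Lemma cps_X_le a b (f g : cps K) : f 0%N != 0 -> cps_X K a * f = cps_X K b * g
  ->
  (b <= a)%N /\ g = cps_X K (a - b)%N * f.
Proof.
move=> f0 E; have ba : (b <= a)%N.
  rewrite leqNgt; apply: contra f0 => ab.
  have := congr1 (fun h : cps K => h a) E.
  by rewrite !cf_XM ltnn subnn ab => ->.
split=> //; apply: (@cps_X_inj _ b).
by rewrite -E mulrA -cps_XD subnKC.
Qed.

(* [q] is the least slope of the Newton polygon, which ramifying by
   [(d.+1)`!] makes an integer. *)
Lemma puiseux_reduced P d : P \is monic -> size P = d.+2 -> P`_d = 0 ->
  (exists2 i, (i <= d)%N & P`_i != 0) ->
  exists m q Q, [/\ Q \is monic, size Q = d.+2, Q`_d = 0,
    exists2 i, (i <= d)%N & cps_at0 Q`_i != 0 &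
    forall i, (i <= d.+1)%N ->
      (map_poly (cps_ram m) P)`_i = cps_X K (q * (d.+1 - i))%N * Q`_i].
Proof.
move=> mP sP Pd [i0 i0d Pi0].
have [m mE] : exists m, m.+1 = (d.+1)`! by exists ((d.+1)`!).-1;
  rewrite prednK // fact_gt0.
pose P' := map_poly (cps_ram m) P.
have ordP' i : (i <= d)%N -> P`_i != 0 ->
    exists v (g : cps K), [/\ g 0%N != 0, (d.+1 - i %| v)%N & P'`_i = cps_X K
      v * g].
  move=> id Pi; have [v [g [g0 gE]]] := cps_ordP Pi.
  exists (m.+1 * v)%N, (cps_ram m g); split; first by rewrite cf_ram dvdn0
    div0n.
    by rewrite dvdn_mulr // mE dvdn_fact // leq_subr subn_gt0 ltnS id.
  by rewrite coef_map /= gE rmorphM /= cps_ram_X.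
(* In terms of the Newton polygon, the points of the coefficients lie on or above the line of height
   [q * (d.+1 - i)] at [i]. The non-zero coefficient at [i0] bounds such [q], so that a largest one
   exists. *)
pose good q := forall i, (i <= d)%N -> exists b, P'`_i = cps_X K (q * (d.+1 -
  i))%N * b.
have [a0 [g0 [g00 _ gE0]]] := ordP' i0 i0d Pi0.
have good_le q : good q -> (q <= a0)%N.
  move=> /(_ i0 i0d) [b bE]; rewrite gE0 in bE.
  have [le_o _] := cps_X_le g00 bE.
  by apply: leq_trans le_o; rewrite leq_pmulr // subn_gt0 ltnS.
have ex_good : exists q, `[< good q >].
  exists 0%N; apply/asboolP => i _; exists P'`_i.
  by rewrite mul0n cps_X0 mul1r.
have bnd q : `[< good q >] -> (q <= a0)%N by move/asboolP/good_le.
case: (ex_maxnP ex_good bnd) => q /asboolP gq qmax.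
have [|b bE] := @choice nat (cps K)
    (fun i c => (i <= d)%N -> P'`_i = cps_X K (q * (d.+1 - i))%N * c).
  move=> i; case: (leqP i d) => [id|_]; last by exists 0.
  by have [c cE] := gq i id; exists c.
pose Q := \poly_(i < d.+2) (if i == d.+1 then 1 else b i).
have QE i : (i <= d)%N -> Q`_i = b i.
  by move=> id; rewrite coef_poly ltnS (leqW id) ltn_eqF.
have Qd : Q`_d.+1 = 1 by rewrite coef_poly ltnS leqnn eqxx.
have sQ : size Q = d.+2 by rewrite size_poly_eq // eqxx oner_eq0.
exists m, q, Q; split=> //.
- by rewrite monicE lead_coefE sQ Qd.
- rewrite QE //; apply: (@cps_X_inj _ (q * (d.+1 - d))%N).
  by rewrite mulr0 -bE // coef_map /= Pd rmorph0.
- apply: contrapT => none.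
  (* If every lower coefficient of [Q] vanished at 0, each order would strictly exceed
     [q * (d.+1 - i)]; being a multiple of [d.+1 - i], it would reach [q.+1 * (d.+1 - i)], against
     the maximality of [q]. *)
  suff /asboolP/qmax : good q.+1 by rewrite ltnn.
  move=> i id; have b0 : b i 0%N = 0.
    apply/eqP/negPn/negP => bi; apply: none; exists i => //.
    by rewrite QE.
  have [Pi|/(ordP' i id)[v [g [g00' dvo gE]]]] := eqVneq P`_i 0.
    by exists 0; rewrite mulr0 coef_map /= Pi rmorph0.
  have E : cps_X K v * g = cps_X K (q * (d.+1 - i))%N * b i by rewrite -gE bE.
  have [le_o bg] := cps_X_le g00' E.
  have lt_o : (q * (d.+1 - i) < v)%N.
    rewrite ltn_neqAle le_o andbT; apply: contraNneq g00' => oE.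
    by rewrite -b0 bg oE subnn cps_X0 mul1r.
  have {}le_o : (q.+1 * (d.+1 - i) <= v)%N.
    case/dvdnP: dvo lt_o => t ->; rewrite ltn_mul2r => /andP[_ qt].
    by rewrite leq_mul2r qt orbT.
  exists (cps_X K (v - q.+1 * (d.+1 - i))%N * g).
  by rewrite mulrA -cps_XD subnKC.
move=> i; rewrite leq_eqVlt => /orP[/eqP->|].
  by rewrite Qd subnn muln0 cps_X0 coef_map /= -[d.+1]/(d.+2.-1) -sP
    -lead_coefE (monicP mP) rmorph1 mulr1.
by rewrite ltnS => id; rewrite QE // bE.
Qed.

(** Translating by the mean of the roots, which is the subleading coefficient divided by [- d.+1],
    makes their sum vanish. *)
Lemma tschirnhaus (P : {poly cps K}) d : P \is monic -> size P = d.+2 ->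
  exists c, (P \Po ('X + c%:P))`_d = 0.
Proof.
move=> mP sP; pose e := cps_const (d.+1%:R^-1) * P`_d.
exists (- e); rewrite polyCN comp_polyE sP !big_ord_recr /=.
have sX k : size (('X - e%:P) ^+ k) = k.+1 by rewrite size_exp_XsubC.
have top k : (('X - e%:P) ^+ k)`_k = 1.
  by rewrite -[k in LHS]/(k.+1.-1) -{2}(sX k) -lead_coefE (monicP (monic_exp _
    (monicXsubC _))).
have sub : (('X - e%:P) ^+ d.+1)`_d = - (e *+ d.+1).
  have := @coefPn_prod_XsubC _ (nseq d.+1 e); rewrite size_nseq => /(_ isT).
  by rewrite !big_nseq iter_mulr_1 iter_addr_0.
have Pd1 : P`_d.+1 = 1.
  by rewrite -[d.+1]/(d.+2.-1) -sP -lead_coefE (monicP mP).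
rewrite !coefD coef_sum big1 => [|i _]; last first.
  by rewrite coefZ [X in _ * X]nth_default ?mulr0 // sX.
rewrite !coefZ top sub Pd1 mulr1 mul1r add0r -mulr_natl -(rmorph_nat
  (@cps_const K)).
by rewrite mulrA -(rmorphM (@cps_const K)) mulfV ?pnatr_eq0 // rmorph1 mul1r
  subrr.
Qed.

(** Induction on the degree. With the subleading coefficient removed and the variable scaled by the
    Newton slope, the polynomial at [s = 0] is not a power of ['X]; it thus has a proper coprime
    factorisation, which lifts to two factors of smaller degree. *)
Theorem puiseux P : P \is monic -> ram_splits P.
Proof.
have [n] := ubnP (size P); elim: n => // n IH in P *.
rewrite ltnS => sPn mP.
case sP : (size P) => [|[|d]].
- by move: (monic_neq0 mP); rewrite -size_poly_gt0 sP.
- have -> : P = 1.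
    have /size_poly1P[c _ cE] : size P == 1%N by rewrite sP.
    by move: mP; rewrite cE monicE lead_coefC => /eqP ->.
  by exists 0%N, [::]; rewrite rmorph1 big_nil.
have [c Pc] := tschirnhaus mP sP.
apply: (@ram_splits_shift c); set P1 := P \Po _ in Pc *.
have sXc : size ('X + c%:P) = 2 by rewrite size_XaddC.
have mP1 : P1 \is monic by rewrite monicE lead_coef_comp ?sXc // (monicP mP)
  lead_coefXaddC expr1n mul1r.
have sP1 : size P1 = d.+2 by rewrite size_comp_poly2.
have [P1X|P1X] := eqVneq P1 'X^(d.+1).
  exists 0%N, (nseq d.+1 0); rewrite P1X map_polyXn big_nseq.
  by rewrite subr0 iter_mulr_1.
have [|m [q [Q [mQ sQ Qd [i id Qi] PQ]]]] := puiseux_reduced mP1 sP1 Pc.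
  apply: contrapT => none; case/eqP: P1X; apply/polyP => i; rewrite coefXn.
  case: ltngtP => [id|id|->].
  - by apply/eqP/negPn/negP => Pi; apply: none; exists i.
  - by rewrite nth_default // sP1.
  - by rewrite -[d.+1]/(d.+2.-1) -sP1 -lead_coefE (monicP mP1).
apply: (@ram_splits_ram m); apply: (@ram_splits_scale q d.+1 _ Q) => //.
  by rewrite -sP1 size_poly.
have Q0E : map_poly (@cps_at0 K) Q = coefpoly 0 Q.
  by apply/polyP => j; rewrite [RHS]coef_coefpoly coef_map.
have mQ0 : map_poly (@cps_at0 K) Q \is monic by rewrite monic_map.
have sQ0 : size (map_poly (@cps_at0 K) Q) = d.+2.
  by rewrite size_map_poly_id0 ?sQ // (monicP mQ) rmorph1 oner_eq0.
have [||g [h [mg mh cop ghE [sg sh]]]] := monic_root_split mQ0 sQ0.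
- by rewrite coef_map /= Qd rmorph0.
- apply: contraNneq Qi => /polyP/(_ i); rewrite coef_map coefXn => ->.
  by rewrite ltn_eqF.
rewrite Q0E in ghE; have [G [H [mG mH sG sH ->]]] := hensel mQ mg mh cop ghE.
apply: ram_splits_mul; apply: IH => //.
  by rewrite sG (leq_trans sg) // sQ0 -sP.
by rewrite sH (leq_trans sh) // sQ0 -sP.
Qed.
End Puiseux.

Local Open Scope classical_set_scope.
Local Open Scope ring_scope.

Local Notation Re := (@complex.Re _).
Local Notation Im := (@complex.Im _).

(** * Germs at infinity *)

Section ComplexModulus.
Variable R : realType.
Implicit Types z w : R[i].
Local Open Scope complex_scope.

Lemma normr_cabs z : `|z| = (cabs z)%:C. Proof. by []. Qed.
Lemma cabs_ge0 z : 0 <= cabs z.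
Proof. by rewrite -lecR -normr_cabs normr_ge0. Qed.
Lemma cabsM z w : cabs (z * w) = cabs z * cabs w.
Proof. exact: ComplexField.Normc.normcM. Qed.
Lemma cabsV z : cabs z^-1 = (cabs z)^-1.
Proof. exact: ComplexField.Normc.normcV. Qed.
Lemma cabsN z : cabs (- z) = cabs z.
Proof. by apply: complexI; rewrite -!normr_cabs normrN. Qed.
Lemma cabsD z w : cabs (z + w) <= cabs z + cabs w.
Proof. by rewrite -lecR rmorphD -!normr_cabs ler_normD. Qed.
Lemma cabsB z w : cabs (z - w) = cabs (w - z).
Proof. by rewrite -cabsN opprB. Qed.
Lemma cabs0 : cabs (0 : R[i]) = 0. Proof. exact: ComplexField.Normc.normc0. Qed.
Lemma cabs1 : cabs (1 : R[i]) = 1. Proof. exact: ComplexField.Normc.normc1. Qed.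
Lemma cabs_eq0 z : (cabs z == 0) = (z == 0).
Proof. by rewrite -(inj_eq (@complexI R)) -normr_cabs normr_eq0. Qed.
Lemma cabs_gt0 z : (0 < cabs z) = (z != 0).
Proof. by rewrite lt_def cabs_eq0 cabs_ge0 andbT. Qed.
Lemma cabsX z n : cabs (z ^+ n) = cabs z ^+ n.
Proof. by elim: n => [|n IH]; rewrite ?expr0 ?cabs1 // !exprS cabsM IH. Qed.
Lemma cabs_real (x : R) : cabs x%:C = `|x|.
Proof. by rewrite /cabs /= expr0n addr0 sqrtr_sqr. Qed.
Lemma cabs_nat n : cabs (n%:R : R[i]) = n%:R.
Proof. by rewrite -(rmorph_nat (real_complex R)) cabs_real ger0_norm. Qed.
Lemma cabs_conj z : cabs z^* = cabs z.
Proof. by case: z => a b; rewrite /cabs /= sqrrN. Qed.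
Lemma cabs_sum I (r : seq I) (P : pred I) (F : I -> R[i]) :
  cabs (\sum_(i <- r | P i) F i) <= \sum_(i <- r | P i) cabs (F i).
Proof.
elim/big_ind2: _ => // [|x a y b xa yb]; first by rewrite cabs0.
by apply: le_trans (cabsD _ _) _; apply: lerD.
Qed.
Lemma cabs_dist z w : cabs z - cabs w <= cabs (z - w).
Proof. by rewrite lerBlDr -{1}[z](subrK w) cabsD. Qed.
Lemma Re_le_cabs z : `|Re z| <= cabs z.
Proof.
case: z => a b; rewrite /cabs /= -sqrtr_sqr ler_wsqrtr // lerDl sqr_ge0 //.
Qed.
Lemma Im_le_cabs z : `|Im z| <= cabs z.
Proof.
case: z => a b; rewrite /cabs /= -sqrtr_sqr ler_wsqrtr // lerDr sqr_ge0 //.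
Qed.
Lemma cabs_le_ReIm z : cabs z <= `|Re z| + `|Im z|.
Proof.
rewrite {1}(complexE z); apply: le_trans (cabsD _ _) _.
rewrite cabsM !cabs_real lerD2l -[leRHS]mul1r ler_wpM2r //.
by rewrite /cabs /= expr0n add0r expr1n sqrtr1.
Qed.

End ComplexModulus.

Section Archimedean.
Variable R : realType.

Lemma le_half_powers (a K : R) : (forall n, a <= K * 2^-1 ^+ n) -> a <= 0.
Proof.
move=> aK; rewrite leNgt; apply/negP => a0.
have K0 : 0 < K by have := aK 0%N; rewrite expr0 mulr1; apply: lt_le_trans.
have := aK (Num.bound (K / a)); apply/negP; rewrite -ltNge.
rewrite exprVn ltr_pdivrMr ?exprn_gt0 // mulrC -ltr_pdivrMr //.
apply: lt_trans (archi_boundP _) _; first by rewrite divr_ge0 // ltW.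
by rewrite -natrX ltr_nat ltn_expl.
Qed.

(** The intervals of centre [u n] and radius [2 * K * 2^-1 ^+ n] are nested; the limit is the
    supremum of their left ends. *)
Lemma half_cauchy (u : nat -> R) (K : R) :
  (forall n, `|u n.+1 - u n| <= K * 2^-1 ^+ n) ->
  exists l, forall n, `|l - u n| <= 2 * K * 2^-1 ^+ n.
Proof.
move=> uK; pose v n := 2 * K * 2^-1 ^+ n.
have K0 : 0 <= K by have := uK 0%N; rewrite expr0 mulr1; apply: le_trans.
have v0 n : 0 <= v n by rewrite !mulr_ge0 ?exprn_ge0.
have vS n : v n - v n.+1 = K * 2^-1 ^+ n by rewrite /v exprS; field.
have up n k : u n - v n <= u (n + k)%N - v (n + k)%N.
  elim: k => [|k IH]; rewrite ?addn0 //; apply: le_trans IH _; rewrite addnS.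
  by have := uK (n + k)%N; have := vS (n + k)%N;
    rewrite ler_norml => ? /andP[]; lra.
have dn n k : u (n + k)%N + v (n + k)%N <= u n + v n.
  elim: k => [|k IH]; rewrite ?addn0 //; apply: le_trans IH; rewrite addnS.
  by have := uK (n + k)%N; have := vS (n + k)%N;
    rewrite ler_norml => ? /andP[]; lra.
have cross n k : u n - v n <= u k + v k.
  apply: le_trans (up n k) _; apply: le_trans (_ : u (k + n)%N + v (k + n)%N
    <= _) => //.
  by rewrite addnC; have := v0 (k + n)%N; lra.
pose A := [set u n - v n | n in [set: nat]].
have ubA k : ubound A (u k + v k) by move=> _ [n _ <-].
have supA : has_sup A by split; [exists (u 0%N - v 0%N);
  exists 0%N | exists (u 0%N + v 0%N)].
exists (sup A) => n; rewrite ler_norml; apply/andP; split.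
  rewrite -/(v n) lerBrDl; apply: ub_le_sup; first by case: supA.
  by exists n.
by rewrite -/(v n) lerBlDl; apply: ge_sup; [case: supA | apply: ubA].
Qed.

End Archimedean.

(** * Sums of convergent series near 0 *)

Section Sums.
Variable R : realType.
Local Notation C := (R[i]).
Implicit Types (f g : cps C) (s z w : C).
Local Open Scope complex_scope.

(* Asking for geometric convergence makes the properties of sums follow from
   estimates on the partial sums, without limits. *)
Definition psum f s z := exists K : R, forall n,
  cabs (z - (cps_trunc n f).[s]) <= K * 2^-1 ^+ n.

Lemma psum_unique f s z w : psum f s z -> psum f s w -> z = w.
Proof.
move=> [K zK] [L wL]; apply/eqP; rewrite -subr_eq0 -cabs_eq0 eq_le cabs_ge0
  andbT.
apply: (@le_half_powers _ _ (K + L)) => n; rewrite mulrDl.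
apply: le_trans (lerD (zK n) (wL n)); rewrite [X in _ <= _ + X]cabsB.
by apply: le_trans (cabsD _ _); rewrite addrA subrK.
Qed.

Lemma cps_bound f : exists2 m : R, 1 <= m & forall k, cabs (f k) <= m ^+ k.+1.
Proof.
have [M M1 fM] := geometric_cf f.
have M0 : 0 <= M := le_trans ler01 M1.
have [m ME] : exists m : R, M = m%:C by exists (Re M);
  rewrite RRe_real // ger0_real.
rewrite ME in M1 fM; exists m; first by rewrite -lecR.
by move=> k; rewrite -lecR rmorphXn -normr_cabs.
Qed.

Lemma horner_trunc n f s : (cps_trunc n f).[s] = \sum_(k < n) f k * s ^+ k.
Proof. by rewrite horner_poly. Qed.

Lemma truncS n f s : (cps_trunc n.+1 f).[s] = (cps_trunc n f).[s] + f n * s ^+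
  n.
Proof. by rewrite !horner_trunc big_ord_recr. Qed.

Lemma psum_exists f : exists2 e : R, 0 < e & forall s, cabs s < e -> exists z,
  psum f s z.
Proof.
have [m m1 fm] := cps_bound f; have m0 := lt_le_trans ltr01 m1.
exists (m * 2)^-1 => [|s sm]; first by rewrite invr_gt0 mulr_gt0.
have term n : cabs (f n * s ^+ n) <= m * 2^-1 ^+ n.
  rewrite cabsM cabsX; apply: le_trans (ler_wpM2r _ (fm n)) _;
    first by rewrite exprn_ge0 ?cabs_ge0.
  rewrite exprS -mulrA ler_wpM2l ?(ltW m0) // -exprMn lerXn2r ?nnegrE
    ?mulr_ge0 ?cabs_ge0 ?(ltW m0) //.
  move: sm; rewrite invfM => /ltW sm; apply: le_trans (ler_wpM2l (ltW m0) sm) _.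
  by rewrite mulrA mulfV ?mul1r // gt_eqF.
have [a aE] : exists a, forall n, `|a - Re (cps_trunc n f).[s]| <= 2 * m *
  2^-1 ^+ n.
  apply: half_cauchy => n; rewrite truncS raddfD addrC addKr.
  by apply: le_trans (Re_le_cabs _) _.
have [b bE] : exists b, forall n, `|b - Im (cps_trunc n f).[s]| <= 2 * m *
  2^-1 ^+ n.
  apply: half_cauchy => n; rewrite truncS raddfD addrC addKr.
  by apply: le_trans (Im_le_cabs _) _.
exists (a +i* b), (2 * m + 2 * m) => n; apply: le_trans (cabs_le_ReIm _) _.
by rewrite mulrDl !raddfB; apply: lerD; [apply: aE|apply: bE].
Qed.

Lemma psum_const c s : psum (cps_const c) s c.
Proof.
exists (cabs c) => -[|n]; first by rewrite horner_trunc big_ord0 subr0 mulr1.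
rewrite horner_trunc big_ord_recl big1 /= => [|i _]; last by rewrite mul0r.
by rewrite mulr1 addr0 subrr cabs0 mulr_ge0 ?cabs_ge0 // exprn_ge0.
Qed.

Lemma psum_add f g s z w : psum f s z -> psum g s w -> psum (f + g) s (z + w).
Proof.
move=> [K zK] [L wL]; exists (K + L) => n; rewrite mulrDl.
have -> : (cps_trunc n (f + g)).[s] = (cps_trunc n f).[s] + (cps_trunc n g).[s].
  rewrite !horner_trunc -big_split; apply: eq_bigr => k _; exact: mulrDl.
by rewrite opprD addrACA; apply: le_trans (cabsD _ _) _; apply: lerD.
Qed.

Lemma psum_mul f g : exists2 e : R, 0 < e & forall s z w, cabs s < e ->
  psum f s z -> psum g s w -> psum (f * g) s (z * w).
Proof.
have [m m1 fm] := cps_bound f; have [l l1 gl] := cps_bound g.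
have m0 := lt_le_trans ltr01 m1; have l0 := lt_le_trans ltr01 l1.
pose B := 2 * (m * l); have B0 : 0 < B by rewrite !mulr_gt0.
exists (4 * B)^-1 => [|s z w sB [K zK] [L wL]];
  first by rewrite invr_gt0 mulr_gt0.
have coefB n k : cabs (cps_trunc n f * cps_trunc n g)`_k <= B ^+ k.+1.
  rewrite coefM; apply: le_trans (cabs_sum _ _ _) _.
  apply: le_trans (_ : \sum_(j < k.+1) (m * l) ^+ k.+1 <= _).
    have tr (h : cps C) (b : R) j : (1 <= b) -> (forall k, cabs (h k) <= b ^+
      k.+1) -> (j <= k)%N ->
        cabs (cps_trunc n h)`_j <= b ^+ k.+1.
      move=> b1 hb jk; have b0 := le_trans ler01 b1; rewrite coef_poly;
        case: ifP => _.
        by apply: le_trans (hb j) _; rewrite ler_weXn2l.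
      by rewrite cabs0 exprn_ge0.
    apply: ler_sum => j _; rewrite cabsM exprMn ler_pM ?cabs_ge0 //.
      by rewrite tr // -ltnS.
    by rewrite tr // leq_subr.
  rewrite sumr_const card_ord -[_ *+ k.+1]mulr_natl /B [leRHS]exprMn ler_wpM2r
    //.
    by rewrite exprn_ge0 ?mulr_ge0 // ltW.
  by rewrite -natrX ler_nat ltnW // ltn_expl.
(* The product of the truncations has at most [n] terms beyond the truncated product, each at most
   [B * 4^-1 ^+ n]. The radius [(4 * B)^-1] leaves a factor [2^-1 ^+ n] to absorb their number. *)
have tail n : cabs ((cps_trunc n f).[s] * (cps_trunc n g).[s] - (cps_trunc n
  (f * g)).[s]) <=
    B * 2^-1 ^+ n.
  have sizeM : (size (cps_trunc n f * cps_trunc n g)%R <= n + n)%N.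
    apply: leq_trans (size_polyMleq _ _) _; apply: leq_trans (leq_pred _) _.
    by apply: leq_add; apply: size_poly.
  rewrite -hornerM (horner_coef_wide _ sizeM) big_split_ord /= horner_trunc.
  have -> : \sum_(k < n) (f * g) k * s ^+ k =
            \sum_(k < n) (cps_trunc n f * cps_trunc n g)`_k * s ^+ k.
    by apply: eq_bigr => k _; rewrite -trunc_mul // coef_trunc.
  rewrite [X in cabs X]addrC addKr; apply: le_trans (cabs_sum _ _ _) _.
  apply: le_trans (_ : \sum_(k < n) B * 4^-1 ^+ n <= _).
    apply: ler_sum => k _; rewrite cabsM cabsX.
    apply: le_trans (ler_wpM2r _ (coefB _ _)) _;
      first by rewrite exprn_ge0 ?cabs_ge0.
    rewrite exprS -mulrA ler_wpM2l ?(ltW B0) // -exprMn exprD -[leRHS]mulr1.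
    have Bs : B * cabs s <= 4^-1.
      move: sB; rewrite invfM => /ltW sB; apply: le_trans (ler_wpM2l (ltW B0)
        sB) _.
      by rewrite mulrCA mulfV ?mulr1 // gt_eqF.
    have Bs0 : 0 <= B * cabs s by rewrite mulr_ge0 ?cabs_ge0 // ltW.
    apply: ler_pM; rewrite ?exprn_ge0 //; first by rewrite lerXn2r ?nnegrE.
    rewrite exprn_ile1 //; apply: le_trans Bs _; lra.
  rewrite sumr_const card_ord -[_ *+ n]mulr_natl mulrCA ler_wpM2l ?(ltW B0) //.
  have -> : 4^-1 = 2^-1 * 2^-1 :> R by field.
  rewrite exprMn mulrA -[leRHS]mul1r ler_wpM2r ?exprn_ge0 //.
  by rewrite exprVn ler_pdivrMr ?exprn_gt0 // mul1r -natrX ler_nat ltnW //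
    ltn_expl.
exists (cabs z * L + (cabs w + L) * K + B) => n.
have -> : z * w - (cps_trunc n (f * g)).[s] = z * (w - (cps_trunc n g).[s]) +
   (cps_trunc n g).[s] * (z - (cps_trunc n f).[s]) +
   ((cps_trunc n f).[s] * (cps_trunc n g).[s] - (cps_trunc n (f * g)).[s]) by
     ring.
apply: le_trans (cabsD _ _) _; rewrite [leRHS]mulrDl; apply: lerD => //.
apply: le_trans (cabsD _ _) _; rewrite [leRHS]mulrDl; apply: lerD.
  by rewrite cabsM -mulrA ler_wpM2l ?cabs_ge0.
rewrite cabsM -mulrA ler_pM ?cabs_ge0 //.
have : cabs w + L * 2^-1 ^+ n <= cabs w + L.
  rewrite lerD2l -[leRHS]mulr1 ler_wpM2l ?exprn_ile1 //; last lra.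
  by have := wL 0%N; rewrite expr0 mulr1; apply: le_trans; apply: cabs_ge0.
apply: le_trans; rewrite addrC -lerBlDr; apply: le_trans (wL n).
by rewrite [leRHS]cabsB; apply: cabs_dist.
Qed.

End Sums.

(** * Laurent germs at complex infinity *)

Section SumsAtPoints.
Variable R : realType.
Local Notation C := (R[i]).
Implicit Types (f : cps C) (g h : C -> C) (s z w t : C).
Local Open Scope complex_scope.

Lemma psum_X n s : psum (cps_X C n) s (s ^+ n).
Proof.
exists (cabs (s ^+ n) * 2 ^+ n) => k; rewrite horner_trunc.
case: (ltnP n k) => [nk|kn].
  rewrite (bigD1 (Ordinal nk)) //= eqxx mul1r big1 ?addr0 => [|i /negbTE ni].
    by rewrite subrr cabs0 !mulr_ge0 ?cabs_ge0 // exprn_ge0.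
  by rewrite -[_ == n]/(i == Ordinal nk) ni mul0r.
rewrite big1 => [|i _]; last by rewrite /= ltn_eqF ?mul0r // (leq_trans
  (ltn_ord i)).
rewrite subr0 -[leLHS]mulr1 -mulrA ler_wpM2l ?cabs_ge0 //.
by rewrite exprVn ler_pdivlMr ?exprn_gt0 // mul1r ler_weXn2l // ler1n.
Qed.

Lemma geometric_conj f : geometric (fun k => (f k)^*).
Proof.
by apply: geometric_le (geometric_cf f) _ => k; rewrite !normr_cabs cabs_conj.
Qed.
Definition cps_conj f := cps_of (geometric_conj f).

Lemma psum_conj f s z : psum f s z -> psum (cps_conj f) s^* z^*.
Proof.
move=> [K zK]; exists K => n; apply: le_trans (zK n).
rewrite -[leRHS]cabs_conj rmorphB /= !horner_trunc rmorph_sum.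
rewrite (eq_bigr (fun k : 'I_n => (f k * s ^+ k)^*)) // => k _.
by rewrite rmorphM rmorphXn.
Qed.

Lemma psum_near0 f : exists2 e : R, 0 < e & exists c : R, forall s z,
  cabs s < e -> psum f s z -> cabs (z - f 0%N) <= c * cabs s.
Proof.
have [m m1 fm] := cps_bound f; have m0 := lt_le_trans ltr01 m1.
exists (m * 2)^-1; first by rewrite invr_gt0 mulr_gt0.
exists (m ^+ 2 * 2) => s z sm [K zK].
have ms : m * cabs s <= 2^-1.
  move: sm; rewrite invfM => /ltW sm; apply: le_trans (ler_wpM2l (ltW m0) sm) _.
  by rewrite mulrA mulfV ?mul1r // gt_eqF.
have ms0 : 0 <= m * cabs s by rewrite mulr_ge0 ?cabs_ge0 // ltW.
have head n : cabs ((cps_trunc n.+1 f).[s] - f 0%N) <= m ^+ 2 * 2 * cabs s.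
  rewrite horner_trunc big_ord_recl expr0 mulr1 addrC addKr.
  apply: le_trans (cabs_sum _ _ _) _.
  apply: le_trans (_ : \sum_(k < n) m ^+ 2 * cabs s * 2^-1 ^+ k <= _).
    apply: ler_sum => k _; rewrite cabsM cabsX /=.
    apply: le_trans (ler_wpM2r _ (fm _)) _; first by rewrite exprn_ge0
      ?cabs_ge0.
    have -> : m ^+ k.+2 * cabs s ^+ k.+1 = m ^+ 2 * cabs s * (m * cabs s) ^+ k.
      by rewrite exprMn !exprS expr0; ring.
    by rewrite ler_wpM2l ?mulr_ge0 ?cabs_ge0 ?exprn_ge0 ?(ltW m0) // lerXn2r
      ?nnegrE.
  rewrite -mulr_sumr -[leRHS]mulrAC ler_wpM2l ?half_sum_le //.
  by rewrite mulr_ge0 ?cabs_ge0 ?exprn_ge0 // ltW.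
rewrite -subr_le0; apply: (@le_half_powers _ _ (K * 2^-1)) => n.
rewrite lerBlDr -mulrA -exprS; apply: le_trans (lerD (zK n.+1) (head n)).
by apply: le_trans (cabsD _ _); rewrite addrA subrK.
Qed.

Lemma trunc_ram n k f s :
  (cps_trunc (k * n.+1) (cps_ram n f)).[s] = (cps_trunc k f).[s ^+ n.+1].
Proof.
rewrite -[s ^+ n.+1](hornerXn s) -horner_comp; congr horner; apply/polyP => i.
rewrite coef_comp_poly_Xn // !coef_poly -ltn_divLR //.
by case: ifP => ik; rewrite ?cf_ram; case: ifP.
Qed.

(** The partial sums of the ramified series at multiples of [n.+1] are the partial sums of [f] at
    [s ^+ n.+1], so both sums have the same approximations. *)
Lemma psum_ram n f s z w :
  psum f (s ^+ n.+1) z -> psum (cps_ram n f) s w -> z = w.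
Proof.
move=> [K zK] [L wL]; apply/eqP; rewrite -subr_eq0 -cabs_eq0 eq_le cabs_ge0
  andbT.
have L0 : 0 <= L.
  by have := wL 0%N; rewrite expr0 mulr1; apply: le_trans; apply: cabs_ge0.
apply: (@le_half_powers _ _ (K + L)) => k; rewrite mulrDl.
have wk := wL (k * n.+1)%N; rewrite trunc_ram in wk.
have {}wk : cabs (w - (cps_trunc k f).[s ^+ n.+1]) <= L * 2^-1 ^+ k.
  apply: le_trans wk _; rewrite ler_wpM2l // ler_wiXn2l ?leq_pmulr //; lra.
apply: le_trans (lerD (zK k) wk); rewrite [X in _ <= _ + X]cabsB.
by apply: le_trans (cabsD _ _); rewrite addrA subrK.
Qed.

Definition at_large (P : C -> Prop) := exists r : R, forall t, r < cabs t -> P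
  t.

Lemma at_large_and (P Q : C -> Prop) :
  at_large P -> at_large Q -> at_large (fun t => P t /\ Q t).
Proof.
move=> [r rP] [q qQ]; exists (Num.max r q) => t; rewrite gt_max => /andP[rt qt].
by split; [apply: rP|apply: qQ].
Qed.

Lemma at_large_imp (P Q : C -> Prop) :
  (forall t, P t -> Q t) -> at_large P -> at_large Q.
Proof. by move=> PQ [r rP]; exists r => t /rP/PQ. Qed.

Lemma at_large_forall n (P : nat -> C -> Prop) :
  (forall k, (k < n)%N -> at_large (P k)) ->
  at_large (fun t => forall k, (k < n)%N -> P k t).
Proof.
elim: n => [|n IH] nP; first by exists 0.
have := at_large_and (IH (fun k kn => nP k (ltnW kn))) (nP n (ltnSn n)).
apply: at_large_imp => t [Pt Pn] k; rewrite ltnS leq_eqVlt => /orP[/eqP-> //|].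
exact: Pt.
Qed.

Lemma at_large_gt (a : R) : at_large (fun t => a < cabs t).
Proof. by exists a. Qed.

Lemma at_large_neq0 : at_large (fun t => t != 0).
Proof. by exists 0 => t; rewrite cabs_gt0. Qed.

Lemma at_large_inv (e : R) : 0 < e -> at_large (fun t => cabs t^-1 < e).
Proof.
move=> e0; exists e^-1 => t et; rewrite cabsV.
have t0 : 0 < cabs t by apply: lt_trans et; rewrite invr_gt0.
by rewrite -[e]invrK ltf_pV2 ?posrE ?invr_gt0.
Qed.

Lemma at_large_conj (P : C -> Prop) : at_large P -> at_large (fun t => P t^*).
Proof. by move=> [r rP]; exists r => t rt; apply: rP; rewrite cabs_conj. Qed.

Lemma at_large_exp n (P : C -> Prop) : at_large P -> at_large (fun t => P (t
  ^+ n.+1)).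
Proof.
move=> [r rP]; exists (Num.max 1 r) => t; rewrite gt_max => /andP[t1 rt].
by apply: rP; rewrite cabsX (lt_le_trans rt) // ler_eXnr // ltW.
Qed.

(* The sum of the series [f] at [1/t], arbitrary if there is none. *)
Definition cev f t : C := xget 0 [set z | psum f t^-1 z].

Lemma cevP f : at_large (fun t => psum f t^-1 (cev f t)).
Proof.
have [e e0 ex] := psum_exists f; have := at_large_inv e0.
by apply: at_large_imp => t /ex[z fz]; apply: xgetPex; exists z.
Qed.

Lemma cev_unique f (g : C -> C) :
  at_large (fun t => psum f t^-1 (g t)) -> at_large (fun t => cev f t = g t).
Proof.
move=> fg; have := at_large_and fg (cevP f); apply: at_large_imp => t [a b].
exact: psum_unique b a.
Qed.

Lemma cev_const (c : C) : at_large (fun t => cev (cps_const c) t = c).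
Proof. by apply: cev_unique; exists 0 => t _; apply: psum_const. Qed.

Lemma cev_X n : at_large (fun t => cev (cps_X C n) t = t^-1 ^+ n).
Proof. by apply: cev_unique; exists 0 => t _; apply: psum_X. Qed.

Lemma cevD f (g : cps C) : at_large (fun t => cev (f + g) t = cev f t + cev g
  t).
Proof.
apply: cev_unique; have := at_large_and (cevP f) (cevP g).
by apply: at_large_imp => t [ft gt]; apply: psum_add.
Qed.

Lemma cevM f (g : cps C) : at_large (fun t => cev (f * g) t = cev f t * cev g
  t).
Proof.
apply: cev_unique; have [e e0 fg] := psum_mul f g.
have := at_large_and (at_large_inv e0) (at_large_and (cevP f) (cevP g)).
by apply: at_large_imp => t [te [ft gt]]; apply: fg.
Qed.

Lemma cev_conj f : at_large (fun t => cev (cps_conj f) t = (cev f t^*)^*).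
Proof.
apply: cev_unique; have := at_large_conj (cevP f); apply: at_large_imp => t.
by move/psum_conj; rewrite -conjc_inv conjcK.
Qed.

Lemma cev_ram n f : at_large (fun t => cev (cps_ram n f) t = cev f (t ^+ n.+1)).
Proof.
have := at_large_and (cevP (cps_ram n f)) (at_large_exp n (cevP f)).
apply: at_large_imp => t [rt ft]; apply/esym.
by apply: psum_ram rt; rewrite exprVn.
Qed.

Lemma cev_near f : exists c : R, at_large (fun t => cabs (cev f t - f 0%N) <=
  c * cabs t^-1).
Proof.
have [e e0 [c fc]] := psum_near0 f; exists c.
have := at_large_and (at_large_inv e0) (cevP f).
by apply: at_large_imp => t [te ft]; apply: fc.
Qed.

Lemma cev_bounds f : f 0%N != 0 ->
  at_large (fun t => cabs (f 0%N) / 2 <= cabs (cev f t) <= 2 * cabs (f 0%N)).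
Proof.
rewrite -cabs_gt0 => f0; have [c fc] := cev_near f.
have e0 : 0 < cabs (f 0%N) / 2 / (1 + `|c|) by rewrite !divr_gt0 // ltr_pwDl.
have := at_large_and fc (at_large_inv e0); apply: at_large_imp => t [ct].
rewrite ltr_pdivlMr ?ltr_pwDl // => te.
have small : c * cabs t^-1 <= cabs (f 0%N) / 2.
  apply: le_trans (ltW te); rewrite mulrC ler_wpM2l ?cabs_ge0 //.
  by apply: le_trans (ler_norm _) _; rewrite lerDr.
have d1 := cabs_dist (cev f t) (f 0%N).
have d2 := cabs_dist (f 0%N) (cev f t); rewrite cabsB in d2.
by apply/andP; split; lra.
Qed.

(* A germ at infinity of a convergent Laurent series. *)
Definition lgerm (g : C -> C) := exists d f, at_large (fun t => g t = t ^+ d *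
  cev f t).

Lemma lgerm_eq (g h : C -> C) : lgerm g -> at_large (fun t => h t = g t) ->
  lgerm h.
Proof.
move=> [d [f gE]] hg; exists d, f; have := at_large_and gE hg.
by apply: at_large_imp => t [-> ->].
Qed.

(** The exponent [d] only bounds the order of the pole and can be raised, which provides common
    exponents for sums and families. *)
Lemma lgerm_raise (g : C -> C) d f n : at_large (fun t => g t = t ^+ d * cev f
  t) ->
  at_large (fun t => g t = t ^+ (d + n) * cev (cps_X C n * f) t).
Proof.
move=> gE; have := at_large_and (at_large_and gE at_large_neq0)
  (at_large_and (cevM (cps_X C n) f) (cev_X n)).
apply: at_large_imp => t [[-> t0] [-> ->]].
by rewrite exprD -mulrA [t ^+ n * _]mulrA -exprMn mulfV // expr1n mul1r.
Qed.

Lemma lgerm_family n (c : nat -> C -> C) : (forall k, (k < n)%N -> lgerm (c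
  k)) ->
  exists D fs, at_large (fun t => forall k, (k < n)%N -> c k t = t ^+ D * cev
    (fs k) t).
Proof.
elim: n => [|n IH] cn; first by exists 0%N, (fun=> 0); exists 0.
have [D [fs fsE]] := IH (fun k kn => cn k (ltnW kn)).
have [d [f fE]] := cn n (ltnSn n).
exists (d + D)%N, (fun k => if (k < n)%N then cps_X C d * fs k else cps_X C D
  * f).
apply: at_large_forall => k; rewrite ltnS leq_eqVlt => /orP[/eqP->|kn].
  by rewrite ltnn; apply: lgerm_raise.
rewrite kn addnC; apply: lgerm_raise; apply: at_large_imp fsE => t; exact.
Qed.

Lemma lgerm_cst c : lgerm (fun=> c).
Proof.
exists 0%N, (cps_const c); apply: at_large_imp (cev_const c) => t ->.
by rewrite mul1r.
Qed.

Lemma lgerm_id : lgerm id.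
Proof.
exists 1%N, (cps_const 1); apply: at_large_imp (cev_const 1) => t ->.
by rewrite mulr1.
Qed.

Lemma lgerm_add g h : lgerm g -> lgerm h -> lgerm (fun t => g t + h t).
Proof.
move=> [d [f gE]] [d' [f' hE]].
exists (d + d')%N, (cps_X C d' * f + cps_X C d * f').
have := at_large_and (at_large_and (lgerm_raise d' gE) (lgerm_raise d hE))
  (cevD (cps_X C d' * f) (cps_X C d * f')).
by apply: at_large_imp => t [[-> ->] ->]; rewrite [(d' + d)%N]addnC mulrDr.
Qed.

Lemma lgerm_mul g h : lgerm g -> lgerm h -> lgerm (fun t => g t * h t).
Proof.
move=> [d [f gE]] [d' [f' hE]]; exists (d + d')%N, (f * f').
have := at_large_and (at_large_and gE hE) (cevM f f').
by apply: at_large_imp => t [[-> ->] ->]; rewrite exprD mulrACA.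
Qed.

Lemma lgerm_exp g n : lgerm g -> lgerm (fun t => g t ^+ n).
Proof.
move=> gg; elim: n => [|n IH]; first exact: lgerm_cst.
by apply: lgerm_eq (lgerm_mul gg IH) _; exists 0 => t _; rewrite exprS.
Qed.

Lemma lgerm_conj g : lgerm g -> lgerm (fun t => (g t^*)^*).
Proof.
move=> [d [f gE]]; exists d, (cps_conj f).
have := at_large_and (at_large_conj gE) (cev_conj f).
by apply: at_large_imp => t [-> ->]; rewrite rmorphM rmorphXn /= conjcK.
Qed.

Lemma lgerm_ram n g : lgerm g -> lgerm (fun t => g (t ^+ n.+1)).
Proof.
move=> [d [f gE]]; exists (n.+1 * d)%N, (cps_ram n f).
have := at_large_and (at_large_exp n gE) (cev_ram n f).
by apply: at_large_imp => t [-> ->]; rewrite exprM.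
Qed.

Lemma lgerm_order g : lgerm g -> at_large (fun t => g t = 0) \/
  exists d n (h : cps C), h 0%N != 0 /\ at_large (fun t => g t = t ^+ d * t^-1
    ^+ n * cev h t).
Proof.
move=> [d [f gE]]; have [f0|/cps_ordP[n [h [h0 fE]]]] := eqVneq f 0;
  [left|right].
  have := at_large_and gE (cev_const 0); apply: at_large_imp => t [-> ct].
  by rewrite f0 -(rmorph0 (@cps_const C)) ct mulr0.
exists d, n, h; split=> //.
have := at_large_and gE (at_large_and (cevM (cps_X C n) h) (cev_X n)).
by apply: at_large_imp => t [->]; rewrite fE -mulrA => -[-> ->].
Qed.

Lemma lgerm_inv g : lgerm g -> lgerm (fun t => (g t)^-1).
Proof.
move=> /lgerm_order[g0|[d [n [h [h0 gE]]]]].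
  by apply: lgerm_eq (lgerm_cst 0) _; apply: at_large_imp g0 => t ->;
    rewrite invr0.
have [k hk] := cps_inverse h0; exists n, (cps_X C d * k).
have := at_large_and (at_large_and gE (cevM h k)) (at_large_and (at_large_and
  (cevM (cps_X C d) k) (cev_X d)) (cev_const 1)).
apply: at_large_imp => t [[-> ]]; rewrite hk -(rmorph1 (@cps_const C)).
move=> hkE [[-> ->]]; rewrite hkE => hk1.
have /mulr1_eq/esym -> := hk1.
by rewrite !invfM -!exprVn invrK mulrA [t ^+ n * _]mulrC.
Qed.

Lemma lgerm_asymp g : lgerm g -> at_large (fun t => g t = 0) \/
  exists k : int, exists c1 c2 : R, [/\ 0 < c1, 0 < c2 &
    at_large (fun t => c1 * cabs t ^ k <= cabs (g t) <= c2 * cabs t ^ k)].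
Proof.
move=> /lgerm_order[g0|[d [n [h [h0 gE]]]]]; [by left|right].
exists (d%:Z - n%:Z), (cabs (h 0%N) / 2), (2 * cabs (h 0%N)).
rewrite divr_gt0 ?mulr_gt0 ?cabs_gt0 //; split=> //.
have := at_large_and (at_large_and gE at_large_neq0) (cev_bounds h0).
apply: at_large_imp => t [[-> t0] /andP[ha hb]].
have ct0 : 0 < cabs t by rewrite cabs_gt0.
rewrite !cabsM !cabsX cabsV expfzDr ?gt_eqF // -exprnN -exprVn -exprnP.
have c0 : 0 <= cabs t ^+ d * (cabs t)^-1 ^+ n.
  by rewrite mulr_ge0 ?exprn_ge0 ?invr_ge0 // ltW.
by rewrite [cabs (h 0%N) / 2 * _]mulrC [2 * cabs (h 0%N) * _]mulrC !ler_wpM2l.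
Qed.

(** This identity principle carries polynomial equations from the real half-line to all large
    complex numbers. *)
Lemma lgerm_eq0_or_neq0 g : lgerm g ->
  at_large (fun t => g t = 0) \/ at_large (fun t => g t != 0).
Proof.
case/lgerm_asymp => [|[k [c1 [c2 [c10 _ gk]]]]]; [by left|right].
have := at_large_and gk (at_large_gt 0); apply: at_large_imp => t [/andP[ck _]
  t0].
by rewrite -cabs_gt0 (lt_le_trans _ ck) // mulr_gt0 // exprz_gt0.
Qed.

End SumsAtPoints.

(** * Roots of polynomials over Laurent germs *)

Section Roots.
Variable R : realType.
Local Notation C := (R[i]).
Implicit Types (P Q : {poly cps C}) (t : C).

Definition map_cev t Q : {poly C} := \poly_(i < size Q) cev Q`_i t.

Lemma cev0 : at_large (fun t => cev 0 t = 0 :> C).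
Proof. by apply: at_large_imp (cev_const 0) => t; rewrite rmorph0. Qed.

Lemma coef_map_cev Q : at_large (fun t => forall i, (map_cev t Q)`_i = cev
  Q`_i t).
Proof.
apply: at_large_imp cev0 => t t0 i; rewrite coef_poly; case: ltnP => // iQ.
by rewrite nth_default.
Qed.

Lemma cev_sum n (F : nat -> cps C) :
  at_large (fun t => cev (\sum_(i < n) F i) t = \sum_(i < n) cev (F i) t).
Proof.
elim: n => [|n IH].
  by apply: at_large_imp cev0 => t; rewrite !big_ord0.
have := at_large_and IH (cevD (\sum_(i < n) F i) (F n)).
by apply: at_large_imp => t [IHt Dt]; rewrite !big_ord_recr /= Dt IHt.
Qed.

Lemma map_cevM P Q :
  at_large (fun t => map_cev t (P * Q) = map_cev t P * map_cev t Q).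
Proof.
pose n := (size P + size Q)%N.
have co : at_large (fun t => forall i, (i < n)%N ->
    cev (P * Q)`_i t = \sum_(j < i.+1) cev P`_j t * cev Q`_(i - j) t).
  apply: at_large_forall => i _.
  have mulE : at_large (fun t => forall j, (j < i.+1)%N ->
      cev (P`_j * Q`_(i - j)) t = cev P`_j t * cev Q`_(i - j) t).
    by apply: at_large_forall => j _; apply: cevM.
  have := at_large_and mulE (cev_sum i.+1 (fun j => P`_j * Q`_(i - j))).
  apply: at_large_imp => t [tM tS]; rewrite coefM tS.
  by apply: eq_bigr => j _; apply: tM.
have := at_large_and (at_large_and co (coef_map_cev P))
  (at_large_and (coef_map_cev Q) (coef_map_cev (P * Q))).
apply: at_large_imp => t [[tn tP] [tQ tPQ]]; apply/polyP => i.
case: (ltnP i n) => [i_n|n_i].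
  by rewrite tPQ tn // coefM; apply: eq_bigr => j _; rewrite tP tQ.
have sPQ : (size (P * Q)%R <= n)%N.
  by apply: leq_trans (size_polyMleq _ _) (leq_pred _).
rewrite !nth_default //.
  apply: leq_trans n_i; apply: leq_trans (size_polyMleq _ _) _.
  by apply: leq_trans (leq_pred _) _; apply: leq_add; apply: size_poly.
by apply: leq_trans n_i; apply: leq_trans sPQ; apply: size_poly.
Qed.

Lemma map_cev_prod (rs : seq (cps C)) : at_large (fun t =>
  map_cev t (\prod_(r <- rs) ('X - r%:P)) = \prod_(r <- rs) ('X - (cev r
    t)%:P)).
Proof.
elim: rs => [|r rs IH].
  have := at_large_and (coef_map_cev 1) (at_large_and cev0 (cev_const 1)).
  apply: at_large_imp => t [t1 [tc0 tc1]]; apply/polyP => i.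
  rewrite !big_nil t1 !coef1; case: i => [|i] /=; last exact: tc0.
  by rewrite -(rmorph1 (@cps_const C)).
have lin : at_large (fun t => map_cev t ('X - r%:P) = 'X - (cev r t)%:P).
  have := at_large_and (coef_map_cev ('X - r%:P)) (at_large_and
    (at_large_and cev0 (cev_const 1)) (at_large_and (cevM (cps_const (-1)) r)
      (cev_const (-1)))).
  apply: at_large_imp => t [tX [[tc0 tc1] [tM tN]]]; apply/polyP => i.
  rewrite tX !coefB !coefX !coefC; case: i => [|[|i]] /=.
  - by rewrite !sub0r -mulN1r -(rmorph1 (@cps_const C)) -rmorphN tM tN mulN1r.
  - by rewrite !subr0 -(rmorph1 (@cps_const C)).
  - by rewrite !subr0.
have := at_large_and IH (at_large_and lin (map_cevM ('X - r%:P) (\prod_(r <-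
  rs) ('X - r%:P)))).
by apply: at_large_imp => t [IHt [lt Mt]]; rewrite !big_cons Mt IHt lt.
Qed.

(** Puiseux's theorem wants a monic polynomial over power series in [1/t]. Dividing by the leading
    germ makes it monic, and rescaling the unknown by a large power of [t] removes the poles of the
    other coefficients. *)
Lemma lgerm_roots d (c : nat -> C -> C) :
  (forall k, (k <= d)%N -> lgerm (c k)) -> at_large (fun t => c d t != 0) ->
  exists n (etas : seq (C -> C)), (forall i, lgerm (nth (fun=> 0) etas i)) /\
    at_large (fun t => forall y, \sum_(k < d.+1) c k (t ^+ n.+1) * y ^+ k =
      c d (t ^+ n.+1) * \prod_(eta <- etas) (y - eta t)).
Proof.
move=> cg cd; have [D [fs fsE]] := @lgerm_family _ d (fun k t => c k t / c d t)
  (fun k kd => lgerm_mul (cg k (ltnW kd)) (lgerm_inv (cg d (leqnn d)))).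
(* Under [y = T ^+ D * w], with [T] the argument of the germs, the normalised coefficient of
   [w ^+ k] is [T^-1 ^+ e k] times the value of [fs k]. The truncated subtraction is exact for
   [k < d]. *)
pose e k := (D * (d - k) - D)%N.
pose P : {poly cps C} := \poly_(k < d.+1) (if k == d then 1 else cps_X C (e k)
  * fs k).
have Pd : P`_d = 1 by rewrite coef_poly ltnSn eqxx.
have Pk k : (k < d)%N -> P`_k = cps_X C (e k) * fs k.
  by move=> kd; rewrite coef_poly ltnS ltnW // ltn_eqF.
have sP : size P = d.+1 by rewrite size_poly_eq // eqxx oner_eq0.
have mP : P \is monic by rewrite monicE lead_coefE sP Pd.
have [n [rs rsE]] := puiseux mP.
have srs : size rs = d.
  apply/eq_add_S; rewrite -(size_prod_XsubC rs id) -rsE -sP.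
  by rewrite size_map_poly_id0 // (monicP mP) rmorph1 oner_eq0.
exists n, [seq (fun t => (t ^+ n.+1) ^+ D * cev r t) | r <- rs]; split.
  move=> i; case: (ltnP i (size rs)) => [irs|rsi].
    rewrite (nth_map 0) //; apply: lgerm_mul.
      by apply: lgerm_exp; apply: lgerm_exp; apply: lgerm_id.
    by exists 0%N, (nth 0 rs i); exists 0 => t _; rewrite mul1r.
  by rewrite nth_default ?size_map //; apply: lgerm_cst.
have coefs : at_large (fun t => forall k, (k < d)%N ->
    cev (cps_ram n P`_k) t = (t ^+ n.+1)^-1 ^+ e k * cev (fs k) (t ^+ n.+1)).
  apply: at_large_forall => k kd; rewrite (Pk _ kd).
  have := at_large_and (cev_ram n (cps_X C (e k) * fs k))
    (at_large_exp n (at_large_and (cevM (cps_X C (e k)) (fs k)) (cev_X R (e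
      k)))).
  by apply: at_large_imp => t [-> [-> ->]].
have := at_large_and (at_large_and (at_large_exp n fsE) (at_large_exp n cd))
  (at_large_and (at_large_and coefs (map_cev_prod rs))
   (at_large_and (at_large_and (cev_const 1) (at_large_exp n (at_large_neq0 R)))
     (coef_map_cev (map_poly (cps_ram n) P)))).
apply: at_large_imp => t [[tfs tcd] [[tco tprod] [[tc1 t0] tcoef]]] y.
rewrite big_map /=; set T := t ^+ n.+1 in tfs tcd tco t0 *; clearbody T.
have TD0 : T ^+ D != 0 by rewrite expf_neq0.
pose w := y / T ^+ D; have yE : y = T ^+ D * w by rewrite mulrC divfK.
have -> : \prod_(r <- rs) (y - T ^+ D * cev r t) =
    T ^+ (D * d) * \prod_(r <- rs) (w - cev r t).
  rewrite (eq_bigr (fun r => T ^+ D * (w - cev r t))) => [|r _];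
    last by rewrite mulrBr -yE.
  by rewrite big_split /= big_const_seq count_predT iter_mulr_1 srs -exprM.
have -> : \prod_(r <- rs) (w - cev r t) = (\prod_(r <- rs) ('X - (cev r
  t)%:P)).[w].
  by rewrite horner_prod; apply: eq_bigr => r _; rewrite hornerXsubC.
have sM : (size (map_cev t (map_poly (cps_ram n) P)) <= d.+1)%N.
  by apply: leq_trans (size_poly _ _) _; rewrite -sP size_poly.
rewrite -tprod -rsE (horner_coef_wide _ sM) !big_ord_recr /= mulrA mulrDr;
  congr (_ + _).
  rewrite mulr_sumr; apply: eq_bigr => k _.
  have -> : c k T = c d T * (T ^+ D * cev (fs k) T) by rewrite -tfs // mulrC
    divfK.
  rewrite tcoef coef_map /= tco // yE.
  have eE : (D * d = e k + (D + D * k))%N.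
    rewrite /e addnA subnK ?leq_pmulr ?subn_gt0 //.
    by rewrite -mulnDr subnK // ltnW.
  rewrite exprMn -exprM eE !exprD.
  have -> : T^-1 ^+ e k = (T ^+ e k)^-1 by rewrite exprVn.
  by field; rewrite expf_neq0.
rewrite tcoef coef_map /= Pd rmorph1 -(rmorph1 (@cps_const C)) tc1 mul1r.
by rewrite yE exprMn -exprM mulrA.
Qed.

End Roots.

(** * Real germs, their signs and their roots *)

Section RealGerms.
Variable R : realType.
Local Notation C := (R[i]).
Local Open Scope complex_scope.

Definition at_pinfty (P : R -> Prop) := exists r, forall x, r < x -> P x.
(** Of finitely many alternatives that together cover arbitrarily large [x], one holds for
    arbitrarily large [x], though perhaps none for all large [x]; hence this weaker notion for
    selection. *)
Definition cofinal (P : R -> Prop) := forall r, exists2 x, r < x & P x.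

Lemma at_pinfty_and (P Q : R -> Prop) :
  at_pinfty P -> at_pinfty Q -> at_pinfty (fun x => P x /\ Q x).
Proof.
move=> [r rP] [q qQ]; exists (Num.max r q) => t; rewrite gt_max => /andP[rt qt].
by split; [apply: rP|apply: qQ].
Qed.

Lemma at_pinfty_imp (P Q : R -> Prop) :
  (forall t, P t -> Q t) -> at_pinfty P -> at_pinfty Q.
Proof. by move=> PQ [r rP]; exists r => t /rP/PQ. Qed.

Lemma at_pinfty_true (P : R -> Prop) : (forall x, P x) -> at_pinfty P.
Proof. by exists 0. Qed.

Lemma at_pinfty_forall n (P : nat -> R -> Prop) :
  (forall k, (k < n)%N -> at_pinfty (P k)) ->
  at_pinfty (fun t => forall k, (k < n)%N -> P k t).
Proof.
elim: n => [|n IH] nP; first exact: at_pinfty_true.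
have := at_pinfty_and (IH (fun k kn => nP k (ltnW kn))) (nP n (ltnSn n)).
apply: at_pinfty_imp => t [Pt Pn] k; rewrite ltnS leq_eqVlt => /orP[/eqP-> //|].
exact: Pt.
Qed.

Lemma at_pinfty_gt (a : R) : at_pinfty (fun x => a < x).
Proof. by exists a. Qed.

Lemma at_pinfty_cofinal (P Q : R -> Prop) :
  at_pinfty P -> cofinal Q -> cofinal (fun x => P x /\ Q x).
Proof.
move=> [r rP] cQ q; have [x] := cQ (Num.max r q).
by rewrite gt_max => /andP[rx qx] Qx; exists x => //; split=> //; apply: rP.
Qed.

Lemma cofinal_imp (P Q : R -> Prop) : (forall x, P x -> Q x) -> cofinal P ->
  cofinal Q.
Proof. by move=> PQ cP r; have [x rx /PQ] := cP r; exists x. Qed.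

Lemma at_pinfty_ex (P : R -> Prop) : at_pinfty P -> exists x, P x.
Proof. by move=> [r rP]; exists (r + 1); apply: rP; rewrite ltrDl. Qed.

Lemma cofinal_ex n (Q : nat -> R -> Prop) :
  cofinal (fun x => exists2 i, (i < n)%N & Q i x) -> exists2 i, (i < n)%N &
    cofinal (Q i).
Proof.
move=> cQ; apply: contrapT => none.
have : at_pinfty (fun x => forall i, (i < n)%N -> ~ Q i x).
  apply: at_pinfty_forall => i i_n; apply: contrapT => ni; apply: none;
    exists i => //.
  move=> r; apply: contrapT => nr; apply: ni; exists r => x rx Qx.
  by apply: nr; exists x.
by move=> /at_pinfty_cofinal/(_ cQ)/(_ 0)[x _ [nQ [i i_n]]]; apply: nQ.
Qed.

Lemma at_pinfty_exp n (P : R -> Prop) : at_pinfty P -> at_pinfty (fun x => P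
  (x ^+ n.+1)).
Proof.
move=> [r rP]; exists (Num.max 1 r) => x; rewrite gt_max => /andP[x1 rx].
by apply: rP; rewrite (lt_le_trans rx) // ler_eXnr // ltW.
Qed.

Lemma cofinal_root n (P : R -> Prop) : cofinal P -> cofinal (fun x => P (x ^+
  n.+1)).
Proof.
move=> cP r; have [X] := cP (Num.max 1 (Num.max 1 r ^+ n.+1)).
rewrite gt_max => /andP[X1 rX PX].
have X0 : 0 <= X by rewrite ltW // (lt_trans ltr01).
pose x := X `^ (n.+1%:R^-1).
have x0 : 0 <= x := powR_ge0 _ _.
have xE : x ^+ n.+1 = X.
  by rewrite -powR_mulrn // -powRrM mulVf ?pnatr_eq0 // powRr1.
exists x; last by rewrite xE.
apply: le_lt_trans (_ : Num.max 1 r < x); first by rewrite le_max lexx orbT.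
by move: rX; rewrite -xE ltr_pXn2r // nnegrE le_max ler01.
Qed.

Lemma at_large_pinfty (P : C -> Prop) : at_large P -> at_pinfty (fun x => P
  x%:C).
Proof.
move=> [r rP]; exists (Num.max 0 r) => x; rewrite gt_max => /andP[x0 rx].
by apply: rP; rewrite cabs_real gtr0_norm.
Qed.

Definition rgerm (g : R -> R) :=
  exists2 G, lgerm G & at_pinfty (fun x => G x%:C = (g x)%:C).

Lemma rgerm_eq g h : rgerm g -> (forall x, h x = g x) -> rgerm h.
Proof. by move=> gg hg; rewrite (_ : h = g) //; apply/funext. Qed.

Lemma rgerm_cst c : rgerm (fun=> c).
Proof. by exists (fun=> c%:C); [apply: lgerm_cst|apply: at_pinfty_true]. Qed.

Lemma rgerm_id : rgerm id.
Proof. by exists id; [apply: lgerm_id|apply: at_pinfty_true]. Qed.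

Lemma rgerm_add g h : rgerm g -> rgerm h -> rgerm (fun x => g x + h x).
Proof.
move=> [G gG GE] [H hH HE]; exists (fun t => G t + H t); first exact: lgerm_add.
by have := at_pinfty_and GE HE; apply: at_pinfty_imp => x [-> ->];
  rewrite rmorphD.
Qed.

Lemma rgerm_mul g h : rgerm g -> rgerm h -> rgerm (fun x => g x * h x).
Proof.
move=> [G gG GE] [H hH HE]; exists (fun t => G t * H t); first exact: lgerm_mul.
by have := at_pinfty_and GE HE; apply: at_pinfty_imp => x [-> ->];
  rewrite rmorphM.
Qed.

Lemma rgerm_opp g : rgerm g -> rgerm (fun x => - g x).
Proof.
move=> gg; apply: rgerm_eq (rgerm_mul (rgerm_cst (-1)) gg) _ => x.
by rewrite mulN1r.
Qed.

Lemma rgerm_exp g n : rgerm g -> rgerm (fun x => g x ^+ n).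
Proof.
move=> gg; elim: n => [|n IH]; first exact: rgerm_cst.
by apply: rgerm_eq (rgerm_mul gg IH) _ => x; rewrite exprS.
Qed.

Lemma rgerm_sum n (F : nat -> R -> R) :
  (forall i, rgerm (F i)) -> rgerm (fun x => \sum_(i < n) F i x).
Proof.
move=> Fg; elim: n => [|n IH].
  by apply: rgerm_eq (rgerm_cst 0) _ => x; rewrite big_ord0.
by apply: rgerm_eq (rgerm_add IH (Fg n)) _ => x; rewrite big_ord_recr.
Qed.

(** The real part is not analytic, but on the real axis it agrees with the half-sum of [G] and of
    its reflection, which is again a Laurent germ. *)
Lemma rgerm_Re G : lgerm G -> rgerm (fun x => Re (G x%:C)).
Proof.
move=> gG; exists (fun t => (G t + (G t^*)^*) / 2).
  by apply: lgerm_mul (lgerm_cst _); apply: lgerm_add => //; apply: lgerm_conj.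
by apply: at_pinfty_true => x; rewrite conjc_real -ReJ_add.
Qed.

Lemma rgerm_ram n g : rgerm g -> rgerm (fun x => g (x ^+ n.+1)).
Proof.
move=> [G gG GE]; exists (fun t => G (t ^+ n.+1)); first exact: lgerm_ram.
have := at_pinfty_exp n GE; apply: at_pinfty_imp => x.
by rewrite rmorphXn.
Qed.

(** Once a power of [x] is removed, the values converge to the leading coefficient [h 0]. It is real
    as a limit of reals and non-zero, so its sign prevails. *)
Lemma rgerm_sign g : rgerm g ->
  exists s, at_pinfty (fun x => Num.sg (g x) = s).
Proof.
move=> [G /lgerm_order[G0|[d [n [h [h0 GE]]]]] Gg].
  exists 0; have := at_pinfty_and Gg (at_large_pinfty G0).
  by apply: at_pinfty_imp => x [-> /complexI ->]; rewrite sgr0.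
have [c hc] := cev_near h.
pose u x := g x * (x^-1) ^+ d * x ^+ n.
have near : at_pinfty (fun x => [/\ 0 < x, cev h x%:C = (u x)%:C &
    cabs ((u x)%:C - h 0%N) <= c * x^-1]).
  have := at_pinfty_and (at_pinfty_and Gg (at_pinfty_gt 0))
     (at_pinfty_and (at_large_pinfty GE) (at_large_pinfty hc)).
  apply: at_pinfty_imp => x [[gE x0] [hE]].
  have x0' : x%:C != 0 by rewrite (inj_eq (@complexI R) x 0) gt_eqF.
  have uE : cev h x%:C = (u x)%:C.
    rewrite /u !rmorphM /= -gE hE !rmorphXn fmorphV /= !exprVn.
    by field; rewrite !expf_neq0.
  by rewrite uE cabsV cabs_real gtr0_norm.
have Im0 : Im (h 0%N) = 0.
  apply/eqP; rewrite -normr_eq0 eq_le normr_ge0 andbT.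
  apply/ler_addgt0Pr => e e0; rewrite add0r.
  have c1 : 0 < 1 + `|c| by rewrite ltr_pwDl.
  have [x [[x0 _ cx] ex]] := at_pinfty_ex (at_pinfty_and near (at_pinfty_gt
    ((1 + `|c|) / e))).
  rewrite -normrN -[- _]add0r -[0 in leLHS]/(Im (u x)%:C) -raddfB.
  apply: le_trans (Im_le_cabs _) _; apply: le_trans cx _.
  rewrite ltr_pdivrMr // in ex; rewrite ler_pdivrMr // mulrC.
  apply: le_trans (ltW ex); apply: le_trans (ler_norm _) _.
  by rewrite lerDr.
have Re0 : Re (h 0%N) != 0.
  by apply: contraNneq h0 => Re0; rewrite [h 0%N]complexE Re0 Im0 mulr0 addr0.
exists (Num.sg (Re (h 0%N))).
have [r0 c1] : 0 < `|Re (h 0%N)| /\ 0 < 1 + `|c| by rewrite normr_gt0 ltr_pwDl.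
have := at_pinfty_and near (at_pinfty_gt ((1 + `|c|) / `|Re (h 0%N)|)).
apply: at_pinfty_imp => x [[x0 _ cx] ex].
have -> : Num.sg (g x) = Num.sg (u x).
  by rewrite /u !sgrM !sgrX sgrV (gtr0_sg x0) ?invr1 !expr1n !mulr1.
have lt_u : `|u x - Re (h 0%N)| < `|Re (h 0%N)|.
  apply: le_lt_trans (_ : c * x^-1 < _).
    by apply: le_trans cx; apply: le_trans (Re_le_cabs _); rewrite raddfB.
  rewrite ltr_pdivrMr // in ex; rewrite ltr_pdivrMr // mulrC.
  apply: le_lt_trans ex; apply: le_trans (ler_norm _) _.
  by rewrite lerDr.
move: lt_u; have [r1|r1|r1] := ltrgt0P (Re (h 0%N)).
- by rewrite ltr_distl => /andP[]; rewrite subrr => u0 _; rewrite !gtr0_sg.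
- by rewrite ltr_distl => /andP[_]; rewrite subrr => u0; rewrite !ltr0_sg.
- by rewrite r1 eqxx in Re0.
Qed.

(** The degree may vary with [x], so only a uniform bound is asked; [gpoly_size] shows that it
    stabilises unless the polynomial eventually vanishes. *)
Definition gpoly (p : R -> {poly R}) :=
  (exists d, forall x, (size (p x) <= d)%N) /\ forall k, rgerm (fun x => (p
    x)`_k).

Lemma gpoly_const g : rgerm g -> gpoly (fun x => (g x)%:P).
Proof.
move=> gg; split; first by exists 1%N => x; apply: size_polyC_leq1.
move=> [|k]; first by apply: rgerm_eq gg _ => x; rewrite coefC.
by apply: rgerm_eq (rgerm_cst 0) _ => x; rewrite coefC.
Qed.

Lemma gpoly_X : gpoly (fun=> 'X).
Proof.
split; first by exists 2 => x; rewrite size_polyX.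
by move=> k; apply: rgerm_cst.
Qed.

Lemma gpoly_add p q : gpoly p -> gpoly q -> gpoly (fun x => p x + q x).
Proof.
move=> [[d pd] pk] [[e qe] qk]; split.
  exists (maxn d e) => x; apply: leq_trans (size_polyD _ _) _.
  by rewrite geq_max !leq_max pd qe orbT.
by move=> k; apply: rgerm_eq (rgerm_add (pk k) (qk k)) _ => x; rewrite coefD.
Qed.

Lemma gpoly_mul p q : gpoly p -> gpoly q -> gpoly (fun x => p x * q x).
Proof.
move=> [[d pd] pk] [[e qe] qk]; split.
  exists (d + e)%N => x; apply: leq_trans (size_polyMleq _ _) _.
  by apply: leq_trans (leq_pred _) (leq_add _ _).
move=> k; pose F j x := (p x)`_j * (q x)`_(k - j).
apply: rgerm_eq (@rgerm_sum k.+1 F _) _ => [j|x]; last by rewrite coefM.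
exact: rgerm_mul.
Qed.

Lemma gpoly_opp p : gpoly p -> gpoly (fun x => - p x).
Proof.
move=> [[d pd] pk]; split; first by exists d => x; rewrite size_polyN.
by move=> k; apply: rgerm_eq (rgerm_opp (pk k)) _ => x; rewrite coefN.
Qed.

Lemma gpoly_exp p n : gpoly p -> gpoly (fun x => p x ^+ n).
Proof.
move=> gp; elim: n => [|n IH].
  have -> : (fun x => p x ^+ 0) = (fun=> 1%:P) by apply/funext => x;
    rewrite expr0.
  exact: gpoly_const (rgerm_cst 1).
have -> : (fun x => p x ^+ n.+1) = (fun x => p x * p x ^+ n).
  by apply/funext => x; rewrite exprS.
exact: gpoly_mul.
Qed.

Lemma gpoly_natmul p n : gpoly p -> gpoly (fun x => p x *+ n).
Proof.
move=> gp; have -> : (fun x => p x *+ n) = (fun x => (n%:R)%:P * p x).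
  by apply/funext => x; rewrite mul_polyC scaler_nat.
exact: gpoly_mul (gpoly_const (rgerm_cst _)) gp.
Qed.

Lemma gpoly_size p : gpoly p -> at_pinfty (fun x => p x = 0) \/
  exists d, at_pinfty (fun x => size (p x) = d.+1).
Proof.
move=> [[d dp] pk].
have: at_pinfty (fun x => (size (p x) <= d)%N) by exact: at_pinfty_true.
elim: d {dp} => [|d IH] pd.
  left; apply: at_pinfty_imp pd => x.
  by rewrite leqn0 size_poly_eq0 => /eqP.
have [s sE] := rgerm_sign (pk d); have := at_pinfty_and pd sE.
have [->|s0] := eqVneq s 0 => both.
  apply: IH; apply: at_pinfty_imp both => x [px /eqP].
  rewrite sgr_eq0 => /eqP pd0; apply/leq_sizeP => j; rewrite leq_eqVlt.
  by case/orP=> [/eqP<- //|dj]; rewrite nth_default // (leq_trans px).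
right; exists d; apply: at_pinfty_imp both => x [px sx].
apply/eqP; rewrite eqn_leq px ltnNge; apply/negP => /leq_sizeP/(_ d (leqnn d))
  pd0.
by move: s0; rewrite -sx pd0 sgr0 eqxx.
Qed.

Lemma gpoly_roots p d : gpoly p -> at_pinfty (fun x => size (p x) = d.+1) ->
  exists n (es : seq (R -> R)), (forall i, rgerm (nth (fun=> 0) es i)) /\
    at_pinfty (fun x => forall y, root (p (x ^+ n.+1)) y -> y \in [seq e x | e
      <- es]).
Proof.
move=> [_ pk] pd.
have [c cP] := @choice nat (C -> C) (fun k G => lgerm G /\
  at_pinfty (fun x => G x%:C = ((p x)`_k)%:C))
  (fun k => let: ex_intro2 G a b := pk k in ex_intro _ G (conj a b)).
have cd : at_large (fun t => c d t != 0).
  have [cd0|//] := lgerm_eq0_or_neq0 (cP d).1; exfalso.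
  have [x [[sx cx] c0]] := at_pinfty_ex (at_pinfty_and (at_pinfty_and pd (cP
    d).2) (at_large_pinfty cd0)).
  move: cx; rewrite c0 => /esym/complexI pd0.
  have : lead_coef (p x) == 0 by rewrite lead_coefE sx pd0.
  by rewrite lead_coef_eq0 -size_poly_eq0 sx.
have [n [etas [eg etaE]]] := lgerm_roots (fun k _ => (cP k).1) cd.
exists n, [seq (fun x : R => Re (eta x%:C)) | eta <- etas]; split.
  move=> i; case: (ltnP i (size etas)) => [ie|ei].
    by rewrite (nth_map (fun=> 0)) //; apply: rgerm_Re.
  by rewrite nth_default ?size_map //; apply: rgerm_cst.
have coefs : at_pinfty (fun x => forall k, (k < d.+1)%N -> c k x%:C = ((p
  x)`_k)%:C).
  by apply: at_pinfty_forall => k _; have [] := cP k.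
have := at_pinfty_and (at_pinfty_and (at_pinfty_exp n pd) (at_pinfty_exp n
  coefs))
  (at_pinfty_and (at_large_pinfty etaE) (at_large_pinfty (at_large_exp n cd))).
apply: at_pinfty_imp => x [[sx cx] [ex cdx]] y /rootP.
have sx' : (size (p (x ^+ n.+1)) <= d.+1)%N by rewrite sx.
rewrite (horner_coef_wide _ sx') => /(congr1 (real_complex R)).
rewrite rmorph_sum (eq_bigr (fun k : 'I_d.+1 => c k (x%:C ^+ n.+1) * y%:C ^+
  k)); last first.
  by move=> k _; rewrite -rmorphXn cx // rmorphM rmorphXn.
move=> /eqP; rewrite ex mulf_eq0 (negPf cdx) /= prodf_seq_eq0 => /hasP[eta ine
  /=].
rewrite subr_eq0 => /eqP yE; rewrite -map_comp; apply/mapP; exists eta => //.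
by rewrite /= -yE.
Qed.
End RealGerms.

(** * Curve selection *)

Section Candidates.
Variable R : rcfType.
Implicit Types (zs : seq R) (x y z c : R).

Lemma seq_max zs : zs != [::] -> exists2 m, m \in zs & forall z, z \in zs -> z
  <= m.
Proof.
elim: zs => // a zs IH _; have [->|/IH[m mzs mP]] := eqVneq zs [::].
  by exists a; rewrite ?mem_head // => z; rewrite inE => /eqP ->.
case: (leP a m) => am; [exists m|exists a]; rewrite ?inE ?eqxx ?mzs ?orbT //.
  by move=> z; rewrite inE => /orP[/eqP -> //|/mP].
by move=> z; rewrite inE => /orP[/eqP -> //|/mP /le_trans]; apply; apply: ltW.
Qed.

Lemma seq_min zs : zs != [::] -> exists2 m, m \in zs & forall z, z \in zs -> m
  <= z.
Proof.
move=> zs0; have [|m] := @seq_max [seq - z | z <- zs]; first by case: (zs) zs0.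
move=> /mapP[a azs ->] aP; exists a => // z zzs.
by rewrite -lerN2; apply: aP; apply: map_f.
Qed.

Definition same_cell zs y c :=
  forall z, z \in zs -> (z < y) = (z < c) /\ (y < z) = (c < z).

(** A point of [zs] is the midpoint of itself with itself, a bounded gap contains the midpoint of
    its ends, and the unbounded gaps contain a translate of an extreme point. All these samples
    depend on [zs] in a way that preserves germs. *)
Lemma cell_point zs y : zs != [::] ->
  (exists z z', [/\ z \in zs, z' \in zs & same_cell zs y ((z + z') / 2)]) \/
  exists z, z \in zs /\ (same_cell zs y (z + 1) \/ same_cell zs y (z - 1)).
Proof.
move=> zs0; have [yzs|yzs] := boolP (y \in zs).
  by left; exists y, y; split=> // z _; have -> : (y + y) / 2 = y by field.
have zy z : z \in zs -> z != y by move=> zzs; apply: contraNneq yzs => <-.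
have [lo0|/seq_max[a]] := eqVneq [seq z <- zs | z < y] [::].
  have [b bzs bP] := seq_min zs0.
  right; exists b; split=> //; right => z zzs.
  have yz : y < z.
    rewrite lt_neqAle eq_sym zy //= leNgt; apply/negP => lzy.
    by have := mem_filter (fun z => z < y) z zs; rewrite lo0 lzy zzs.
  have := bP z zzs; split; last by rewrite yz; apply/esym; lra.
  by rewrite ltNge (ltW yz); apply/esym/negbTE; rewrite -leNgt; lra.
rewrite mem_filter => /andP[ay azs] aP.
have loP z : z \in zs -> z < y -> z <= a by move=> zzs lzy; apply: aP;
  rewrite mem_filter lzy.
have [hi0|/seq_min[b]] := eqVneq [seq z <- zs | y < z] [::].
  right; exists a; split=> //; left => z zzs.
  have lzy : z < y.
    rewrite lt_neqAle zy //= leNgt; apply/negP => yz.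
    by have := mem_filter (fun z => y < z) z zs; rewrite hi0 yz zzs.
  have := loP z zzs lzy; split; first by rewrite lzy; apply/esym; lra.
  by rewrite ltNge (ltW lzy); apply/esym/negbTE; rewrite -leNgt; lra.
rewrite mem_filter => /andP[yb bzs] bP.
left; exists a, b; split=> // z zzs.
have [lzy|yz|zE] := ltgtP z y; last by have := zy z zzs; rewrite zE eqxx.
  by have := loP z zzs lzy; split; apply/esym; [lra|apply/negbTE;
    rewrite -leNgt; lra].
have : b <= z by apply: bP; rewrite mem_filter yz.
by split; apply/esym; [apply/negbTE; rewrite -leNgt; lra|lra].
Qed.

Lemma no_root_sign (p : {poly R}) a b : a <= b ->
  (forall z, a <= z <= b -> ~~ root p z) -> Num.sg p.[a] = Num.sg p.[b].
Proof.
move=> ab nr.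
have ivt (q : {poly R}) : (forall z, root q z = root p z) -> ~ (q.[a] <= 0 <=
  q.[b]).
  by move=> qp /(poly_ivt ab)[x xab]; rewrite qp; apply/negP/nr.
have [pa|pa|pa] := ltrgt0P p.[a]; have [pb|pb|pb] := ltrgt0P p.[b].
all: try by rewrite ?(gtr0_sg pa) ?(gtr0_sg pb) ?(ltr0_sg pa) ?(ltr0_sg pb)
  ?pa ?pb.
all: exfalso.
all: try by have := nr a; rewrite lexx ab rootE pa eqxx => /(_ isT).
all: try by have := nr b; rewrite lexx ab rootE pb eqxx => /(_ isT).
  apply: (ivt (- p)) => [z|]; first by rewrite rootN.
  by rewrite !hornerN oppr_le0 oppr_ge0 !ltW.
by apply: (ivt p) => //; rewrite (ltW pa) (ltW pb).
Qed.

Lemma same_cell_sign (p : {poly R}) zs y c :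
  p = 0 \/ (forall z, root p z -> z \in zs) -> same_cell zs y c ->
  Num.sg p.[y] = Num.sg p.[c].
Proof.
case=> [->|pzs] cell; first by rewrite !horner0.
have [rt|nr] := boolP (root p y).
  have [yc cy] := cell y (pzs y rt).
  suff -> : c = y by [].
  by apply/eqP; rewrite eq_le !leNgt -yc -cy ltxx.
have nocross z : root p z -> ~ (Num.min y c <= z <= Num.max y c).
  move=> rz; have [zy yz] := cell z (pzs z rz); rewrite ge_min le_max => /andP.
  have zneq : z != y by apply: contraNneq nr => <-.
  by move: zy yz; case: (ltgtP z y) zneq => // _ _; case: ltgtP => // _ _ _ [].
case: (leP y c) => [yc|/ltW cy].
  by apply: no_root_sign => // z zyc; apply/negP => /nocross;
    rewrite min_l ?max_r.
apply/esym/no_root_sign => // z zyc; apply/negP => /nocross.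
by rewrite min_r ?max_l.
Qed.
End Candidates.

(** * Sign patterns and selection of germs *)

Section CurveSelection.
Variable R : realType.

Lemma gpoly_prod (ps : seq (R -> {poly R})) : (forall p, p \in ps -> gpoly p) ->
  gpoly (fun x => \prod_(p <- ps) p x).
Proof.
elim: ps => [|p ps IH] gps.
  have -> : (fun x : R => \prod_(p <- [::]) (p : R -> {poly R}) x) = (fun=>
    1%:P).
    by apply/funext => x; rewrite big_nil.
  exact: gpoly_const (rgerm_cst 1).
have -> : (fun x => \prod_(q <- p :: ps) q x) = (fun x => p x * \prod_(q <-
  ps) q x).
  by apply/funext => x; rewrite big_cons.
apply: gpoly_mul; first by apply: gps; rewrite mem_head.
by apply: IH => q qps; apply: gps; rewrite inE qps orbT.
Qed.

Lemma at_pinfty_seq (T : eqType) (s : seq T) (P : T -> R -> Prop) :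
  (forall a, a \in s -> at_pinfty (P a)) ->
  at_pinfty (fun x => forall a, a \in s -> P a x).
Proof.
elim: s => [|a s IH] sP; first exact: at_pinfty_true.
have sP' b : b \in s -> at_pinfty (P b) by move=> bs; apply: sP;
  rewrite inE bs orbT.
have := at_pinfty_and (sP a (mem_head _ _)) (IH sP').
apply: at_pinfty_imp => x [Pa Ps] b.
by rewrite inE => /orP[/eqP->|/Ps].
Qed.

Lemma cofinal_seq (T : eqType) (s : seq T) (Q : T -> R -> Prop) :
  cofinal (fun x => exists2 a, a \in s & Q a x) -> exists2 a, a \in s &
    cofinal (Q a).
Proof.
case: s => [/(_ 0)[x _ []]//|a0 s] cQ.
have [|i i_s ci] := @cofinal_ex _ (size (a0 :: s)) (fun i => Q (nth a0 (a0 ::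
  s) i)).
  apply: cofinal_imp cQ => x [a as_ Qa]; exists (index a (a0 :: s)).
    by rewrite index_mem.
  by rewrite nth_index.
by exists (nth a0 (a0 :: s) i) => //; apply: mem_nth.
Qed.

Lemma gpoly_horner p (g : R -> R) : gpoly p -> rgerm g -> rgerm (fun x => (p
  x).[g x]).
Proof.
move=> [[d pd] pk] gg.
apply: rgerm_eq (@rgerm_sum _ d (fun k x => (p x)`_k * g x ^+ k) _) _ => [k|x].
  by apply: rgerm_mul => //; apply: rgerm_exp.
by rewrite (horner_coef_wide _ (pd x)).
Qed.

(** Signs are constant on the cells cut out by the roots of all the polynomials, so one sample per
    cell is enough. The index [n] is the ramification that turns the roots into germs. *)
Lemma sign_samples (ps : seq (R -> {poly R})) : (forall p, p \in ps -> gpoly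
  p) ->
  exists n (es : seq (R -> R)), (forall e, e \in es -> rgerm e) /\
    at_pinfty (fun x => forall y, exists2 e, e \in es & forall p, p \in ps ->
      Num.sg (p (x ^+ n.+1)).[y] = Num.sg (p (x ^+ n.+1)).[e x]).
Proof.
move=> gps; pose Z (p : R -> {poly R}) := `[< at_pinfty (fun x => p x = 0) >].
(* Polynomials that eventually vanish have sign 0 everywhere, and would make the product vanish;
   they are set aside. *)
pose qs := [seq p <- ps | ~~ Z p]; pose q x := \prod_(p <- qs) p x.
have gqs p : p \in qs -> gpoly p by rewrite mem_filter => /andP[_ /gps].
have gq : gpoly q by apply: gpoly_prod.
have qs0 : at_pinfty (fun x => forall p, p \in qs -> p x != 0).
  apply: at_pinfty_seq => p; rewrite mem_filter => /andP[/asboolP nZ /gps gp].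
  have [//|[d pd]] := gpoly_size gp; apply: at_pinfty_imp pd => x.
  by rewrite -size_poly_eq0 => ->.
have q0 : at_pinfty (fun x => q x != 0).
  apply: at_pinfty_imp qs0 => x xqs; rewrite /q prodf_seq_neq0.
  by apply/allP => p /xqs.
have [d qd] : exists d, at_pinfty (fun x => size (q x) = d.+1).
  have [qz|//] := gpoly_size gq.
  by have [x [/eqP]] := at_pinfty_ex (at_pinfty_and q0 qz).
have [n [es [ges esP]]] := gpoly_roots gq qd.
(* The zero germ is added because [cell_point] wants a non-empty list; an additional cutting point
   does no harm. *)
pose E := (fun=> 0) :: es.
have gE e : e \in E -> rgerm e.
  rewrite inE => /orP[/eqP->|/(nthP (fun=> 0))[i _ <-] //].
  exact: rgerm_cst.
exists n, ([seq (fun x => (e.1 x + e.2 x) / 2) | e <- [seq (e, e') | e <- E,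
  e' <- E]] ++
  [seq (fun x => e x + 1) | e <- E] ++ [seq (fun x => e x - 1) | e <- E]);
    split.
  move=> e; rewrite !mem_cat => /or3P[/mapP[[e1 e2] /allpairsP[[a b] /= [aE bE
    [-> ->]]] ->]|/mapP[a aE ->]|/mapP[a aE ->]].
  - by apply: rgerm_mul (rgerm_cst _); apply: rgerm_add; apply: gE.
  - exact: rgerm_add (gE _ aE) (rgerm_cst _).
  - exact: rgerm_add (gE _ aE) (rgerm_cst _).
have Zps : at_pinfty (fun x => forall p, p \in [seq p <- ps | Z p] -> p x = 0).
  by apply: at_pinfty_seq => p; rewrite mem_filter => /andP[/asboolP].
have := at_pinfty_and esP (at_pinfty_exp n Zps).
apply: at_pinfty_imp => x [xes xZ] y; pose zs := [seq e x | e <- E].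
have cellP e : same_cell zs y (e x) -> forall p, p \in ps ->
    Num.sg (p (x ^+ n.+1)).[y] = Num.sg (p (x ^+ n.+1)).[e x].
  move=> ce p pps; apply: (same_cell_sign (zs := zs)) ce.
  case: (boolP (Z p)) => Zp; [left|right].
    by apply: xZ; rewrite mem_filter Zp.
  move=> z rz; rewrite /zs /= inE; apply/orP; right; apply: xes.
  rewrite rootE /q horner_prod prodf_seq_eq0; apply/hasP; exists p => //.
  by rewrite mem_filter Zp.
have [|[z [z' [zz zz' cz]]]|[z [zz [cz|cz]]]] := @cell_point _ zs y;
  first by [].
- have [[a aE az] [b bE bz]] := (mapP zz, mapP zz').
  exists (fun x => (a x + b x) / 2).
    rewrite !mem_cat; apply/or3P/Or31; apply/mapP; exists (a, b) => //.
    by apply/allpairsP; exists (a, b).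
  by apply: (cellP (fun x => (a x + b x) / 2)); rewrite /= -az -bz.
- have [a aE az] := mapP zz; exists (fun x => a x + 1).
    by rewrite !mem_cat; apply/or3P/Or32; apply/mapP; exists a.
  by apply: (cellP (fun x => a x + 1)); rewrite /= -az.
- have [a aE az] := mapP zz; exists (fun x => a x - 1).
    by rewrite !mem_cat; apply/or3P/Or33; apply/mapP; exists a.
  by apply: (cellP (fun x => a x - 1)); rewrite /= -az.
Qed.

Definition genv (e : R -> seq R) := forall i, rgerm (fun x => nth 0 (e x) i).

Lemma genv_set e i g : genv e -> rgerm g -> genv (fun x => set_nth 0 (e x) i
  (g x)).
Proof.
move=> ge gg j; case: (eqVneq j i) => [->|ji].
  by apply: rgerm_eq gg _ => x; rewrite nth_set_nth /= eqxx.
by apply: rgerm_eq (ge j) _ => x; rewrite nth_set_nth /= (negPf ji).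
Qed.

Lemma genv_ram e n : genv e -> genv (fun x => e (x ^+ n.+1)).
Proof. by move=> ge i; apply: (rgerm_ram n (ge i)). Qed.

Lemma term_gpoly (t : GRing.term R) i e : GRing.rterm t -> genv e ->
  exists p, gpoly p /\ forall x y, GRing.eval (set_nth 0 (e x) i y) t = (p
    x).[y].
Proof.
move=> rt ge; elim: t rt => //=.
- move=> n _; case: (eqVneq n i) => [->|ni].
    exists (fun=> 'X); split; first exact: gpoly_X.
    by move=> x y; rewrite nth_set_nth /= eqxx hornerX.
  exists (fun x => (nth 0 (e x) n)%:P); split; first exact: gpoly_const (ge n).
  by move=> x y; rewrite nth_set_nth /= (negPf ni) hornerC.
- move=> r _; exists (fun=> r%:P); split; first exact: gpoly_const (rgerm_cst
  r).
  by move=> x y; rewrite hornerC.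
- move=> n _; exists (fun=> (n%:R)%:P); split; first exact: gpoly_const
  (rgerm_cst _).
  by move=> x y; rewrite hornerC.
- move=> t1 IH1 t2 IH2 /andP[/IH1[p [gp pE]] /IH2[q [gq qE]]].
  exists (fun x => p x + q x); split; first exact: gpoly_add.
  by move=> x y; rewrite hornerD pE qE.
- move=> t1 IH1 /IH1[p [gp pE]]; exists (fun x => - p x); split;
  first exact: gpoly_opp.
  by move=> x y; rewrite hornerN pE.
- move=> t1 IH1 n /IH1[p [gp pE]]; exists (fun x => p x *+ n); split;
  first exact: gpoly_natmul.
  by move=> x y; rewrite hornerMn pE.
- move=> t1 IH1 t2 IH2 /andP[/IH1[p [gp pE]] /IH2[q [gq qE]]].
  exists (fun x => p x * q x); split; first exact: gpoly_mul.
  by move=> x y; rewrite hornerM pE qE.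
- move=> t1 IH1 n /IH1[p [gp pE]]; exists (fun x => p x ^+ n); split;
  first exact: gpoly_exp.
  by move=> x y; rewrite horner_exp pE.
Qed.

Definition sign_determined (b : R -> R -> bool) :=
  exists (ps : seq (R -> {poly R})) (B : seq R -> bool),
    (forall p, p \in ps -> gpoly p) /\
    forall x y, b x y = B [seq Num.sg (p x).[y] | p <- ps].

Lemma qf_signs (f : ord.formula R) i e : ord.qf_form f -> ord.rformula f ->
  genv e ->
  sign_determined (fun x y => ord.qf_eval (set_nth 0 (e x) i y) f).
Proof.
move=> qf rf ge.
have atom t1 t2 (B : R -> bool) : GRing.rterm t1 && GRing.rterm t2 ->
    sign_determined (fun x y => B (Num.sg
      (GRing.eval (set_nth 0 (e x) i y) t1 - GRing.eval (set_nth 0 (e x) i y)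
        t2))).
  move=> /andP[/(term_gpoly i)/(_ ge)[p [gp pE]] /(term_gpoly i)/(_ ge)[q [gq
    qE]]].
  exists [:: (fun x => p x - q x)], (fun s => B (head 0 s)); split.
    by move=> r; rewrite inE => /eqP ->; apply: gpoly_add gp (gpoly_opp gq).
  by move=> x y; rewrite /= hornerD hornerN pE qE.
have pair (b : bool -> bool -> bool) (b1 b2 : R -> R -> bool) :
    sign_determined b1 -> sign_determined b2 ->
    sign_determined (fun x y => b (b1 x y) (b2 x y)).
  move=> [ps [B1 [gps psP]]] [qs [B2 [gqs qsP]]].
  exists (ps ++ qs), (fun s => b (B1 (take (size ps) s)) (B2 (drop (size ps)
    s))).
  split; first by move=> p; rewrite mem_cat => /orP[/gps|/gqs].
  move=> x y; rewrite map_cat take_size_cat ?size_map // drop_size_cat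
    ?size_map //.
  by rewrite psP qsP.
elim: f qf rf => //=.
- by move=> b _ _; exists [::], (fun=> b).
- move=> t1 t2 _ /(atom _ _ (fun s => s == 0))[ps [B [gps psP]]];
  exists ps, B; split=> // x y.
  by rewrite -psP sgr_eq0 subr_eq0.
- move=> t1 t2 _ /(atom _ _ (fun s => s < 0))[ps [B [gps psP]]]; exists ps, B;
  split=> // x y.
  by rewrite -psP sgr_lt0 subr_lt0.
- move=> t1 t2 _ /(atom _ _ (fun s => s <= 0))[ps [B [gps psP]]];
  exists ps, B; split=> // x y.
  by rewrite -psP sgr_le0 subr_le0.
- by move=> f1 IH1 f2 IH2 /andP[q1 q2] /andP[r1 r2];
  apply: (pair andb _ _ (IH1 q1 r1) (IH2 q2 r2)).
- by move=> f1 IH1 f2 IH2 /andP[q1 q2] /andP[r1 r2];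
  apply: (pair orb _ _ (IH1 q1 r1) (IH2 q2 r2)).
- by move=> f1 IH1 f2 IH2 /andP[q1 q2] /andP[r1 r2];
  apply: (pair implb _ _ (IH1 q1 r1) (IH2 q2 r2)).
- move=> f1 IH1 q1 r1; have := IH1 q1 r1.
  by move=> /(pair (fun a _ => ~~ a) _ _)/(_ (IH1 q1 r1)).
Qed.

(** For large [x], any witness can be replaced by a sample germ with the same signs; one of the
    finitely many germs then serves for arbitrarily large [x]. *)
Lemma qf_select1 (f : ord.formula R) i e : ord.qf_form f -> ord.rformula f ->
  genv e ->
  cofinal (fun x => exists y, ord.qf_eval (set_nth 0 (e x) i y) f) ->
  exists n g, rgerm g /\
    cofinal (fun x => ord.qf_eval (set_nth 0 (e (x ^+ n.+1)) i (g x)) f).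
Proof.
move=> qf rf ge cf; have [ps [B [gps psP]]] := qf_signs i qf rf ge.
have [n [es [ges esP]]] := sign_samples gps.
have [|g ges' cg] := @cofinal_seq _ es (fun g x =>
    ord.qf_eval (set_nth 0 (e (x ^+ n.+1)) i (g x)) f).
  have := at_pinfty_cofinal esP (cofinal_root n cf); apply: cofinal_imp => x.
  move=> [xes [y fy]]; have [g ges' gs] := xes y; exists g => //.
  move: fy; rewrite !psP.
  by rewrite (_ : [seq _ | p <- ps] = [seq Num.sg (p (x ^+ n.+1)).[g x] | p <-
    ps]) //; apply/eq_in_map.
by exists n, g; split=> //; apply: ges.
Qed.

Lemma quantifier_elimination (f : ord.formula R) : ord.rformula f -> exists qf
  : ord.formula R,
  [/\ ord.qf_form qf, ord.rformula qf & forall e, ord.holds e f <->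
    ord.qf_eval e qf].
Proof.
move=> rf; exists (ord.quantifier_elim (@wproj R) f).
have /andP[a b] := ord.quantifier_elim_wf (@wf_QE_wproj R) rf; split=> // e.
by split=> /(ord.quantifier_elim_rformP (@wf_QE_wproj R) (@valid_QE_wproj R) e
  rf).
Qed.

(** After quantifier elimination the truth value is a function of the signs of finitely many germs,
    and these signs are eventually constant. *)
Lemma holds_at_pinfty (f : ord.formula R) e : ord.rformula f -> genv e ->
  cofinal (fun x => ord.holds (e x) f) -> at_pinfty (fun x => ord.holds (e x)
    f).
Proof.
move=> rf ge; have [qf [qq rq qP]] := quantifier_elimination rf => cf.
have [ps [B [gps psP]]] := qf_signs 0 qq rq ge.
have qE x : ord.holds (e x) f <->
    B [seq Num.sg (p x).[nth 0 (e x) 0] | p <- ps].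
  (* Overwriting entry 0 of the environment by its own value brings the formula into the form
     treated by [qf_signs]. *)
  rewrite -psP; have same : GRing.same_env (e x) (set_nth 0 (e x) 0 (nth 0 (e
    x) 0)).
    by move=> i; rewrite nth_set_nth /=; case: eqP => [->|].
  split=> h; [apply/qP; apply: ord.eq_holds same h|].
  by apply: ord.eq_holds (GRing.same_env_sym same) _; apply/qP.
have [S SE] : exists S, at_pinfty (fun x => [seq Num.sg (p x).[nth 0 (e x) 0]
  | p <- ps] = S).
  elim: (ps) gps => [|p qs IH] gps'; first by exists [::];
    apply: at_pinfty_true.
  have [|S SE] := IH; first by move=> q qq'; apply: gps'; rewrite inE qq' orbT.
  have [s sE] := rgerm_sign (gpoly_horner (gps' p (mem_head _ _)) (ge 0%N)).
  exists (s :: S); have := at_pinfty_and sE SE.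
  by apply: at_pinfty_imp => x [<- <-].
have [x _ [xS /qE]] := at_pinfty_cofinal SE cf 0.
rewrite xS => BS; apply: at_pinfty_imp SE => y yS.
by apply/qE; rewrite yS.
Qed.

(** Induction on the bound variables: the inner quantifiers are eliminated to select the outermost
    variable, then restored to go on. Each selection reparametrises the earlier entries, and the
    ramification indices multiply. *)
Theorem curve_selection (I : seq nat) (f : ord.formula R) e : ord.rformula f
  -> genv e ->
  cofinal (fun x => ord.holds (e x) (foldr (@ord.Exists R) f I)) ->
  exists n e', [/\ genv e', cofinal (fun x => ord.holds (e' x) f) &
    forall x i, i \notin I -> nth 0 (e' x) i = nth 0 (e (x ^+ n.+1)) i].
Proof.
move=> rf; elim: I e => [|i I IH] e ge cf /=.
  by exists 0%N, e; split.
have rfI : ord.rformula (foldr (@ord.Exists R) f I) by elim: (I).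
have [q [qq rq qP]] := quantifier_elimination rfI.
have [|n [g [gg cg]]] := @qf_select1 q i e qq rq ge.
  by apply: cofinal_imp cf => x /= [y]; exists y; apply/qP.
have ge' := genv_set i (genv_ram n ge) gg.
have [|m [e' [ge'' ce' e'E]]] := IH _ ge'.
  by apply: cofinal_imp cg => x /qP.
exists (m.+1 * n.+1).-1, e'; split=> // x j; rewrite inE negb_or => /andP[ji
  jI].
rewrite e'E // nth_set_nth [LHS]/= (negPf ji) prednK ?muln_gt0 //.
by rewrite exprM.
Qed.

End CurveSelection.

(** * Definable functions and conditions *)

Section Definable.
Variable R : realType.
Local Notation C := (R[i]).
Local Open Scope complex_scope.
Implicit Types (nu : nat -> R).

(** The class [Q] is arbitrary because the closure property serves both definable functions and
    Laurent germs. *)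
Lemma meval_closed (X : Type) (Q : (X -> C) -> Prop) n (v : 'I_n -> X -> C) p :
  (forall c, Q (fun=> c)) ->
  (forall f g, Q f -> Q g -> Q (fun x => f x + g x)) ->
  (forall f g, Q f -> Q g -> Q (fun x => f x * g x)) ->
  (forall i, Q (v i)) -> Q (fun x => meval (v^~ x) p).
Proof.
move=> Qc Qa Qm Qv.
have Qx f k : Q f -> Q (fun x => f x ^+ k).
  move=> Qf; elim: k => [|k IH].
    by rewrite (_ : (fun x => f x ^+ 0) = (fun=> 1)) //; apply/funext => x;
      rewrite expr0.
  rewrite (_ : (fun x => f x ^+ k.+1) = (fun x => f x * f x ^+ k));
    first exact: Qm.
  by apply/funext => x; rewrite exprS.
have Qp (r : seq 'I_n) F : (forall i, Q (F i)) -> Q (fun x => \prod_(i <- r) F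
  i x).
  move=> QF; elim: r => [|i r IH].
    by rewrite (_ : (fun _ => _) = (fun=> 1)) //; apply/funext => x;
      rewrite big_nil.
  rewrite (_ : (fun _ => _) = (fun x => F i x * \prod_(i <- r) F i x));
    first exact: Qm.
  by apply/funext => x; rewrite big_cons.
rewrite (_ : (fun _ => _) = (fun x => \sum_(m <- msupp p) mcoeff m p * \prod_i
  v i x ^+ m i)); last first.
  by apply/funext => x; rewrite mevalE.
elim: (msupp p) => [|m s IH].
  by rewrite (_ : (fun _ => _) = (fun=> 0)) //; apply/funext => x;
    rewrite big_nil.
rewrite (_ : (fun _ => _) = (fun x => mcoeff m p * \prod_i v i x ^+ m i +
    \sum_(m <- s) mcoeff m p * \prod_i v i x ^+ m i)); last first.
  by apply/funext => x; rewrite big_cons.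
by apply: Qa => //; apply: Qm => //; apply: (Qp _ (fun i x => v i x ^+ m i))
  => i; apply: Qx.
Qed.

Definition defterm (g : (nat -> R) -> R) := exists2 t : GRing.term R,
  GRing.rterm t &
  forall e, GRing.eval e t = g (nth 0 e).

Lemma defterm_var i : defterm (fun nu => nu i).
Proof. by exists (GRing.Var _ i). Qed.
Lemma defterm_cst c : defterm (fun=> c).
Proof. by exists (GRing.Const c). Qed.
Lemma defterm_add g h : defterm g -> defterm h -> defterm (fun nu => g nu + h
  nu).
Proof.
by move=> [t rt tE] [s rs sE]; exists (GRing.Add t s) => [|e];
  rewrite /= ?rt // tE sE.
Qed.
Lemma defterm_mul g h : defterm g -> defterm h -> defterm (fun nu => g nu * h
  nu).
Proof.
by move=> [t rt tE] [s rs sE]; exists (GRing.Mul t s) => [|e];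
  rewrite /= ?rt // tE sE.
Qed.
Lemma defterm_opp g : defterm g -> defterm (fun nu => - g nu).
Proof. by move=> [t rt tE]; exists (GRing.Opp t) => [|e];
  rewrite /= ?rt // tE. Qed.

Lemma defterm_sum n (g : 'I_n -> (nat -> R) -> R) :
  (forall i, defterm (g i)) -> defterm (fun nu => \sum_i g i nu).
Proof.
move=> gd; rewrite /index_enum; elim: (Finite.enum _) => [|i s IH].
  rewrite (_ : (fun _ => _) = (fun=> 0)); first exact: defterm_cst.
  by apply/funext => nu; rewrite big_nil.
rewrite (_ : (fun _ => _) = (fun nu => g i nu + \sum_(i <- s) g i nu)).
  exact: defterm_add.
by apply/funext => nu; rewrite big_cons.
Qed.

Definition cdefterm (g : (nat -> R) -> C) :=
  defterm (fun nu => Re (g nu)) /\ defterm (fun nu => Im (g nu)).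

Lemma ReM (z w : C) : Re (z * w) = Re z * Re w - Im z * Im w.
Proof. by case: z w => a b []. Qed.
Lemma ImM (z w : C) : Im (z * w) = Re z * Im w + Im z * Re w.
Proof. by case: z w => a b []. Qed.

Lemma cdefterm_meval n (v : 'I_n -> (nat -> R) -> C) p :
  (forall i, cdefterm (v i)) -> cdefterm (fun nu => meval (v^~ nu) p).
Proof.
move=> vd; apply: (meval_closed (Q := cdefterm)) => //.
- by move=> c; split; apply: defterm_cst.
- move=> f g [fr fi] [gr gi]; split.
    rewrite (_ : (fun _ => _) = (fun nu => Re (f nu) + Re (g nu)));
      first exact: defterm_add.
    by apply/funext => nu; rewrite raddfD.
  rewrite (_ : (fun _ => _) = (fun nu => Im (f nu) + Im (g nu)));
    first exact: defterm_add.
  by apply/funext => nu; rewrite raddfD.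
- move=> f g [fr fi] [gr gi]; split.
    rewrite (_ : (fun _ => _) = (fun nu => Re (f nu) * Re (g nu) + - (Im (f
      nu) * Im (g nu)))).
      by apply: defterm_add; [|apply: defterm_opp]; apply: defterm_mul.
    by apply/funext => nu; rewrite ReM.
  rewrite (_ : (fun _ => _) = (fun nu => Re (f nu) * Im (g nu) + Im (f nu) *
    Re (g nu))).
    by apply: defterm_add; apply: defterm_mul.
  by apply/funext => nu; rewrite ImM.
Qed.

Definition definable (P : (nat -> R) -> Prop) := exists2 f : ord.formula R,
  ord.rformula f & forall e, ord.holds e f <-> P (nth 0 e).

Lemma definable_eq g h : defterm g -> defterm h -> definable (fun nu => g nu =
  h nu).
Proof.
move=> [t rt tE] [s rs sE]; exists (ord.Equal t s) => [|e]; rewrite /= ?rt //.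
by rewrite tE sE.
Qed.
Lemma definable_le g h : defterm g -> defterm h -> definable (fun nu => g nu
  <= h nu).
Proof.
move=> [t rt tE] [s rs sE]; exists (ord.Le t s) => [|e]; rewrite /= ?rt //.
by rewrite tE sE.
Qed.
Lemma definable_and P Q : definable P -> definable Q -> definable (fun nu => P
  nu /\ Q nu).
Proof.
move=> [f rf fP] [g rg gQ]; exists (ord.And f g) => [|e]; rewrite /= ?rf //.
by rewrite fP gQ.
Qed.
Lemma definable_imp P Q : definable P -> definable Q -> definable (fun nu => P
  nu -> Q nu).
Proof.
move=> [f rf fP] [g rg gQ]; exists (ord.Implies f g) => [|e]; rewrite /= ?rf //.
by rewrite fP gQ.
Qed.
Lemma definable_all (T : eqType) (s : seq T) (P : T -> (nat -> R) -> Prop) :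
  (forall a, definable (P a)) -> definable (fun nu => forall a, a \in s -> P a
    nu).
Proof.
move=> Pd; elim: s => [|a s [f rf fP]]; first by exists (ord.Bool true).
have [g rg gP] := Pd a; exists (ord.And g f) => [|e]; rewrite /= ?rg // fP gP.
split=> [[Pa Ps] b|Ps]; first by rewrite inE => /orP[/eqP ->|/Ps].
by split=> [|b bs]; apply: Ps; rewrite inE ?eqxx ?bs ?orbT.
Qed.

(** Letting [u] vary here amounts to quantifying over all the variables of [J] at once. *)
Definition override (J : seq nat) (u nu : nat -> R) : nat -> R :=
  fun i => if i \in J then u i else nu i.

Lemma override_cons i J u nu :
  override (i :: J) u nu = override J u (override [:: i] u nu).
Proof.
by apply/funext => j; rewrite /override !inE; case: (j == i); case: (j \in J).
Qed.

Lemma nth_override1 i (u : nat -> R) e :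
  nth 0 (set_nth 0 e i (u i)) = override [:: i] u (nth 0 e).
Proof.
apply/funext => j; rewrite nth_set_nth /override inE /=.
by case: eqP => [->|].
Qed.

Lemma definable_forall J P : definable P ->
  definable (fun nu => forall u, P (override J u nu)).
Proof.
move=> Pd; elim: J => [|i J [f rf fP]].
  have [f rf fP] := Pd; exists f => // e; rewrite fP.
  by split=> [Pe u|/(_ (fun=> 0))].
exists (ord.Forall i f) => // e /=; split=> [fe u|Pe x].
  have := fe (u i); rewrite fP => /(_ u).
  by rewrite (nth_override1 i u) (override_cons i J).
(* The combined assignment gives [J] precedence over [i]: if [i] occurs again in [J], the inner
   quantifier rebinds it. *)
apply/fP => u; pose w j := if j \in J then u j else x.
suff -> : override J u (nth 0 (set_nth 0 e i x)) = override (i :: J) w (nth 0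
  e) by [].
apply/funext => j; rewrite /override /w inE.
case: (boolP (j \in J)) => _; rewrite ?orbT ?orbF //.
by rewrite nth_set_nth /=; case: (j == i).
Qed.

Lemma holds_exists J u (f : ord.formula R) P :
  (forall e, ord.holds e f <-> P (nth 0 e)) -> forall e,
  P (override J u (nth 0 e)) -> ord.holds e (foldr (@ord.Exists R) f J).
Proof.
move=> fP; elim: J => [|i J IH] e; first by move=> Pe; apply/fP.
rewrite override_cons -(nth_override1 i u) => Pe /=.
by exists (u i); apply: IH.
Qed.

End Definable.

(** * The minimising curve *)

Section Minimum.
Variable R : realType.
Local Notation C := (R[i]).
Local Open Scope complex_scope.

Lemma compact_min (T : topologicalType) (A : set T) (f : T -> R) :
  compact A -> A !=set0 -> continuous f -> exists2 a, A a & forall b, A b -> f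
    a <= f b.
Proof.
move=> cA [a0 Aa0] cf.
have cfA : compact (f @` A).
  by apply: continuous_compact cA; apply: continuous_subspaceT.
have [M [Mr MP]] := compact_bounded cfA.
have hi : has_inf (f @` A).
  split; first by exists (f a0), a0.
  exists (- (M + 1)) => y fy; have := MP (M + 1) _ y fy.
  by rewrite ltrDl ltr01 => /(_ isT); rewrite /= ler_norml => /andP[].
have : closure (f @` A) (inf (f @` A)).
  move=> B /nbhs_ballP[e /= e0 eB].
  have [y fy yi] := inf_adherent e0 hi; exists y; split=> //; apply: eB.
  rewrite /ball /= distrC ger0_norm ?subr_ge0 ?ltrBlDl //.
  by apply: ge_inf => //; case: hi.
have /closure_id <- := compact_closed (@Rhausdorff R) cfA.
move=> [a Aa fa]; exists a => // b Ab; rewrite fa; apply: ge_inf;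
  first by case: hi.
by exists b.
Qed.

Definition row_env m (v : 'rV[R]_m) : seq R := [seq v 0 i | i <- enum 'I_m].

Lemma nth_row_env m (v : 'rV[R]_m) (i : 'I_m) : nth 0 (row_env v) i = v 0 i.
Proof. by rewrite (nth_map i) ?size_enum_ord // nth_ord_enum. Qed.

Lemma defterm_continuous m g : defterm g ->
  continuous (fun v : 'rV[R]_m => g (nth 0 (row_env v))).
Proof.
move=> [t rt tE]; rewrite (_ : (fun _ => _) = (fun v => GRing.eval (row_env v)
  t)); last first.
  by apply/funext => v; rewrite tE.
elim: t rt {tE} => //=.
- move=> i _; case: (ltnP i m) => [im|mi].
    rewrite (_ : (fun _ => _) = (fun v : 'rV[R]_m => v 0 (Ordinal im))).
      exact: coord_continuous.
    by apply/funext => v; rewrite -(nth_row_env v (Ordinal im)).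
  rewrite (_ : (fun _ => _) = (fun=> 0)); first by move=> v;
    apply: cst_continuous.
  by apply/funext => v; rewrite nth_default // size_map size_enum_ord.
- by move=> r _ v; apply: cst_continuous.
- by move=> r _ v; apply: cst_continuous.
- move=> t1 IH1 t2 IH2 /andP[/IH1 c1 /IH2 c2] v.
  by apply: continuousD; [apply: c1|apply: c2].
- by move=> t1 IH1 /IH1 c1 v; apply: continuousN; apply: c1.
- move=> t1 IH1 k /IH1 c1; elim: k => [|k IH].
    rewrite (_ : (fun _ => _) = (fun=> 0)); first by move=> v;
      apply: cst_continuous.
    by apply/funext => v; rewrite mulr0n.
  rewrite (_ : (fun _ => _) = (fun v => GRing.eval (row_env v) t1 + GRing.eval
    (row_env v) t1 *+ k)).
    by move=> v; exact: (continuousD (c1 v) (IH v)).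
  by apply/funext => v; rewrite mulrS.
- move=> t1 IH1 t2 IH2 /andP[/IH1 c1 /IH2 c2] v.
  by apply: continuousM; [apply: c1|apply: c2].
- move=> t1 IH1 k /IH1 c1; elim: k => [|k IH].
    rewrite (_ : (fun _ => _) = (fun=> 1)); first by move=> v;
      apply: cst_continuous.
    by apply/funext => v; rewrite expr0.
  rewrite (_ : (fun _ => _) = (fun v => GRing.eval (row_env v) t1 * GRing.eval
    (row_env v) t1 ^+ k)).
    by move=> v; exact: (continuousM (c1 v) (IH v)).
  by apply/funext => v; rewrite exprS.
Qed.

Lemma defterm_closed m g : defterm g ->
  closed [set v : 'rV[R]_m | g (nth 0 (row_env v)) = 0].
Proof.
move=> /(@defterm_continuous m) cg.
rewrite (_ : [set v | _] = (fun v => g (nth 0 (row_env v))) @^-1` [set 0]) //.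
apply: (@closed_comp _ _ (fun v : 'rV[R]_m => g (nth 0 (row_env v))) [set 0])
  => [v _|].
  exact: cg.
exact: closed_eq.
Qed.

Definition nsq n (v : 'rV[C]_n) : R := \sum_i (Re (v 0 i) ^+ 2 + Im (v 0 i) ^+
  2).

Lemma cabs_sqr (z : C) : cabs z ^+ 2 = Re z ^+ 2 + Im z ^+ 2.
Proof.
by case: z => a b; rewrite /cabs /= sqr_sqrtr // addr_ge0 // sqr_ge0.
Qed.

Lemma enormE n (v : 'rV[C]_n) : enorm v = Num.sqrt (nsq v).
Proof. by congr Num.sqrt; apply: eq_bigr => i _; rewrite cabs_sqr. Qed.

Lemma nsq_ge0 n (v : 'rV[C]_n) : 0 <= nsq v.
Proof. by apply: sumr_ge0 => i _; rewrite addr_ge0 // sqr_ge0. Qed.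

Lemma enorm_ge0 n (v : 'rV[C]_n) : 0 <= enorm v. Proof. exact: sqrtr_ge0. Qed.

Lemma enorm_sqr n (v : 'rV[C]_n) : enorm v ^+ 2 = nsq v.
Proof. by rewrite enormE sqr_sqrtr // nsq_ge0. Qed.

(* The point of C^n whose coordinates have their real and imaginary parts at the
   positions [a, a + 1, ...] of [nu]. *)
Definition point_at n a (nu : nat -> R) : 'rV[C]_n :=
  \row_i (nu (a + i.*2)%N +i* nu (a + i.*2).+1).

Definition coords n a (z : 'rV[C]_n) (j : nat) : R :=
  if insub (j - a)./2 is Some i then
    (if odd (j - a) then Im (z 0 i) else Re (z 0 i)) else 0.

Lemma coords_re n a (z : 'rV[C]_n) (i : 'I_n) : coords a z (a + i.*2) = Re (z
  0 i).
Proof.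
rewrite /coords addKn odd_double doubleK.
by case: insubP => [j _ ji|]; [congr (Re (z 0 _));
  apply: val_inj|rewrite ltn_ord].
Qed.

Lemma coords_im n a (z : 'rV[C]_n) (i : 'I_n) : coords a z (a + i.*2).+1 = Im
  (z 0 i).
Proof.
rewrite /coords -addnS addKn /= odd_double /= uphalf_double.
by case: insubP => [j _ ji|]; [congr (Im (z 0 _));
  apply: val_inj|rewrite ltn_ord].
Qed.

Lemma point_at_coords n a (z : 'rV[C]_n) : point_at n a (coords a z) = z.
Proof.
apply/rowP => i; rewrite mxE coords_re coords_im; by case: (z 0 i).
Qed.

Lemma point_at_eq n a nu mu :
  (forall j, (a <= j < a + n.*2)%N -> nu j = mu j) -> point_at n a nu =
    point_at n a mu.
Proof.
move=> E; apply/rowP => i; rewrite !mxE.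
have i1 : (i.*2.+1 < n.*2)%N by rewrite -!muln2; have := ltn_ord i; lia.
have A1 : (a <= a + i.*2 < a + n.*2)%N by rewrite leq_addr ltn_add2l (ltnW i1).
have A2 : (a <= (a + i.*2).+1 < a + n.*2)%N by rewrite -addnS leq_addr
  ltn_add2l.
by rewrite (E _ A1) (E _ A2).
Qed.

Lemma cdefterm_point_at n a i : cdefterm (fun nu => point_at n a nu 0 i).
Proof.
split.
  rewrite (_ : (fun _ => _) = (fun nu => nu (a + i.*2)%N));
    first exact: defterm_var.
  by apply/funext => nu; rewrite mxE.
rewrite (_ : (fun _ => _) = (fun nu => nu (a + i.*2).+1));
  first exact: defterm_var.
by apply/funext => nu; rewrite mxE.
Qed.

Lemma cdefterm_peval n a (p : mpoly n C) : cdefterm (fun nu => peval p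
  (point_at n a nu)).
Proof.
apply: (@cdefterm_meval R n (fun i nu => point_at n a nu 0 i)) => i.
exact: cdefterm_point_at.
Qed.

Lemma defterm_nsq n (v : (nat -> R) -> 'rV[C]_n) :
  (forall i, cdefterm (fun nu => v nu 0 i)) -> defterm (fun nu => nsq (v nu)).
Proof.
move=> vd; apply: defterm_sum => i; have [vr vi] := vd i.
by apply: defterm_add; apply: defterm_mul.
Qed.

Lemma defterm_nsq_poly n m (F : 'rV[C]_n -> 'rV[C]_m) a : polynomial_map F ->
  defterm (fun nu => nsq (F (point_at n a nu))).
Proof.
move=> [P PE]; apply: defterm_nsq => j.
rewrite (_ : (fun _ => _) = (fun nu => peval (P j) (point_at n a nu))).
  exact: cdefterm_peval.
by apply/funext => nu; rewrite PE.
Qed.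

(** The sphere is transported to real row vectors of length [n.*2], where the equations of [S] are
    closed conditions on continuous terms and boxes are compact. *)
Lemma sphere_min n m (F : 'rV[C]_n -> 'rV[C]_m) (S : set 'rV[C]_n) z0 :
  polynomial_map F -> algebraic_set S -> S z0 ->
  exists z, [/\ S z, nsq z = nsq z0 &
    forall w, S w -> nsq w = nsq z0 -> nsq (F z) <= nsq (F w)].
Proof.
move=> pF [ps SE] Sz0; pose k := n.*2.
pose pt (v : 'rV[R]_k) := point_at n 0 (nth 0 (row_env v)).
pose A := [set v : 'rV[R]_k | S (pt v) /\ nsq (pt v) = nsq z0].
pose enc (z : 'rV[C]_n) : 'rV[R]_k := \row_j coords 0 z j.
have encK z : pt (enc z) = z.
  rewrite -[RHS](point_at_coords 0); apply: point_at_eq => j /andP[_ jk].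
  by have := nth_row_env (enc z) (Ordinal jk); rewrite mxE.
have cA : compact A.
  (* Squares of coordinates are at most [nsq z0], which is at most [r ^+ 2]. *)
  pose r := nsq z0 + 1.
  have cK : compact [set v : 'rV[R]_k | forall i, `[- r, r]%classic (v ord0 i)].
    by apply: (@rV_compact _ k (fun=> `[- r, r]%classic)) => i;
      apply: segment_compact.
  apply: subclosed_compact cK _; last first.
    move=> v [_ nv] j /=; rewrite in_itv /= -ler_norml.
    have j2 : (j./2 < n)%N by rewrite -ltn_double (leq_ltn_trans _ (ltn_ord
      j)) // -[leqRHS]odd_double_half leq_addl.
    have le_j : v ord0 j ^+ 2 <= nsq z0.
      rewrite -nv /nsq (bigD1 (Ordinal j2)) //= !mxE /= !add0n -(nth_row_env v
        j).
      apply: le_trans (_ : nth 0 (row_env v) j./2.*2 ^+ 2 + nth 0 (row_env v)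
        j./2.*2.+1 ^+ 2 <= _).
        rewrite -{1}[j : nat]odd_double_half; case: (odd j).
          by rewrite add1n lerDr sqr_ge0.
        by rewrite add0n lerDl sqr_ge0.
      by rewrite lerDl; apply: sumr_ge0 => i _; rewrite addr_ge0 // sqr_ge0.
    rewrite -(ler_pXn2r (n := 2)) ?nnegrE ?addr_ge0 ?nsq_ge0 //.
    rewrite real_normK ?num_real //; apply: le_trans le_j _.
    have := nsq_ge0 z0; rewrite /r; nra.
  have -> : A = [set v | nsq (pt v) - nsq z0 = 0] `&`
      \bigcap_(p in [set` ps]) ([set v | Re (peval p (pt v)) = 0] `&` [set v |
        Im (peval p (pt v)) = 0]).
    apply/seteqP; split => v.
      move=> [Sv nv]; split=> /=; first by rewrite nv subrr.
      by move=> p /= pps; move: Sv; rewrite SE => /(_ p pps) ->.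
    move=> [/= /subr0_eq nv pv]; split=> //; rewrite SE => p /pv[/= a b].
    by rewrite [peval _ _]complexE a b mulr0 addr0.
  apply: closedI.
    apply: (@defterm_closed k (fun nu => nsq (point_at n 0 nu) - nsq z0)).
    apply: defterm_add (defterm_cst _); apply: defterm_nsq => i.
    exact: cdefterm_point_at.
  apply: closed_bigI => p _; have [dr di] := cdefterm_peval 0 p.
  by apply: closedI; [apply: (defterm_closed dr)|apply: (defterm_closed di)].
have [||v [Sv nv] vmin] := @compact_min _ A (fun v => nsq (F (pt v))) cA.
- by exists (enc z0); split; rewrite encK.
- exact: (defterm_continuous (defterm_nsq_poly 0 pF)).
exists (pt v); split=> // w Sw nw.
by have := vmin (enc w); rewrite encK; apply; split; rewrite encK.
Qed.

End Minimum.

(** * Holomorphy and Laurent expansion of the sums *)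

Section LaurentCurves.
Variable R : realType.
Local Notation C := (R[i]).
Local Open Scope complex_scope.
Implicit Types (f : cps C) (s z t h : C).

Lemma geometric_deriv f : geometric (fun k => k.+1%:R * f k.+1).
Proof.
have [M M1 fM] := geometric_cf f; have M0 := le_trans ler01 M1.
apply: (@geometricI _ _ (2 * M ^+ 2) (2 * M)); last by rewrite mulr_ge0.
move=> k; rewrite normrM normr_nat.
have -> : 2 * M ^+ 2 * (2 * M) ^+ k = 2 ^+ k.+1 * M ^+ k.+2.
  by rewrite exprMn !exprS expr0; ring.
by rewrite ler_pM // -natrX ler_nat ltnW // ltn_expl.
Qed.
Definition cps_deriv f := cps_of (geometric_deriv f).

(** A quadratic remainder, uniform over a disc, is obtained from the partial sums; it yields
    differentiability without interchanging limits. *)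
Lemma psum_taylor f : exists2 rho : R, 0 < rho & exists c : R, 0 <= c /\
  forall s0, cabs s0 <= rho ->
  exists L, forall s z z0, cabs s <= rho -> psum f s z -> psum f s0 z0 ->
    cabs (z - z0 - L * (s - s0)) <= c * cabs (s - s0) ^+ 2.
Proof.
have [m m1 fm] := cps_bound f; have m0 := lt_le_trans ltr01 m1.
have [e e0 ex] := psum_exists (cps_deriv f).
(* The first bound gives the ratio [2 * m * rho <= 2^-1] in the estimate of the remainders; the
   second places [s0] in the disc where the derived series has a sum. *)
pose rho := Num.min (4 * m)^-1 (e / 2).
have rho0 : 0 < rho by rewrite lt_min invr_gt0 mulr_gt0 // divr_gt0.
have mrho : 2 * m * rho <= 2^-1.
  have : rho <= (4 * m)^-1 by rewrite ge_min lexx.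
  rewrite -(ler_pM2l (_ : 0 < 2 * m)) ?mulr_gt0 // => /le_trans; apply.
  by rewrite le_eqVlt; apply/orP; left; apply/eqP; field; rewrite gt_eqF.
exists rho => //; exists (m ^+ 2 / rho * 2).
split; first by rewrite !mulr_ge0 ?exprn_ge0 ?invr_ge0 // ltW.
move=> s0 s0r.
have [|L fL] := ex s0.
  by apply: le_lt_trans s0r _; rewrite gt_min ltr_pdivrMr // mulr_natr mulr2n
    ltrDl e0 orbT.
exists L => s z z0 sr [K1 zK] [K2 z0K]; case: fL => K3 LK.
set d := s - s0; have sE : s = s0 + d by rewrite /d addrC subrK.
(* This is the first-order Taylor remainder of the monomial of degree [k.+1]; the recurrence [ES]
   gives the geometric bound [EB], using [k.+1 <= 2 ^+ k]. *)
pose E k := s ^+ k.+1 - s0 ^+ k.+1 - k.+1%:R * s0 ^+ k * d.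
have ES k : E k.+1 = s * E k + k.+1%:R * d ^+ 2 * s0 ^+ k.
  by rewrite /E sE !exprS -[k.+2]add1n natrD; ring.
have EB k : cabs (E k) <= cabs d ^+ 2 * (rho^-1 * (2 * rho) ^+ k).
  elim: k => [|k IH].
    rewrite /E !expr1 expr0 mulr1 mul1r -/d subrr cabs0.
    by rewrite !mulr_ge0 ?exprn_ge0 ?mulr_ge0 ?cabs_ge0 ?invr_ge0 // ltW.
  rewrite ES; apply: le_trans (cabsD _ _) _; rewrite !cabsM.
  apply: le_trans (_ : rho * (cabs d ^+ 2 * (rho^-1 * (2 * rho) ^+ k)) +
     2 ^+ k * cabs d ^+ 2 * rho ^+ k <= _).
    apply: lerD; first by rewrite ler_pM ?cabs_ge0.
    rewrite !cabsX; apply: ler_pM; rewrite ?mulr_ge0 ?exprn_ge0 ?cabs_ge0 //.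
      rewrite ler_wpM2r ?mulr_ge0 ?cabs_ge0 //.
      by rewrite cabs_nat -natrX ler_nat ltn_expl.
    by rewrite lerXn2r ?nnegrE ?cabs_ge0 // ltW.
  rewrite le_eqVlt; apply/orP; left; apply/eqP.
  by rewrite !exprMn !exprS; field; rewrite gt_eqF.
have partial n : cabs ((cps_trunc n.+1 f).[s] - (cps_trunc n.+1 f).[s0] -
  (cps_trunc n (cps_deriv f)).[s0] * d)
    <= m ^+ 2 / rho * 2 * cabs d ^+ 2.
  have -> : (cps_trunc n.+1 f).[s] - (cps_trunc n.+1 f).[s0] - (cps_trunc n
    (cps_deriv f)).[s0] * d
      = \sum_(k < n) f k.+1 * E k.
    rewrite !horner_trunc !big_ord_recl !expr0 opprD addrACA subrr add0r
      mulr_suml.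
    rewrite -!sumrB; apply: eq_bigr => k _; rewrite /E /=; ring.
  apply: le_trans (cabs_sum _ _ _) _.
  apply: le_trans (_ : \sum_(k < n) m ^+ 2 / rho * cabs d ^+ 2 * 2^-1 ^+ k <=
    _).
    apply: ler_sum => k _; rewrite cabsM.
    apply: le_trans (ler_pM (cabs_ge0 _) (cabs_ge0 _) (fm _) (EB k)) _.
    have -> : m ^+ k.+2 * (cabs d ^+ 2 * (rho^-1 * (2 * rho) ^+ k)) =
        m ^+ 2 / rho * cabs d ^+ 2 * (2 * m * rho) ^+ k.
      by rewrite !exprMn !exprS; field; rewrite gt_eqF.
    rewrite ler_wpM2l ?lerXn2r ?nnegrE ?invr_ge0 ?mulr_ge0 ?exprn_ge0
      ?cabs_ge0 ?invr_ge0 ?(ltW m0) ?(ltW rho0) //.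
  rewrite -mulr_sumr [leRHS]mulrAC ler_wpM2l ?half_sum_le //.
  by rewrite !mulr_ge0 ?exprn_ge0 ?cabs_ge0 ?invr_ge0 // ltW.
rewrite -subr_le0; apply: (@le_half_powers _ _ (K1 * 2^-1 + K2 * 2^-1 + K3 *
  cabs d)) => n.
rewrite lerBlDr; apply: le_trans (lerD (lexx _) (partial n)).
have := zK n.+1; have := z0K n.+1; have := LK n; rewrite !exprS.
set A := (cps_trunc n.+1 f).[s]; set B := (cps_trunc n.+1 f).[s0];
  set D := (cps_trunc n (cps_deriv f)).[s0].
move=> h3 h2 h1.
have -> : z - z0 - L * d = (z - A) - (z0 - B) - (L - D) * d + (A - B - D * d)
  by ring.
apply: le_trans (cabsD _ _) _; rewrite lerD2r.
apply: le_trans (cabsD _ _) _; rewrite cabsN cabsM.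
apply: le_trans (lerD (cabsD _ _) (lexx _)) _; rewrite cabsN.
have := ler_wpM2r (cabs_ge0 d) h3; move: h1 h2; rewrite !mulrDl.
move: (2^-1 ^+ n) => q; lra.
Qed.

Lemma derivable_of_taylor (g : C -> C) t : (exists L (c e : R), [/\ 0 < e, 0
  <= c & forall h,
    cabs h < e -> cabs (g (t + h) - g t - L * h) <= c * cabs h ^+ 2]) ->
  derivable (g : C^o -> C^o) t 1.
Proof.
move=> [L [c [e [e0 c0 gL]]]]; apply/cvg_ex; exists (L : C^o).
apply/cvgrPdist_lt => /= a a0.
pose b := Re a; have aE : a = b%:C by rewrite RRe_real // gtr0_real.
have b0 : 0 < b by rewrite aE ltcR in a0.
pose r := Num.min e (b / (1 + c)).
have r0 : 0 < r by rewrite lt_min e0 divr_gt0 // ltr_pwDl.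
have rC : 0 < r%:C :> C by rewrite ltcR.
near=> h.
have h0 : h != 0 by near: h; exact: (@nbhs_dnbhs_neq (C^o) 0).
have hr : cabs h < r.
  rewrite -ltcR -normr_cabs; near: h.
  exact: (@dnbhs0_lt _ (C^o) _ rC).
rewrite aE normr_cabs ltcR.
have -> : L - h^-1 *: (g (h *: 1 + t) - g t) = - (h^-1 * (g (t + h) - g t - L
  * h)).
  rewrite -[LHS]/(L - h^-1 * (g (h * 1 + t) - g t)) mulr1 [h + t]addrC.
  by rewrite [in RHS]mulrBr [L * h]mulrC mulKf // opprB.
rewrite cabsN cabsM cabsV mulrC ltr_pdivrMr ?cabs_gt0 //.
have := gL h; move: hr; rewrite lt_min => /andP[he hb] /(_ he) /le_lt_trans;
  apply.
rewrite expr2 mulrA ltr_pM2r ?cabs_gt0 //.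
rewrite ltr_pdivlMr ?ltr_pwDl // in hb.
apply: le_lt_trans hb; rewrite mulrC ler_wpM2l ?cabs_ge0 // lerDr //.
Unshelve. all: by end_near.
Qed.

Lemma cev_derivable f : at_large (fun t => derivable (cev f : C^o -> C^o) t 1).
Proof.
have [rho rho0 [c [c0 tay]]] := psum_taylor f.
have [r rP] := at_large_and (at_large_and (at_large_inv rho0) (cevP f))
  (at_large_neq0 R).
exists r => t rt; apply: derivable_of_taylor.
have [[tr tf] t0] := rP t rt; have [L LP] := tay t^-1 (ltW tr).
(* This is the chain rule for the inverse. The constants come from [s - s0 = - (h * s * s0)] with
   [s] and [s0] bounded by [rho], and the radius keeps [t + h] in the domain. *)
exists (- (L * t^-1 ^+ 2)), (c * rho ^+ 4 + cabs L * rho ^+ 3), (cabs t - r);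
  split.
- by rewrite subr_gt0.
- by rewrite addr_ge0 // mulr_ge0 ?exprn_ge0 ?cabs_ge0 // ltW.
move=> h hr; have rth : r < cabs (t + h).
  have := cabs_dist t (- h); rewrite opprK cabsN; lra.
have [[thr thf] th0] := rP _ rth.
have := LP _ _ _ (ltW thr) thf tf.
set s := (t + h)^-1 in thr thf *; set s0 := t^-1 in tr tf *.
have dE : s - s0 = - (h * s * s0) by rewrite /s /s0; field; rewrite t0.
have -> : cev f (t + h) - cev f t - - (L * s0 ^+ 2) * h =
    (cev f (t + h) - cev f t - L * (s - s0)) + L * (h ^+ 2 * s0 ^+ 2 * s).
  have -> : L * (h ^+ 2 * s0 ^+ 2 * s) = L * (- (h * s0) * (s - s0)) by
    rewrite dE; ring.
  have -> : L * (s - s0) = - L * h * s0 * s by rewrite dE; ring.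
  have -> : L * (- (h * s0) * (s - s0)) = - L * h * s0 * s + L * s0 ^+ 2 * h
    by ring.
  ring.
move=> le1; apply: le_trans (cabsD _ _) _; rewrite mulrDl; apply: lerD.
  apply: le_trans le1 _; rewrite -mulrA ler_wpM2l // dE cabsN !cabsM.
  have -> : (cabs h * cabs s * cabs s0) ^+ 2 = (cabs s * cabs s0) ^+ 2 * cabs
    h ^+ 2 by ring.
  rewrite ler_wpM2r ?exprn_ge0 ?cabs_ge0 //.
  rewrite [rho ^+ 4](_ : _ = (rho * rho) ^+ 2); last by ring.
  by rewrite lerXn2r ?nnegrE ?mulr_ge0 ?cabs_ge0 ?ler_pM ?cabs_ge0 // ltW.
rewrite cabsM -[leRHS]mulrA ler_wpM2l ?cabs_ge0 //.
have -> : cabs (h ^+ 2 * s0 ^+ 2 * s) = cabs h ^+ 2 * (cabs s0 ^+ 2 * cabs s).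
  by rewrite -mulrA cabsM cabsM !cabsX.
rewrite [leRHS]mulrC ler_wpM2l ?exprn_ge0 ?cabs_ge0 //.
rewrite [rho ^+ 3]exprSr; apply: ler_pM; rewrite ?exprn_ge0 ?cabs_ge0 //;
  last exact: ltW.
by rewrite lerXn2r ?nnegrE ?cabs_ge0 // ltW.
Qed.

Lemma laurent_curve d f : at_large (fun t =>
  derivable ((fun t => t ^+ d * cev f t) : C^o -> C^o) t 1) /\
  at_large (fun t => series (fun k => f k * t ^ (d%:Z - k%:Z) : C^o) @ \oo -->
    (t ^+ d * cev f t : C^o)).
Proof.
split.
  have [r rP] := cev_derivable f; exists r => t rt.
  have dX : derivable (fun t : C^o => t ^+ d : C^o) t 1.
    rewrite (_ : (fun _ => _) = (@id C^o) ^+ d);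
      first exact/derivableX/derivable_id.
    by apply/funext => u; rewrite fctE.
  exact: derivableM dX (rP t rt).
have [r rP] := at_large_and (cevP f) (at_large_neq0 R).
exists r => t rt; have [[K KP] t0] := rP t rt.
apply/cvgrPdist_lt => /= a a0.
pose b := Re a; have aE : a = b%:C by rewrite RRe_real // gtr0_real.
have b0 : 0 < b by rewrite aE ltcR in a0.
have K0 : 0 <= K by have := KP 0%N; rewrite expr0 mulr1; apply: le_trans;
  apply: cabs_ge0.
pose B := (cabs t ^+ d * K + 1) / b.
have B0 : 0 < B by rewrite divr_gt0 // ltr_wpDl // mulr_ge0 ?exprn_ge0
  ?cabs_ge0.
exists (Num.bound B) => // n /= Bn.
have -> : series (fun k => f k * t ^ (d%:Z - k%:Z) : C^o) n = t ^+ d *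
  (cps_trunc n f).[t^-1].
  rewrite /series /= big_mkord horner_trunc mulr_sumr; apply: eq_bigr => k _.
  by rewrite expfzDr // -exprnN -exprVn -exprnP; ring.
rewrite aE normr_cabs ltcR -mulrBr cabsM cabsX.
apply: le_lt_trans (ler_wpM2l _ (KP n)) _; first by rewrite exprn_ge0 ?cabs_ge0.
have Bn2 : B < 2 ^+ n.
  apply: lt_le_trans (archi_boundP (ltW B0)) _.
  by rewrite -natrX ler_nat (leq_trans Bn) // ltnW // ltn_expl.
rewrite mulrA exprVn ltr_pdivrMr ?exprn_gt0 //.
move: Bn2; rewrite ltr_pdivrMr // [b * _]mulrC; lra.
Qed.

End LaurentCurves.

(** * The optimal curve and its growth *)

Section OptimalCurve.
Variable R : realType.
Local Notation C := (R[i]).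
Local Open Scope complex_scope.

Lemma definable_alg n (S : set 'rV[C]_n) a : algebraic_set S ->
  definable (fun nu : nat -> R => S (point_at n a nu)).
Proof.
move=> [ps ->]; apply: (@definable_all _ _ ps (fun p nu => peval p (point_at n
  a nu) = 0)).
move=> p; have [dr di] := cdefterm_peval a p.
have [f rf fP] := definable_and (definable_eq dr (defterm_cst 0))
  (definable_eq di (defterm_cst 0)).
exists f => // e; rewrite fP; split=> [[re im]|->] //.
by rewrite [LHS]complexE re im mulr0 addr0.
Qed.

Definition minimal_at n m (F : 'rV[C]_n -> 'rV[C]_m) (S : set 'rV[C]_n) (nu :
  nat -> R) :=
  [/\ S (point_at n 1 nu), nsq (point_at n 1 nu) = nu 0%N ^+ 2 &
   forall w, S w -> nsq w = nu 0%N ^+ 2 -> nsq (F (point_at n 1 nu)) <= nsq (F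
     w)].

(* The coordinates of the point come after the radius [nu 0]; those of the
   competitor [w] are quantified over at the next positions. *)
Lemma definable_minimal n m (F : 'rV[C]_n -> 'rV[C]_m) (S : set 'rV[C]_n) :
  polynomial_map F -> algebraic_set S -> definable (minimal_at F S).
Proof.
move=> pF aS; pose b := (1 + n.*2)%N; pose J := iota b n.*2.
have dsq a : defterm (fun nu : nat -> R => nsq (point_at n a nu)).
  by apply: defterm_nsq => i; apply: cdefterm_point_at.
have d0 : defterm (fun nu : nat -> R => nu 0%N ^+ 2).
  by apply: defterm_mul; apply: defterm_var.
have := definable_and (definable_alg 1 aS) (definable_and (definable_eq (dsq
  1%N) d0)
  (definable_forall J (definable_imp (definable_alg b aS)
    (definable_imp (definable_eq (dsq b) d0)
      (definable_le (defterm_nsq_poly 1 pF) (defterm_nsq_poly b pF)))))).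
move=> [f rf fP]; exists f => // e; rewrite fP /=; move: (nth 0 e) => nu.
have ov0 u : override J u nu 0%N = nu 0%N.
  by rewrite /override mem_iota.
have ov1 u : point_at n 1 (override J u nu) = point_at n 1 nu.
  apply: point_at_eq => j /andP[_ jb]; rewrite /override mem_iota.
  by rewrite leqNgt jb.
have ovb w : point_at n b (override J (coords b w) nu) = w.
  rewrite -[RHS](point_at_coords b); apply: point_at_eq => j jb.
  by rewrite /override mem_iota jb.
split=> [[Sz [nz min]]|[Sz nz min]]; split=> //.
  move=> w Sw nw; have := min (coords b w).
  by rewrite ov0 ov1 ovb; apply.
by split=> // u; rewrite ov0 ov1; apply: min.
Qed.

Lemma at_large_seq (T : eqType) (s : seq T) (P : T -> C -> Prop) :
  (forall a, a \in s -> at_large (P a)) ->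
  at_large (fun t => forall a, a \in s -> P a t).
Proof.
elim: s => [|a s IH] sP; first by exists 0.
have sP' b : b \in s -> at_large (P b) by move=> bs; apply: sP;
  rewrite inE bs orbT.
have := at_large_and (sP a (mem_head _ _)) (IH sP').
apply: at_large_imp => x [Pa Ps] b.
by rewrite inE => /orP[/eqP->|/Ps].
Qed.

Lemma minimal_curve n m (F : 'rV[C]_n -> 'rV[C]_m) (S : set 'rV[C]_n) :
  polynomial_map F -> algebraic_set S -> unbounded S ->
  exists (N : nat) (d : 'I_n -> nat) (f : 'I_n -> cps C),
  let phi t := \row_i (t ^+ d i * cev (f i) t) in
  at_large (fun t => S (phi t)) /\
  at_pinfty (fun x => nsq (phi x%:C) = (x ^+ N.+1) ^+ 2 /\
    forall w, S w -> nsq w = (x ^+ N.+1) ^+ 2 -> nsq (F (phi x%:C)) <= nsq (F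
      w)).
Proof.
move=> pF aS uS; have [g rg gP] := definable_minimal pF aS.
have ge0 : genv (fun x : R => [:: x]).
  by move=> [|i]; [apply: rgerm_id|apply: rgerm_eq (rgerm_cst 0) _ => x;
    rewrite /= nth_nil].
have [|N [e [ge ce eE]]] := curve_selection (I := iota 1 n.*2) rg ge0.
  (* Unboundedness only says that spheres of arbitrarily large radius meet [S], which is all that
     selection asks; [holds_at_pinfty] then gives all large radii. *)
  move=> r; have [z0 Sz0 z0r] := uS (Num.max r 0).
  move: z0r; rewrite gt_max => /andP[rz0 _]; exists (enorm z0) => //.
  have [z [Sz nz zmin]] := sphere_min pF aS Sz0.
  apply: (holds_exists (u := coords 1 z) gP).
  set nu := override _ _ _.
  have nu0 : nu 0%N = enorm z0 by rewrite /nu /override mem_iota.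
  have nu1 : point_at n 1 nu = z.
    rewrite -[RHS](point_at_coords 1); apply: point_at_eq => j jb.
    by rewrite /nu /override mem_iota jb.
  by rewrite /minimal_at nu0 nu1 enorm_sqr; split.
have := holds_at_pinfty rg ge ce => pinf.
have coord i : exists df : nat * cps C, at_pinfty (fun x =>
    x%:C ^+ df.1 * cev df.2 x%:C = point_at n 1 (nth 0 (e x)) 0 i).
  have [Gr gr Er] := ge (1 + i.*2)%N; have [Gi gi Ei] := ge (1 + i.*2).+1.
  (* The germs extending the real and the imaginary part are combined into one complex germ, which
     equals the coordinate on the real axis. *)
  have [d [f fE]] := lgerm_add gr (lgerm_mul (lgerm_cst 'i) gi).
  exists (d, f); have := at_pinfty_and (at_pinfty_and Er Ei) (at_large_pinfty
    fE).
  apply: at_pinfty_imp => x [[xr xi] <-].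
  by rewrite xr xi mxE [RHS]complexE.
have [df dfE] := choice coord.
pose phi t := \row_i (t ^+ (df i).1 * cev (df i).2 t).
have phiE : at_pinfty (fun x => phi x%:C = point_at n 1 (nth 0 (e x))).
  have := @at_pinfty_seq _ _ (enum 'I_n) (fun i x => x%:C ^+ (df i).1 * cev
    (df i).2 x%:C =
    point_at n 1 (nth 0 (e x)) 0 i) (fun i _ => dfE i).
  by apply: at_pinfty_imp => x xE; apply/rowP => i; rewrite mxE xE // mem_enum.
exists N, (fun i => (df i).1), (fun i => (df i).2); rewrite /= -/phi.
(* Variable 0 is not among the selected ones, so [eE] says that the radius has become
   [x ^+ N.+1]. *)
have mini : at_pinfty (fun x => [/\ S (phi x%:C), nsq (phi x%:C) = (x ^+ N.+1)
  ^+ 2 &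
    forall w, S w -> nsq w = (x ^+ N.+1) ^+ 2 -> nsq (F (phi x%:C)) <= nsq (F
      w)]).
  have := at_pinfty_and phiE pinf; apply: at_pinfty_imp => x [-> /gP].
  by rewrite /minimal_at eE // mem_iota.
split; last by apply: at_pinfty_imp mini => x [].
have [ps SE] := aS.
(* Along the curve, an equation of [S] is a Laurent germ that vanishes at large reals; it cannot be
   eventually non-zero, so it vanishes for all large [t]. *)
have zero p : p \in ps -> at_large (fun t => peval p (phi t) = 0).
  move=> pps; have [//|nz] : at_large (fun t => peval p (phi t) = 0) \/
      at_large (fun t => peval p (phi t) != 0).
    apply: lgerm_eq0_or_neq0.
    apply: (meval_closed (Q := @lgerm R) (v := fun i t => phi t 0 i)) => [c|f1
      f2|f1 f2|i].
    - exact: lgerm_cst.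
    - exact: lgerm_add.
    - exact: lgerm_mul.
    - exists (df i).1, (df i).2; exists 0 => t _; by rewrite mxE.
  have [x [[Sx _ _]]] := at_pinfty_ex (at_pinfty_and mini (at_large_pinfty nz)).
  by move: Sx; rewrite SE => /(_ p pps) ->; rewrite eqxx.
by rewrite SE; apply: (at_large_seq (P := fun p t => peval p (phi t) = 0)).
Qed.

(** The exponent of the vector is the largest exponent of its non-zero components; a component
    attaining it gives the lower bound. *)
Lemma vector_asymp k (v : C -> 'rV[C]_k) : (forall i, lgerm (fun t => v t 0
  i)) ->
  at_large (fun t => v t = 0) \/ exists j : int, exists c1 c2 : R, [/\ 0 < c1,
    0 < c2 &
    at_large (fun t => c1 * cabs t ^ j <= enorm (v t) <= c2 * cabs t ^ j)].
Proof.
move=> vg.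
have cabs_le_enorm (w : 'rV[C]_k) i : cabs (w 0 i) <= enorm w.
  rewrite -(ler_pXn2r (n := 2)) ?nnegrE ?enorm_ge0 ?cabs_ge0 //.
  rewrite enorm_sqr cabs_sqr /nsq (bigD1 i) //= lerDl.
  by apply: sumr_ge0 => l _; rewrite addr_ge0 // sqr_ge0.
have enorm_le (w : 'rV[C]_k) (B : R) : 0 <= B -> (forall i, cabs (w 0 i) <= B)
  -> enorm w <= k%:R * B + B.
  move=> B0 wB; rewrite -(ler_pXn2r (n := 2)) ?nnegrE ?enorm_ge0 ?addr_ge0
    ?mulr_ge0 //.
  rewrite enorm_sqr /nsq; apply: le_trans (_ : \sum_(i < k) B ^+ 2 <= _).
    by apply: ler_sum => i _; rewrite -cabs_sqr lerXn2r ?nnegrE ?cabs_ge0.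
  rewrite sumr_const card_ord -[_ *+ k]mulr_natl.
  have -> : k%:R * B + B = (k%:R + 1) * B by ring.
  rewrite [leRHS]exprMn ler_wpM2r ?exprn_ge0 //.
  by have := ler0n R k; nra.
suff : (forall i, at_large (fun t => v t 0 i = 0)) \/ exists j : int, exists
  c1 c2 : R, [/\ 0 < c1, 0 < c2 &
    exists i0, at_large (fun t => c1 * cabs t ^ j <= cabs (v t 0 i0) /\ forall
      i, cabs (v t 0 i) <= c2 * cabs t ^ j)].
  move=> [v0|[j [c1 [c2 [c10 c20 [i0 vj]]]]]]; [left|right].
    have := @at_large_seq _ (enum 'I_k) (fun i t => v t 0 i = 0) (fun i _ =>
      v0 i).
    by apply: at_large_imp => t t0; apply/rowP => i; rewrite mxE t0 // mem_enum.
  exists j, c1, (k%:R * c2 + c2); split=> //; first by rewrite ltr_wpDl //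
    mulr_ge0 // ltW.
  apply: at_large_imp vj => t [lo hi]; rewrite (le_trans lo) //=.
  have B0 : 0 <= c2 * cabs t ^ j by rewrite mulr_ge0 ?exprz_ge0 ?cabs_ge0 //
    ltW.
  by apply: le_trans (enorm_le _ _ B0 hi) _; rewrite mulrDl mulrA.
suff ind (s : seq 'I_k) : (forall i, i \in s -> at_large (fun t => v t 0 i =
  0)) \/
    exists j : int, exists c1 c2 : R, [/\ 0 < c1, 0 < c2 & exists i0, 
      at_large (fun t => c1 * cabs t ^ j <= cabs (v t 0 i0)) /\
      forall i, i \in s -> at_large (fun t => cabs (v t 0 i) <= c2 * cabs t ^
        j)].
  have [v0|[j [c1 [c2 [c10 c20 [i0 [lo hi]]]]]]] := ind (enum 'I_k);
    [left|right].
    by move=> i; apply: v0; rewrite mem_enum.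
  exists j, c1, c2; split=> //; exists i0.
  have := at_large_and lo (@at_large_seq _ (enum 'I_k) (fun i t => cabs (v t 0
    i) <= c2 * cabs t ^ j) hi).
  by apply: at_large_imp => t [? tP]; split=> // i; apply: tP; rewrite mem_enum.
elim: s => [|i s IH]; first by left.
have [i_0|[j [a1 [a2 [a10 a20 vj]]]]] := lgerm_asymp (vg i).
  case: IH => [v0|[j [c1 [c2 [c10 c20 [i0 [lo hi]]]]]]]; [left|right].
    by move=> l; rewrite inE => /orP[/eqP ->|/v0].
  exists j, c1, c2; split=> //; exists i0; split=> // l;
    rewrite inE => /orP[/eqP ->|/hi //].
  apply: at_large_imp i_0 => t ->; rewrite cabs0.
  by rewrite mulr_ge0 ?exprz_ge0 ?cabs_ge0 // ltW.
have vlo : at_large (fun t => a1 * cabs t ^ j <= cabs (v t 0 i)).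
  by apply: at_large_imp vj => t /andP[].
have vhi : at_large (fun t => cabs (v t 0 i) <= a2 * cabs t ^ j).
  by apply: at_large_imp vj => t /andP[].
right; case: IH => [v0|[l [c1 [c2 [c10 c20 [i0 [lo hi]]]]]]].
  exists j, a1, a2; split=> //; exists i; split=> // l;
    rewrite inE => /orP[/eqP -> //|/v0].
  apply: at_large_imp => t ->; rewrite cabs0.
  by rewrite mulr_ge0 ?exprz_ge0 ?cabs_ge0 // ltW.
(* For [|t| > 1] an upper bound survives an increase of its exponent and its constant, which lets
   all components share one bound. *)
have big (p q : int) (b : R) (b' : R) (i' : 'I_k) : 0 < b -> 0 < b' -> p <= q ->
    at_large (fun t => cabs (v t 0 i') <= b * cabs t ^ p) ->
    at_large (fun t => cabs (v t 0 i') <= (b + b') * cabs t ^ q).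
  move=> b0 b0' pq vb; have := at_large_and vb (at_large_gt 1).
  apply: at_large_imp => t [tb t1]; apply: le_trans tb _.
  apply: ler_pM; rewrite ?exprz_ge0 ?cabs_ge0 // ?lerDl;
    [exact: ltW|exact: ltW|].
  by rewrite ler_weXz2l // ltW.
case: (leP j l) => [jl|/ltW lj].
  exists l, c1, (a2 + c2); split=> //; first exact: addr_gt0.
  exists i0; split=> // i'; rewrite inE => /orP[/eqP ->|/hi h];
    first exact: (big j l).
  by rewrite addrC; apply: (big l l).
exists j, a1, (a2 + c2); split=> //; first exact: addr_gt0.
exists i; split=> // i'; rewrite inE => /orP[/eqP ->|/hi h];
  first exact: (big j j).
by rewrite addrC; apply: (big l j).
Qed.

Lemma powR_growth (a b c : R) : at_pinfty (fun x => x `^ a <= c * x `^ b) -> a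
  <= b.
Proof.
move=> ab; rewrite leNgt; apply/negP => ba.
have c0 : 0 < `|c| + 1 by rewrite ltr_wpDl.
(* Beyond [y], the power of exponent [a - b] is at least [|c| + 1], hence exceeds [c]. *)
pose y := (`|c| + 1) `^ ((a - b)^-1).
have [x [[xab x0] xy]] := at_pinfty_ex (at_pinfty_and (at_pinfty_and ab
  (at_pinfty_gt 0)) (at_pinfty_gt y)).
have ab0 : 0 < a - b by rewrite subr_gt0.
have : `|c| + 1 <= x `^ (a - b).
  have -> : `|c| + 1 = y `^ (a - b).
    by rewrite /y -powRrM mulVf ?gt_eqF // powRr1 // ltW.
  by rewrite ge0_ler_powR ?nnegrE ?(ltW ab0) ?(ltW x0) ?(ltW xy) ?powR_ge0.
have xb : 0 < x `^ b by rewrite powR_gt0.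
have xE : x `^ a = x `^ (a - b) * x `^ b.
  by rewrite -powRD ?subrK // (gt_eqF x0) implybT.
move: xab; rewrite xE ler_pM2r // => /[swap] /le_trans /[apply].
by have := ler_norm c; lra.
Qed.

(** The exponent obtained for [F] may be negative, in which case the two bounds are exchanged; the
    minimum and the maximum cover both cases. *)
Lemma powR_between (u v y q : R) : 0 < u -> u <= y -> y <= v ->
  Num.min (u `^ q) (v `^ q) <= y `^ q <= Num.max (u `^ q) (v `^ q).
Proof.
move=> u0 uy yv; have y0 := lt_le_trans u0 uy; have v0 := lt_le_trans y0 yv.
have [q0|q0] := leP 0 q.
  have mono z z' : 0 < z -> z <= z' -> z `^ q <= z' `^ q.
    move=> z0 zz; have z0' := lt_le_trans z0 zz.
    by apply: ge0_ler_powR; rewrite ?nnegrE // ltW.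
  by rewrite ge_min le_max (mono u y) // (mono y v) // !orbT.
have inv z : 0 < z -> z `^ q = (z `^ (- q))^-1 by move=> z0;
  rewrite powRN invrK.
have mono z z' : 0 < z -> z <= z' -> z' `^ q <= z `^ q.
  move=> z0 zz; have z0' := lt_le_trans z0 zz; rewrite !inv // lef_pV2 ?posrE
    ?powR_gt0 //.
  by apply: ge0_ler_powR; rewrite ?nnegrE ?oppr_ge0 // ltW.
by rewrite ge_min le_max (mono u y) // (mono y v) // orbT.
Qed.

End OptimalCurve.

Theorem proposition1 (R : realType) (n m : nat) (n2 : (2 <= n)%N)
    (F : 'rV[R[i]]_n -> 'rV[R[i]]_m) (polyF : polynomial_map F)
    (S : set 'rV[R[i]]_n) (algS : algebraic_set S) (unbS : unbounded S)
    (finF : finite_set (S `&` [set z | F z = 0])) :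
  (exists2 q : rat, loj_exp F S = (ratr q)%:E & loj_set F S (ratr q)) /\
  (exists2 r : R, 0 < r & exists phi : R[i] -> 'rV[R[i]]_n,
    [/\ meromorphic_at_infty r phi,
        forall t, r < cabs t -> S (phi t),
        tends_to_pinfty (fun t => enorm (phi t)) &
        asymp_equiv (fun t => enorm (F (phi t)))
          (fun t => enorm (phi t) `^ fine (loj_exp F S))]).
Proof.
have [N [d [f]]] := minimal_curve polyF algS unbS; set phi := fun t => _.
move=> /= [Sphi mini].
have phig i : lgerm (fun t => phi t 0 i).
  by exists (d i), (f i); exists 0 => t _; rewrite mxE.
have Fphig j : lgerm (fun t => F (phi t) 0 j).
  have [P PE] := polyF.
  rewrite (_ : (fun _ => _) = (fun t => meval (fun i => phi t 0 i) (P j)));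
    last first.
    by apply/funext => t; rewrite PE.
  apply: (meval_closed (Q := @lgerm R) (v := fun i t => phi t 0 i)) => //.
  - exact: lgerm_cst.
  - by move=> g h; apply: lgerm_add.
  - by move=> g h; apply: lgerm_mul.
have ephi : at_pinfty (fun x => 0 < x /\ enorm (phi (real_complex R x)) = x ^+
  N.+1).
  have := at_pinfty_and mini (at_pinfty_gt 0); apply: at_pinfty_imp => x [[nx
    _] x0].
  by split=> //; rewrite enormE nx sqrtr_sqr ger0_norm // exprn_ge0 // ltW.
have [phi0|[k [a1 [a2 [a10 a20 phik]]]]] := vector_asymp phig.
  have [x [[x0 ex] px]] := at_pinfty_ex (at_pinfty_and ephi (at_large_pinfty
    phi0)).
  move: ex; rewrite px enormE /nsq big1 ?sqrtr0 => [/eqP|i _].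
    by rewrite eq_sym expf_eq0 (gt_eqF x0) andbF.
  by rewrite !mxE /= expr0n addr0.
(* The exponent valid for complex [t] is already determined on the real axis, where the norm is
   exactly [x ^+ N.+1]. *)
have kN : k = N.+1%:Z.
  have both := at_pinfty_and ephi (at_large_pinfty phik).
  have pz x (j : int) : 0 < x -> x ^ j = x `^ j%:~R.
    by move=> x0; rewrite powR_intmul // ltW.
  apply/eqP; rewrite eq_le -!(ler_int R); apply/andP; split.
    apply: (@powR_growth _ _ _ a1^-1); apply: at_pinfty_imp both => x [[x0 ->]].
    rewrite cabs_real gtr0_norm // -!pz // => /andP[lo _].
    by rewrite mulrC ler_pdivlMr // mulrC.
  apply: (@powR_growth _ _ _ a2); apply: at_pinfty_imp both => x [[x0 ->]].
  by rewrite cabs_real gtr0_norm // -!pz // => /andP[].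
(* If [F] vanished along the curve, points of arbitrarily large norm would be zeros of [F] on [S],
   although the sum of the norms of these finitely many zeros bounds each of them. *)
have [F0|[j [b1 [b2 [b10 b20 Fj]]]]] := vector_asymp Fphig.
  have [s sE] := (finite_seqP _).1 finF.
  have [x [[[x0 ex] xM] [Sx Fx]]] := at_pinfty_ex (at_pinfty_and
    (at_pinfty_and ephi (at_pinfty_gt (Num.max 1 (\sum_(z <- s) enorm z))))
    (at_large_pinfty (at_large_and Sphi F0))).
  move: xM; rewrite gt_max => /andP[x1 xM].
  have xs : phi (real_complex R x) \in s.
    suff : [set` s] (phi (real_complex R x)) by [].
    by rewrite -sE.
  have : enorm (phi (real_complex R x)) <= \sum_(z <- s) enorm z.
    by rewrite (big_rem _ xs) /= lerDl sumr_ge0 // => z _; apply: enorm_ge0.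
  rewrite ex leNgt; case/negP; apply: lt_le_trans xM _.
  by rewrite ler_eXnr // ltW.
(* At large real [x] the curve has norm [x ^+ N.+1] and its image has size comparable to [x ^ j]:
   the exponent is the quotient. *)
pose q : rat := j%:~R / N.+1%:R.
pose Q : R := ratr q.
have qE : Q = j%:~R / N.+1%:R by rewrite /Q /q rmorphM /= ratr_int fmorphV /=
  ratr_nat.
have powq x : 0 < x -> (x ^+ N.+1) `^ Q = x ^ j.
  move=> x0; rewrite -powR_mulrn ?(ltW x0) // -powRrM qE mulrC divfK
    ?pnatr_eq0 //.
  by rewrite powR_intmul // ltW.
have real_bounds : at_pinfty (fun x => [/\ 0 < x, S (phi (real_complex R x)),
    enorm (phi (real_complex R x)) = x ^+ N.+1,
    b1 * x ^ j <= enorm (F (phi (real_complex R x))) <= b2 * x ^ j &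
    forall w, S w -> enorm w = x ^+ N.+1 -> enorm (F (phi (real_complex R x)))
      <= enorm (F w)]).
  have := at_pinfty_and (at_pinfty_and mini ephi)
    (at_pinfty_and (at_large_pinfty Sphi) (at_large_pinfty Fj)).
  apply: at_pinfty_imp => x [[[_ xmin] [x0 ex]] [Sx]].
  rewrite cabs_real gtr0_norm // => Fx; split=> // w Sw ew.
  by rewrite !enormE ler_wsqrtr // xmin // -enorm_sqr ew.
(* A far point [z] of [S] shares its sphere with a point of the curve, at the parameter whose power
   [N.+1] is the norm of [z]; there [F] is smallest in norm, so [b1] serves as the constant for all
   of [S]. *)
have lojq : loj_set F S (Q).
  have [rho rhoP] := real_bounds; pose B := Num.max 1 rho.
  have B0 : 0 < B by rewrite lt_max ltr01.
  exists b1, (B ^+ N.+1); split=> //; first by rewrite exprn_gt0.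
  move=> z Sz zB; have z0 : 0 < enorm z by apply: lt_trans zB;
    rewrite exprn_gt0.
  pose x := enorm z `^ (N.+1%:R^-1).
  have xE : x ^+ N.+1 = enorm z.
    by rewrite -powR_mulrn ?powR_ge0 // -powRrM mulVf ?pnatr_eq0 // powRr1 //
      ltW.
  have xB : B < x.
    by move: zB; rewrite -xE ltr_pXn2r // nnegrE ?powR_ge0 // ltW.
  have [|x0 _ _ /andP[lo _] xmin] := rhoP x.
    by apply: le_lt_trans xB; rewrite le_max lexx orbT.
  by rewrite -xE powq // (le_trans lo) // xmin.
(* Tested on the curve, an admissible [nu] compares the powers of [x] with exponents [N.+1 * nu] and
   [j]. *)
have lojub nu : loj_set F S nu -> nu <= Q.
  move=> [A [B [A0 B0 AB]]]; rewrite qE ler_pdivlMr ?ltr0n // mulrC.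
  apply: (@powR_growth _ _ _ (b2 / A)).
  have := at_pinfty_and real_bounds (at_pinfty_gt (Num.max 1 B)).
  apply: at_pinfty_imp => x [[x0 Sx ex /andP[_ hi] _]];
    rewrite gt_max => /andP[x1 xB].
  have := AB _ Sx; rewrite ex => /(_ (lt_le_trans xB _)) ABx.
  rewrite powRrM powR_mulrn ?(ltW x0) // powR_intmul ?(ltW x0) //.
  rewrite mulrAC ler_pdivlMr // mulrC.
  by apply: le_trans hi; apply: ABx; rewrite ler_eXnr // ltW.
have lojE : loj_exp F S = (Q)%:E.
  apply/eqP; rewrite eq_le; apply/andP; split.
    by apply: ge_ereal_sup => _ [nu /lojub le_nu <-]; rewrite lee_fin.
  by apply: ereal_sup_ubound; exists (Q).
split; first by exists q.
rewrite lojE /=.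
have [r0 r0P] := at_large_and Sphi (at_large_and
  (@at_large_seq R _ (enum 'I_n) _ (fun i _ => (laurent_curve (d i) (f i)).1))
  (@at_large_seq R _ (enum 'I_n) _ (fun i _ => (laurent_curve (d i) (f i)).2))).
exists (Num.max 1 r0); first by rewrite lt_max ltr01.
have r0P' t : Num.max 1 r0 < cabs t -> r0 < cabs t.
  by apply: le_lt_trans; rewrite le_max lexx orbT.
have phiE i : (fun t => phi t 0 i) = (fun t => t ^+ d i * cev (f i) t).
  by apply/funext => t; rewrite mxE.
exists phi; split.
- move=> i; rewrite phiE; split.
    move=> t /r0P'/r0P[_ [dt _]]; apply: dt; exact: mem_enum.
  exists (d i), (f i) => t /r0P'/r0P[_ [_ lt]]; apply: lt; exact: mem_enum.
- by move=> t /r0P'/r0P[].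
- move=> M; have [r1 r1P] := at_large_and phik (at_large_gt (Num.max 1 (M /
  a1))).
  exists r1 => t /r1P[/andP[lo _]]; rewrite gt_max => /andP[t1 tM].
  apply: lt_le_trans lo; rewrite kN -exprnP.
  rewrite ltr_pdivrMr // mulrC in tM; apply: lt_le_trans tM _.
  by rewrite ler_pM2l // ler_eXnr // ltW.
(* These compare the power [Q] of the norm of [phi t] with [cabs t ^ j], to which the norm of
   [F (phi t)] is comparable as well. *)
pose m1 := Num.min (a1 `^ Q) (a2 `^ Q).
pose m2 := Num.max (a1 `^ Q) (a2 `^ Q).
have m10 : 0 < m1 by rewrite lt_min !powR_gt0.
have m20 : 0 < m2 by rewrite lt_max !powR_gt0.
exists (b1 / m2), (b2 / m1); split; rewrite ?divr_gt0 //.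
have := at_large_and (at_large_and phik Fj) (at_large_gt 0).
apply: at_large_imp => t [[/andP[lo hi] /andP[Flo Fhi]] t0].
rewrite kN -exprnP in lo hi; set T := cabs t ^ j in Flo Fhi.
have T0 : 0 < T by rewrite exprz_gt0.
have u0 : 0 < a1 * cabs t ^+ N.+1 by rewrite mulr_gt0 ?exprn_gt0.
have aT a : 0 < a -> (a * cabs t ^+ N.+1) `^ Q = a `^ Q * T.
  by move=> a0; rewrite powRM ?powq // ltW // exprn_gt0.
have /andP[] := powR_between (Q) u0 lo hi; rewrite !aT //.
set y := enorm (phi t) `^ _ => ylo yhi.
have ym1 : m1 * T <= y.
  by apply: le_trans ylo; rewrite le_min !ler_wpM2r ?(ltW T0) // ge_min lexx
    ?orbT.
have ym2 : y <= m2 * T.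
  by apply: le_trans yhi _; rewrite ge_max !ler_wpM2r ?(ltW T0) // le_max lexx
    ?orbT.
apply/andP; split.
  apply: le_trans Flo; rewrite mulrAC ler_pdivrMr // -mulrA ler_wpM2l ?(ltW
    b10) //.
  by rewrite mulrC.
apply: le_trans Fhi _; rewrite mulrAC ler_pdivlMr // -mulrA ler_wpM2l ?(ltW
  b20) //.
by rewrite mulrC.
Qed.
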